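(* Let $\Gamma$, $\mathfrak a$, $\eta$, $k$ and notation be as in the context. For all $m,n\in\mathbb Z$, $$c_{\mathfrak a}(n;P_{\eta,m})=\sum_{C\in C_{\eta\mathfrak a}}C^{-k/2}\,I_{\eta\,\mathrm{par}}\!\left(m,n;\frac1{2C}\right)S_{\eta\mathfrak a}(m,n;C).$$
   Context: $\Gamma\subset SL_2(\mathbb R)$ is a Fuchsian group of the first kind acting by linear fractional transformations; $k$ is an even integer, $k\geqslant4$; $j(\gamma,z)=cz+d$, $(f|_k\gamma)(z)=j(\gamma,z)^{-k}f(\gamma z)$; complex powers use the principal branch $-\pi<\arg z\le\pi$; $\mathbf e(z)=e^{2\pi iz}$. A cusp $\mathfrak a$ of $\Gamma$ has stabilizer $\Gamma_{\mathfrak a}$ and a fixed scaling matrix $\sigma_{\mathfrak a}\in SL_2(\mathbb R)$ with $\sigma_{\mathfrak a}\infty=\mathfrak a$, $\sigma_{\mathfrak a}^{-1}\overline\Gamma_{\mathfrak a}\sigma_{\mathfrak a}=\{\pm\begin{pmatrix}1&m\\0&1\end{pmatrix}:m\in\mathbb Z\}$ (bar = image in $PSL_2(\mathbb R)$); parabolic coefficients: $(f|_k\sigma_{\mathfrak a})(z)=\sum_nc_{\mathfrak a}(n;f)e^{2\pi inz}$. $\eta=(\eta_1,\eta_2)$ is an ordered hyperbolic fixed pair of $\Gamma$ (distinct points of $\mathbb R\cup\{\infty\}$ fixed by a hyperbolic element), $\Gamma_\eta$ the subgroup fixing both, $\sigma_\eta\in SL_2(\mathbb R)$ a fixed scaling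 matrix with $\sigma_\eta0=\eta_1,\sigma_\eta\infty=\eta_2$, and $\ell_\eta>0$ defined by $\sigma_\eta^{-1}\overline\Gamma_\eta\sigma_\eta=\{\pm\mathrm{diag}(e^{j\ell_\eta/2},e^{-j\ell_\eta/2}):j\in\mathbb Z\}$. $P_{\eta,m}(z)=\sum_{\gamma\in\Gamma_\eta\backslash\Gamma}(\sigma_\eta^{-1}\gamma z)^{-k/2+2\pi im/\ell_\eta}j(\sigma_\eta^{-1}\gamma,z)^{-k}$. $C_{\eta\mathfrak a}=\{ac:\begin{pmatrix}a&b\\c&d\end{pmatrix}\in\sigma_\eta^{-1}\Gamma\sigma_{\mathfrak a}\}$ and for $C\in C_{\eta\mathfrak a}$, $S_{\eta\mathfrak a}(m,n;C)=\sum\mathbf e\big(\frac m{\ell_\eta}\log|\frac ac|+n(\frac b{2a}+\frac d{2c})\big)$ over double cosets $\gamma\in\Gamma_\eta\backslash\Gamma/\Gamma_{\mathfrak a}$ with $\begin{pmatrix}a&b\\c&d\end{pmatrix}=\sigma_\eta^{-1}\gamma\sigma_{\mathfrak a}$, $ac=C$. For $r\in\mathbb R\setminus\{0\}$, $$I_{\eta\,\mathrm{par}}(m,n;r)=\int_{-\infty+iy}^{\infty+iy}\frac{\left(\mathrm{sgn}(r)\frac{u-r}{u+r}\right)^{2\pi im/\ell_\eta}e^{-2\pi inu}}{(u-r)^{k/2}(u+r)^{k/2}}\,du\quad(y>0).$$ *)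

(* Defs.v *)
From HB Require Import structures.
From mathcomp Require Import all_boot all_order all_algebra finmap.
From mathcomp Require Import all_classical all_reals all_analysis.
From mathcomp Require Import complex summability.

Set Implicit Arguments.
Unset Strict Implicit.
Unset Printing Implicit Defensive.

Import Order.TTheory GRing.Theory Num.Theory.
Import numFieldNormedType.Exports.
Import ComplexField.Normc.

Local Open Scope classical_set_scope.
Local Open Scope ring_scope.
Local Open Scope complex_scope.

Section UnorderedSums.
Context {R : realType} {I : choiceType}.
Implicit Types (A : set I) (f : I -> R[i]).

(* Partial sums of f over the finite subsets of A: the terms outside A are
   replaced by 0. The codomain R[i]^o carries the topology of R[i]. *)
Definition sums_over A f : {fset I} -> R[i]^o :=
  partial_sum (fun i => (if i \in A then f i else 0) : R[i]^o).

Definition has_sum A f (s : R[i]) : Prop :=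
  sums_over A f @ totally --> (s : R[i]^o).

Definition usum A f : R[i] := lim (sums_over A f @ totally).

End UnorderedSums.

Section ComplexFunctions.
Context {R : realType}.
Implicit Types z w : R[i].

(* The argument in ]-pi, pi]; it is only meaningful for z != 0. *)
Definition argc z : R :=
  if 0 <= complex.Im z then acos (complex.Re z / normc z) else - acos (complex.Re z / normc z).

Definition expc z : R[i] :=
  (expR (complex.Re z) * cos (complex.Im z)) +i* (expR (complex.Re z) * sin (complex.Im z)).

Definition logc z : R[i] := ln (normc z) +i* argc z.

Definition powc z w : R[i] := expc (w * logc z).

Definition e_ z : R[i] := expc ((0 +i* (2 * pi)) * z).

Definition upper_half : set R[i] := [set z | 0 < complex.Im z].

Definition integralc (f : R -> R[i]) : R[i] :=
  (\int[lebesgue_measure]_x complex.Re (f x)) +i* (\int[lebesgue_measure]_x complex.Im (f x)).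

(* Integral over the horizontal line Im u = y, from left to right. *)
Definition hline_integral (y : R) (f : R[i] -> R[i]) : R[i] :=
  integralc (fun x => f (x +i* y)).

End ComplexFunctions.

Section SL2.
Context {R : realType}.
Implicit Types (g s : 'M[R]_2) (G : set 'M[R]_2) (z : R[i]) (x : option R).

Definition mx2 (a b c d : R) : 'M[R]_2 :=
  \matrix_(i, j) if i == 0 then (if j == 0 then a else b)
                 else (if j == 0 then c else d).

Definition SL2 : set 'M[R]_2 := [set g | \det g = 1].

Definition subgroup_SL2 G : Prop :=
  [/\ G `<=` SL2, G 1%:M,
      forall g h, G g -> G h -> G (g *m h) &
      forall g, G g -> G (invmx g)].

Definition jfac g z : R[i] := (g 1 0)%:C * z + (g 1 1)%:C.

Definition moebius g z : R[i] :=
  ((g 0 0)%:C * z + (g 0 1)%:C) / jfac g z.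

(* The boundary R \cup {oo} is option R, with None standing for oo. *)
Definition moebius_bd g x : option R :=
  match x with
  | Some t => if g 1 0 * t + g 1 1 == 0 then None
              else Some ((g 0 0 * t + g 0 1) / (g 1 0 * t + g 1 1))
  | None => if g 1 0 == 0 then None else Some (g 0 0 / g 1 0)
  end.

Definition boundary_limit_point G x : Prop :=
  exists2 z, upper_half z &
    match x with
    | Some t => forall e : R, 0 < e ->
                  exists2 g, G g & normc (moebius g z - t%:C) < e
    | None => forall M : R, exists2 g, G g & M < normc (moebius g z)
    end.

Definition fuchsian_first_kind G : Prop :=
  [/\ subgroup_SL2 G, G `<=` isolated G & forall x, boundary_limit_point G x].

Definition parabolic g : Prop :=
  [/\ g <> 1%:M, g <> - 1%:M & `|\tr g| = 2].

Definition hyperbolic g : Prop := 2 < `|\tr g|.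

Definition stab G x : set 'M[R]_2 := [set g | G g /\ moebius_bd g x = x].

Definition stab2 G (eta : option R * option R) : set 'M[R]_2 :=
  stab G eta.1 `&` stab G eta.2.

Definition is_cusp G x : Prop := exists2 g, stab G x g & parabolic g.

Definition hyperbolic_pair G (eta : option R * option R) : Prop :=
  eta.1 <> eta.2 /\ exists2 g, stab2 G eta g & hyperbolic g.

(* Preimage in SL_2(R) of the image of A in PSL_2(R). *)
Definition pm (A : set 'M[R]_2) : set 'M[R]_2 := [set g | A g \/ A (- g)].

Definition conj_set s (A : set 'M[R]_2) : set 'M[R]_2 :=
  [set invmx s *m g *m s | g in A].

Definition scaling_cusp G (a : option R) s : Prop :=
  [/\ SL2 s, moebius_bd s None = a &
      pm (conj_set s (stab G a)) =
      pm [set mx2 1 m%:~R 0 1 | m in [set: int]]].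

Definition scaling_pair G (eta : option R * option R) s (l : R) : Prop :=
  [/\ SL2 s, moebius_bd s (Some 0) = eta.1, moebius_bd s None = eta.2 &
      pm (conj_set s (stab2 G eta)) =
      pm [set mx2 (expR (j%:~R * l / 2)) 0 0 (expR (- (j%:~R * l / 2)))
         | j in [set: int]]].

Definition lcosets (H G : set 'M[R]_2) : set (set 'M[R]_2) :=
  [set [set h *m g | h in H] | g in G].

Definition dcosets (H G K : set 'M[R]_2) : set (set 'M[R]_2) :=
  [set [set h *m g *m u | h in H & u in K] | g in G].

(* Some element of a (nonempty) coset. *)
Definition repr_of (A : set 'M[R]_2) : 'M[R]_2 := xget 1%:M A.

End SL2.

Section Poincare.
Context {R : realType}.
Variable k : nat.
Implicit Types (s sa se : 'M[R]_2) (G : set 'M[R]_2) (m n : int) (l : R).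

Definition slash (f : R[i] -> R[i]) s (z : R[i]) : R[i] :=
  jfac s z ^- k * f (moebius s z).

Definition parabolic_expansion sa (f : R[i] -> R[i]) (c : int -> R[i]) : Prop :=
  forall z, upper_half z ->
    has_sum [set: int] (fun n => c n * e_ (n%:~R * z)) (slash f sa z).

Definition parabolic_coeff sa (f : R[i] -> R[i]) : int -> R[i] :=
  xget (fun=> 0) [set c | parabolic_expansion sa f c].

Definition twist l m : R[i] := 0 +i* (2 * pi * m%:~R / l).

(* For even k the summand depends only on the coset of g, not on the chosen
   representative. *)
Definition poincare_hyp G (eta : option R * option R) se l m (z : R[i]) : R[i] :=
  usum (lcosets (stab2 G eta) G) (fun A =>
    let g := invmx se *m repr_of A in
    powc (moebius g z) (- (k%:R / 2) + twist l m) * jfac g z ^- k).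

Definition C_set G se sa : set R :=
  [set g 0 0 * g 1 0 | g in [set invmx se *m g *m sa | g in G]].

Definition I_par (y l : R) m n (r : R) : R[i] :=
  hline_integral y (fun u =>
    powc ((Num.sg r)%:C * ((u - r%:C) / (u + r%:C))) (twist l m)
    * e_ (- (n%:~R * u))
    / ((u - r%:C) ^+ k./2 * (u + r%:C) ^+ k./2)).

End Poincare.

Section Kloosterman.
Context {R : realType}.
Implicit Types (sa se : 'M[R]_2) (G : set 'M[R]_2).

(* Neither the condition a * c = C nor the summand depends on the chosen
   representative of the double coset. *)
Definition S_sum G (eta : option R * option R) (a : option R) se sa (l : R)
    (m n : int) (C : R) : R[i] :=
  let D A := invmx se *m repr_of A *m sa in
  usum [set A | dcosets (stab2 G eta) G (stab G a) A /\ D A 0 0 * D A 1 0 = C]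
    (fun A =>
       let g := D A in
       e_ (m%:~R / l * ln `|g 0 0 / g 1 0|
           + n%:~R * (g 0 1 / (2 * g 0 0) + g 1 1 / (2 * g 1 0)))%:C).

End Kloosterman.

(* Main.v *)
Require Import Defs.
From mathcomp Require Import all_boot all_order all_algebra finmap.
From mathcomp Require Import all_classical all_reals all_analysis.
From mathcomp Require Import complex summability measurable_realfun zify ring lra.

(* Let [g] run over [se^-1 G sa], with entries [a], [b], [c], [d], and put
   [q = k / 2] and [tau = 2 pi m / l]. Up to a constant the summand of the
   Poincare series at [sa z] is [(z + b/a)^(- q + i tau) (z + d/c)^(- q - i tau)],
   a function of the left coset of [g]; replacing [g] by [g T^j] shifts [z] by
   [j]. The left cosets correspond to pairs of a double coset and an integer
   [j], so summing the integrals over [[j, j + 1]] over all [j] gives the integral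
   over a horizontal line defining [I_par], once [z] is translated by
   [b/2a + d/2c].

   Convergence: the summand at [i] is [O(1 / (M N))], where [M] and [N] are the
   squared lengths of the two rows of [g]. Modulo the hyperbolic stabilizer one
   may take [M / N] bounded above and below; covering the half plane by dyadic
   hyperbolic cells, each of which contains a bounded number of orbit points
   because the group is discrete, reduces the sum to [sum 1 / n^2].

   Fourier expansion: a 1-periodic function [h] with a locally uniform second
   order Taylor expansion is recovered exactly from its finite Fourier
   coefficients over [N] equally spaced points. As [N] tends to infinity these
   converge to limits that do not depend on the base point (a telescoping
   version of Cauchy's theorem), and second differences bound the [n]-th one by
   [O(1 / n^2)], so dominated convergence gives the expansion. *)

Set Implicit Arguments.
Unset Strict Implicit.
Unset Printing Implicit Defensive.

Import Order.TTheory GRing.Theory Num.Theory.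
Import numFieldNormedType.Exports.
Import ComplexField.Normc.

Local Open Scope classical_set_scope.
Local Open Scope ring_scope.
Local Open Scope complex_scope.

(** * Unordered sums *)

Section Normc.
Context {R : realType}.
Implicit Types z w : R[i].

(** Each series in the statement is a limit along finite subsets with a default value in case of
    divergence, and [parabolic_coeff] is selected among all expansions. Hence absolute convergence
    precedes every rearrangement, the expansion needs both existence and uniqueness, and limits pass
    through sums by dominated convergence ([tannery]).

    The powers are principal, and a power of a quotient need not be a quotient of powers. Here
    [z + b/a], [z + d/c] and [moebius g z] all have arguments in []0, pi[], which leaves a branch
    constant depending only on the sign of [a / c]. Since [a / c], [C = a c] and [r = 1 / (2 C)]
    share their sign, it is the constant hidden in the factor [sgn r] of [I_par]. The value
    [1 / (2 C)] is half of [d/c - b/a], because [a d - b c = 1].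

    Discreteness enters a second time to show that [a] and [c] do not vanish: no point is fixed by
    both a parabolic and a hyperbolic element.

    [G] need not contain [-1], and the scaling conditions describe the stabilizers only up to sign,
    hence the relation [sim]; for even [k] the summand does not see the sign. *)

Lemma normcD z w : normc (z + w) <= normc z + normc w.
Proof. exact: (@ler_normD _ (Rcomplex R)). Qed.

Lemma normc_ge0 z : 0 <= normc z.
Proof. exact: (@normr_ge0 _ (Rcomplex R)). Qed.

Lemma normcN z : normc (- z) = normc z.
Proof. exact: (@normrN _ (Rcomplex R)). Qed.

Lemma normcB z w : normc (z - w) <= normc z + normc w.
Proof. by rewrite -(normcN w) normcD. Qed.

Lemma distcC z w : normc (z - w) = normc (w - z).
Proof. by rewrite -normcN opprB. Qed.

Lemma distcD u z w : normc (z - w) <= normc (z - u) + normc (u - w).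
Proof. by rewrite -[z - w](subrKA u) normcD. Qed.

Lemma normc_eq0 z : (normc z == 0) = (z == 0).
Proof. exact: (@normr_eq0 _ (Rcomplex R)). Qed.

Lemma normc_gt0 z : (0 < normc z) = (z != 0).
Proof. by rewrite lt_neqAle normc_ge0 andbT eq_sym normc_eq0. Qed.

Lemma normcX z n : normc (z ^+ n) = normc z ^+ n.
Proof.
by elim: n => [|n IH]; rewrite ?expr0 ?normc1// !exprS normcM IH.
Qed.

Lemma normcR (x : R) : normc x%:C = `|x|.
Proof. by rewrite /= expr0n addr0 sqrtr_sqr. Qed.

Lemma normc_nat n : normc (n%:R : R[i]) = n%:R.
Proof. by rewrite -(rmorph_nat (real_complex R)) normcR ger0_norm. Qed.

Lemma normrcE z : `|z| = (normc z)%:C.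
Proof. by case: z. Qed.

Lemma normc_sqr z : normc z ^+ 2 = complex.Re z ^+ 2 + complex.Im z ^+ 2.
Proof. by case: z => a b; rewrite sqr_sqrtr// addr_ge0 ?sqr_ge0. Qed.

Lemma Re_le_normc z : `|complex.Re z| <= normc z.
Proof.
case: z => a b /=; rewrite -sqrtr_sqr ler_sqrt ?lerDl ?sqr_ge0//.
by rewrite addr_ge0 ?sqr_ge0.
Qed.

Lemma Im_le_normc z : `|complex.Im z| <= normc z.
Proof.
case: z => a b /=; rewrite -sqrtr_sqr ler_sqrt ?lerDr ?sqr_ge0//.
by rewrite addr_ge0 ?sqr_ge0.
Qed.

Lemma normc_le_ReIm z : normc z <= `|complex.Re z| + `|complex.Im z|.
Proof.
rewrite -ler_sqr ?nnegrE ?normc_ge0 ?addr_ge0// normc_sqr sqrrD !real_normK ?num_real//.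
by rewrite lerD2r lerDl mulrn_wge0// mulr_ge0.
Qed.

Lemma Re_add z w : complex.Re (z + w) = complex.Re z + complex.Re w.
Proof. by case: z w => a b []. Qed.
Lemma Im_add z w : complex.Im (z + w) = complex.Im z + complex.Im w.
Proof. by case: z w => a b []. Qed.
Lemma Re_opp z : complex.Re (- z) = - complex.Re z.
Proof. by case: z. Qed.
Lemma Im_opp z : complex.Im (- z) = - complex.Im z.
Proof. by case: z. Qed.
Lemma Re_mul z w : complex.Re (z * w) =
  complex.Re z * complex.Re w - complex.Im z * complex.Im w.
Proof. by case: z w => a b []. Qed.
Lemma Im_mul z w : complex.Im (z * w) =
  complex.Re z * complex.Im w + complex.Im z * complex.Re w.
Proof. by case: z w => a b []. Qed.

Lemma complexP z w : complex.Re z = complex.Re w ->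
  complex.Im z = complex.Im w -> z = w.
Proof. by case: z w => a b [c d] /= -> ->. Qed.

Lemma normc_sum (I : Type) (r : seq I) (P : pred I) (F : I -> R[i]) :
  normc (\sum_(i <- r | P i) F i) <= \sum_(i <- r | P i) normc (F i).
Proof. exact: (@ler_norm_sum _ (Rcomplex R)). Qed.

Lemma Re_sum (I : Type) (r : seq I) (P : pred I) (F : I -> R[i]) :
  complex.Re (\sum_(i <- r | P i) F i) = \sum_(i <- r | P i) complex.Re (F i).
Proof. by elim/big_ind2: _ => // x1 x2 y1 y2 <- <-; rewrite Re_add. Qed.

Lemma Im_sum (I : Type) (r : seq I) (P : pred I) (F : I -> R[i]) :
  complex.Im (\sum_(i <- r | P i) F i) = \sum_(i <- r | P i) complex.Im (F i).
Proof. by elim/big_ind2: _ => // x1 x2 y1 y2 <- <-; rewrite Im_add. Qed.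

End Normc.

#[local] Existing Instance totally_filter.

Section UnorderedSums.
Context {R : realType}.
Implicit Types I : choiceType.

Definition sums I (f : I -> R[i]) (s : R[i]) := forall e : R, 0 < e ->
  exists J0 : {fset I}, forall J : {fset I}, (J0 `<=` J)%fset ->
    normc (\sum_(i <- J) f i - s) <= e.

Definition bounded_sums I (g : I -> R) (M : R) :=
  forall J : {fset I}, \sum_(i <- J) g i <= M.

Definition restr I (A : set I) (f : I -> R[i]) i : R[i] := if i \in A then f i else 0.

Lemma has_sumE I (A : set I) f s : has_sum A f s <-> sums (restr A f) s.
Proof.
rewrite /has_sum /sums_over; split => [/cvgrPdist_lt h e e0|h].
  have /h[J0 _ hJ] : 0 < (e%:C : R[i]) by rewrite ltcR.
  exists J0 => J /hJ/=; rewrite /partial_sum -(big_seq_fsetE _ _ xpredT (restr A f)).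
  by rewrite normrcE ltcR distcC => /ltW.
apply/cvgrPdist_lt => e e0.
have eE : e = (complex.Re e)%:C.
  by move: e0; rewrite ltcE => /andP[/eqP]; case: (e) => a b /= ->.
have re0 : 0 < complex.Re e by move: e0; rewrite eE ltcR.
have [|J0 hJ] := h (complex.Re e / 2); first by rewrite divr_gt0.
exists J0 => //= J /hJ/= {}hJ; rewrite /partial_sum.
rewrite -(big_seq_fsetE _ _ xpredT (restr A f)) eE normrcE ltcR distcC.
by apply: le_lt_trans hJ _; lra.
Qed.

Lemma restrT I (f : I -> R[i]) : restr setT f = f.
Proof. by apply/funext => i; rewrite /restr in_setT. Qed.

Lemma has_sumT I (f : I -> R[i]) s : has_sum setT f s <-> sums f s.
Proof. by rewrite has_sumE restrT. Qed.

Lemma sums_unique I (f : I -> R[i]) s t : sums f s -> sums f t -> s = t.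
Proof.
move=> fs ft; apply/eqP; rewrite -subr_eq0 -normc_eq0 eq_le normc_ge0 andbT.
apply/ler_addgt0Pr => e e0; rewrite add0r.
have [J0 h0] := fs _ (divr_gt0 e0 (ltr0n _ 2)).
have [J1 h1] := ft _ (divr_gt0 e0 (ltr0n _ 2)).
rewrite (le_trans (distcD (\sum_(i <- (J0 `|` J1)%fset) f i) _ _))//.
rewrite [leRHS]splitr distcC.
by apply: lerD; [apply: h0; exact: fsubsetUl|apply: h1; exact: fsubsetUr].
Qed.

Lemma usumE I (A : set I) (f : I -> R[i]) s : has_sum A f s -> usum A f = s.
Proof. by move=> /(cvg_lim (@norm_hausdorff _ _)). Qed.

Lemma sums_lin I (f g : I -> R[i]) (c s t : R[i]) :
  sums f s -> sums g t -> sums (fun i => c * f i + g i) (c * s + t).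
Proof.
move=> fs gt e e0; have c0 : 0 < normc c + 1 by rewrite ltr_wpDl ?normc_ge0.
have e2 : 0 < e / 2 by rewrite divr_gt0.
have [J0 h0] := fs _ (divr_gt0 e2 c0).
have [J1 h1] := gt _ e2.
exists (J0 `|` J1)%fset => J; rewrite fsubUset => /andP[/h0{}h0 /h1{}h1].
rewrite big_split/= -mulr_sumr.
rewrite [X in normc X](_ : _ = c * (\sum_(i <- J) f i - s) + (\sum_(i <- J) g i - t));
  last by ring.
rewrite (le_trans (normcD _ _))// [leRHS]splitr lerD// normcM.
rewrite (le_trans (ler_wpM2l (normc_ge0 _) h0))// mulrCA ler_piMr ?(ltW e2)//.
by rewrite ler_pdivrMr// mul1r lerDl.
Qed.

Lemma sums_cst0 I : sums (fun _ : I => 0 : R[i]) 0.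
Proof.
by move=> e e0; exists fset0 => J _; rewrite big1// subrr normc0 ltW.
Qed.

Lemma sumsZ I (f : I -> R[i]) (c s : R[i]) : sums f s -> sums (fun i => c * f i) (c * s).
Proof.
move=> fs; have := @sums_lin _ _ _ c _ _ fs (sums_cst0 I); rewrite addr0.
by under eq_fun do rewrite addr0.
Qed.

Lemma sums_sum (N : nat) I (f : nat -> I -> R[i]) (s : nat -> R[i]) :
  (forall n, sums (f n) (s n)) ->
  sums (fun i => \sum_(n < N) f n i) (\sum_(n < N) s n).
Proof.
move=> fs; elim: N => [|N IH].
  by rewrite big_ord0; under eq_fun do rewrite big_ord0; exact: sums_cst0.
rewrite big_ord_recr/= addrC; under eq_fun do rewrite big_ord_recr/= addrC.
have := @sums_lin _ _ _ 1 _ _ (fs N) IH.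
by rewrite mul1r; under eq_fun do rewrite mul1r.
Qed.

Lemma fsum_subset (V : nmodType) I (f : I -> V) (J0 J : {fset I}) : (J0 `<=` J)%fset ->
  \sum_(i <- J) f i = \sum_(i <- J0) f i + \sum_(i <- (J `\` J0)%fset) f i.
Proof.
move=> JJ; rewrite (big_fsetID _ (mem J0)) /=; congr (_ + _); apply: eq_fbigl.
  by move=> i; rewrite !inE/= andbC; case: (boolP (i \in J0)) => // /(fsubsetP JJ) ->.
by move=> i; rewrite !inE/= andbC.
Qed.

Lemma sums_nonneg I (g : I -> R) M : (forall i, 0 <= g i) -> bounded_sums g M ->
  exists2 S : R, S <= M & (forall J : {fset I}, \sum_(i <- J) g i <= S) /\
  forall e, 0 < e -> exists J0 : {fset I}, S - e <= \sum_(i <- J0) g i.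
Proof.
move=> g0 gM; pose E := [set \sum_(i <- J) g i | J in [set: {fset I}]].
have hE : has_sup E.
  by split; [exists (\sum_(i <- fset0) g i), fset0|exists M => _ [J _ <-]].
exists (sup E); first by apply: ge_sup; [exact: hE.1|move=> _ [J _ <-]].
split=> [J|e e0]; first by apply: sup_upper_bound => //; exists J.
have [_ [J _ <-] h] := sup_adherent e0 hE.
by exists J; exact: ltW.
Qed.

Lemma sum_tail I (g : I -> R) M e : (forall i, 0 <= g i) -> bounded_sums g M ->
  0 < e -> exists J0 : {fset I}, forall J : {fset I}, [disjoint J0 & J]%fset ->
    \sum_(i <- J) g i <= e.
Proof.
move=> g0 gM e0; have [S _ [gS /(_ _ e0)[J0 h0]]] := sums_nonneg g0 gM.
exists J0 => J dJ; have := gS (J0 `|` J)%fset.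
rewrite (fsum_subset _ (fsubsetUl J0 J)) => h.
have -> : \sum_(i <- J) g i = \sum_(i <- ((J0 `|` J) `\` J0)%fset) g i.
  apply: eq_fbigl => i; rewrite !inE; case: (boolP (i \in J0)) => //= iJ.
  by move/fdisjointP : dJ => /(_ _ iJ)/negbTE ->.
by have := le_trans (lerD h0 (lexx _)) h; lra.
Qed.

Lemma sumsR_exists I (g : I -> R) M : (forall i, 0 <= g i) -> bounded_sums g M ->
  exists s, sums (fun i => (g i)%:C) s.
Proof.
move=> g0 gM; have [S _ [gS h]] := sums_nonneg g0 gM.
exists S%:C => e /h[J0 h0]; exists J0 => J JJ.
rewrite -rmorph_sum -rmorphB normcR ler0_norm ?subr_le0//.
have : 0 <= \sum_(i <- (J `\` J0)%fset) g i by exact: sumr_ge0.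
have := fsum_subset g JJ; lra.
Qed.

(** The positive and negative parts of the real and imaginary parts are nonnegative families bounded
    by [normc (f i)]; for these the supremum of the finite sums is the limit. *)
Lemma sums_exists I (f : I -> R[i]) M :
  bounded_sums (fun i => normc (f i)) M -> exists s, sums f s.
Proof.
move=> fM.
have bnd g : (forall i, 0 <= g i) -> (forall i, g i <= normc (f i)) ->
    exists s, sums (fun i => (g i)%:C) s.
  move=> g0 gf; apply: (@sumsR_exists _ _ M) => // J.
  by apply: le_trans (fM J); exact: ler_sum.
have part g : (forall i, `|g i| <= normc (f i)) -> exists s, sums (fun i => (g i)%:C) s.
  move=> gf.
  have [||s hs] := bnd (fun i => Num.max (g i) 0).
  - by move=> i; rewrite le_max lexx orbT.
  - by move=> i; rewrite ge_max normc_ge0 andbT (le_trans (ler_norm _)).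
  have [||t ht] := bnd (fun i => Num.max (- g i) 0).
  - by move=> i; rewrite le_max lexx orbT.
  - by move=> i; rewrite ge_max normc_ge0 andbT (le_trans (ler_norm _))// normrN.
  exists ((-1) * t + s); have := sums_lin (-1) ht hs.
  congr sums; apply/funext => i; rewrite mulN1r -rmorphN -rmorphD; congr _%:C.
  by rewrite !maxElt; case: ifP; case: ifP; lra.
have [s hs] := part _ (fun i => Re_le_normc (f i)).
have [t ht] := part _ (fun i => Im_le_normc (f i)).
exists ((0 +i* 1) * t + s); have := sums_lin (0 +i* 1) ht hs.
by congr sums; apply/funext => i; case: (f i) => x y; apply: complexP => /=; ring.
Qed.

Lemma sums_near I (f : I -> R[i]) s (J0 : {fset I}) e : sums f s ->
  (forall J : {fset I}, [disjoint J0 & J]%fset -> \sum_(i <- J) normc (f i) <= e) ->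
  normc (s - \sum_(i <- J0) f i) <= e.
Proof.
move=> fs h; apply/ler_addgt0Pr => d d0; have [J1 h1] := fs _ d0.
rewrite (le_trans (distcD (\sum_(i <- (J0 `|` J1)%fset) f i) _ _))// addrC lerD//.
  rewrite (fsum_subset _ (fsubsetUl J0 J1)) addrAC subrr add0r.
  apply: le_trans (normc_sum _ _ _) (h _ _).
  by apply/fdisjointP => i iJ; rewrite !inE iJ.
by rewrite distcC h1// fsubsetUr.
Qed.

Lemma sums_norm_le I (f : I -> R[i]) s M : sums f s ->
  bounded_sums (fun i => normc (f i)) M -> normc s <= M.
Proof.
move=> fs fM; have := @sums_near _ f s fset0 M fs.
by rewrite big_seq_fset0 subr0; apply => J _; exact: fM.
Qed.

Lemma bounded_sumsW I (f g : I -> R) M : (forall i, f i <= g i) ->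
  bounded_sums g M -> bounded_sums f M.
Proof. by move=> fg gM J; apply: le_trans (gM J); exact: ler_sum. Qed.

Lemma bounded_sums_ge0 I (g : I -> R) M : bounded_sums g M -> 0 <= M.
Proof. by move/(_ fset0); rewrite big_seq_fset0. Qed.

Lemma bounded_sumsZ I (g : I -> R) M K : 0 <= K ->
  bounded_sums g M -> bounded_sums (fun i => K * g i) (K * M).
Proof. by move=> K0 gM J; rewrite -mulr_sumr ler_wpM2l. Qed.

(** Unconditional convergence is absolute in finite dimension. Finite sums away from [J0] have norm
    at most 2; splitting the index set by the sign of the real part, and separately of the imaginary
    part, bounds each sum of absolute values by [2 + 2]. *)
Lemma sums_bounded I (f : I -> R[i]) s : sums f s ->
  exists M, bounded_sums (fun i => normc (f i)) M.
Proof.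
move=> fs; have [J0 h0] := fs 1 ltr01.
have h (J : {fset I}) : [disjoint J0 & J]%fset -> normc (\sum_(i <- J) f i) <= 2.
  move=> dJ; have := fsum_subset f (fsubsetUl J0 J).
  have -> : \sum_(i <- ((J0 `|` J) `\` J0)%fset) f i = \sum_(i <- J) f i.
    apply: eq_fbigl => i; rewrite !inE; case: (boolP (i \in J0)) => //= iJ.
    by move/fdisjointP : dJ => /(_ _ iJ)/negbTE ->.
  move/eqP; rewrite addrC -subr_eq => /eqP <-.
  rewrite (le_trans (distcD s _ _))//; have -> : 2 = 1 + 1 :> R by lra.
  apply: lerD.
    by rewrite h0// fsubsetUl.
  by rewrite distcC h0.
have hp (g : I -> R) (J : {fset I}) : (forall J' : {fset I}, [disjoint J0 & J']%fset -> `|\sum_(i <- J') g i| <= 2) ->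
    [disjoint J0 & J]%fset -> \sum_(i <- J) `|g i| <= 4.
  move=> hg dJ; rewrite (big_fsetID _ (fun i => 0 <= g i)) /=.
  have dJ' P : [disjoint J0 & [fset i in J | P i]]%fset.
    apply/fdisjointP => i iJ; rewrite !inE negb_and.
    by move/fdisjointP : dJ => /(_ _ iJ) ->.
  have -> : 4 = 2 + 2 :> R by lra.
  apply: lerD.
    rewrite (le_trans _ (hg _ (dJ' (fun i => 0 <= g i))))//.
    rewrite (le_trans _ (ler_norm _))// big_seq [leRHS]big_seq.
    by apply: ler_sum => i; rewrite !inE => /andP[_ g0]; rewrite ger0_norm.
  rewrite (le_trans _ (hg _ (dJ' (fun i => ~~ (0 <= g i)))))// -normrN.
  rewrite (le_trans _ (ler_norm _))// -sumrN big_seq [leRHS]big_seq.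
  apply: ler_sum => i; rewrite !inE -ltNge => /andP[_ g0].
  by rewrite ltr0_norm.
exists (\sum_(i <- J0) normc (f i) + 8) => J.
have -> : \sum_(i <- J) normc (f i) = \sum_(i <- (J `&` J0)%fset) normc (f i)
    + \sum_(i <- (J `\` J0)%fset) normc (f i).
  rewrite (fsum_subset _ (fsubsetIl J J0)); congr (_ + _); apply: eq_fbigl => i.
  by rewrite !inE; case: (i \in J); rewrite ?andbF ?andbT.
apply: lerD.
  rewrite (fsum_subset _ (fsubsetIr J J0)) lerDl.
  by apply: sumr_ge0 => i _; exact: normc_ge0.
have dJ : [disjoint J0 & J `\` J0]%fset by apply/fdisjointP => i iJ; rewrite !inE iJ.
rewrite (@le_trans _ _ (\sum_(i <- (J `\` J0)%fset) (`|complex.Re (f i)| + `|complex.Im (f i)|)))//.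
  by apply: ler_sum => i _; exact: normc_le_ReIm.
rewrite big_split/=; have -> : 8 = 4 + 4 :> R by lra.
apply: lerD.
  apply: hp dJ => J' /h {}h; move: h; apply: le_trans; rewrite -Re_sum; exact: Re_le_normc.
apply: hp dJ => J' /h {}h; move: h; apply: le_trans; rewrite -Im_sum; exact: Im_le_normc.
Qed.

Definition clim (u : nat -> R[i]) (l : R[i]) := forall e : R, 0 < e ->
  exists N0, forall n, (N0 <= n)%N -> normc (u n - l) <= e.

Lemma clim_unique u s t : clim u s -> clim u t -> s = t.
Proof.
move=> us ut; apply/eqP; rewrite -subr_eq0 -normc_eq0 eq_le normc_ge0 andbT.
apply/ler_addgt0Pr => e e0; rewrite add0r.
have [N0 h0] := us _ (divr_gt0 e0 (ltr0n _ 2)).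
have [N1 h1] := ut _ (divr_gt0 e0 (ltr0n _ 2)).
rewrite (le_trans (distcD (u (maxn N0 N1)) _ _))//.
by rewrite [leRHS]splitr distcC lerD ?h0 ?h1 ?leq_maxl ?leq_maxr.
Qed.

Lemma clim_norm_le u l M : clim u l ->
  (exists N0, forall n, (N0 <= n)%N -> normc (u n) <= M) -> normc l <= M.
Proof.
move=> ul [N1 uM]; apply/ler_addgt0Pr => e e0; have [N0 h0] := ul _ e0.
rewrite -[l](subrK (u (maxn N0 N1))) addrC (le_trans (normcD _ _))// lerD ?uM ?leq_maxr//.
by rewrite distcC h0 ?leq_maxl.
Qed.

Lemma clim_cst c : clim (fun=> c) c.
Proof. by move=> e e0; exists 0%N => n _; rewrite subrr normc0 ltW. Qed.

Lemma clim_lin u v (c s t : R[i]) : clim u s -> clim v t ->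
  clim (fun n => c * u n + v n) (c * s + t).
Proof.
move=> us vt e e0; have c0 : 0 < normc c + 1 by rewrite ltr_wpDl ?normc_ge0.
have e2 : 0 < e / 2 by rewrite divr_gt0.
have [N0 h0] := us _ (divr_gt0 e2 c0).
have [N1 h1] := vt _ e2.
exists (maxn N0 N1) => n; rewrite geq_max => /andP[/h0{}h0 /h1{}h1].
rewrite [X in normc X](_ : _ = c * (u n - s) + (v n - t)); last by ring.
rewrite (le_trans (normcD _ _))// [leRHS]splitr lerD// normcM.
rewrite (le_trans (ler_wpM2l (normc_ge0 _) h0))// mulrCA ler_piMr ?(ltW e2)//.
by rewrite ler_pdivrMr// mul1r lerDl.
Qed.

Lemma clim_sum I (r : seq I) (u : nat -> I -> R[i]) (l : I -> R[i]) :
  (forall i, clim (u^~ i) (l i)) ->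
  clim (fun n => \sum_(i <- r) u n i) (\sum_(i <- r) l i).
Proof.
move=> ul; elim: r => [|i r IH].
  by rewrite big_nil; under eq_fun do rewrite big_nil; exact: clim_cst.
rewrite big_cons; under eq_fun do rewrite big_cons.
have := @clim_lin _ _ 1 _ _ (ul i) IH.
by rewrite mul1r; under eq_fun do rewrite mul1r.
Qed.

(** Outside a finite set [J0] the dominating family sums to at most [e / 3], uniformly in [n]; on
    [J0] the limit is that of a finite sum. Summability of the limit family is part of the
    conclusion. *)
Lemma tannery I (f : nat -> I -> R[i]) (F : I -> R[i]) (g : I -> R) M (s : nat -> R[i]) :
  (forall n i, normc (f n i) <= g i) -> bounded_sums g M ->
  (forall i, clim (f^~ i) (F i)) -> (forall n, sums (f n) (s n)) ->
  exists2 S, sums F S & clim s S.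
Proof.
move=> fg gM fF fs.
have g0 i : 0 <= g i by apply: le_trans (fg 0%N i); exact: normc_ge0.
have Fg i : normc (F i) <= g i by apply: clim_norm_le (fF i) _; exists 0%N.
have [S FS] := sums_exists (bounded_sumsW Fg gM).
exists S => // e e0; have e3 : 0 < e / 3 by rewrite divr_gt0.
have [J0 h0] := sum_tail g0 gM e3.
have [N0 hN] := clim_sum J0 fF e3.
exists N0 => n /hN hn.
have t1 : normc (s n - \sum_(i <- J0) f n i) <= e / 3.
  by apply: sums_near => // J /h0; apply: le_trans; exact: ler_sum.
have t2 : normc (S - \sum_(i <- J0) F i) <= e / 3.
  by apply: sums_near => // J /h0; apply: le_trans; exact: ler_sum.
have h1 := distcD (\sum_(i <- J0) f n i) (s n) S.
have h2 := distcD (\sum_(i <- J0) F i) (\sum_(i <- J0) f n i) S.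
rewrite distcC in t2; lra.
Qed.

Lemma sums_partition I (J : choiceType) (p : I -> J) (f : I -> R[i]) (g : J -> R[i]) s :
  (forall j, sums (fun i => if p i == j then f i else 0) (g j)) ->
  sums f s -> sums g s.
Proof.
move=> fg fs e e0; have e2 : 0 < e / 2 by rewrite divr_gt0.
have [J0 h0] := fs _ e2.
exists [fset p i | i in J0]%fset => K hK.
(* The tolerance [e / 2] is shared among the fibres over [K]; the [+ 1] covers an empty [K]. *)
pose d := e / 2 / (#|` K |%:R + 1).
have K0 : 0 < #|` K |%:R + 1 :> R by rewrite ltr_wpDl.
have d0 : 0 < d by rewrite divr_gt0.
have [F hF] := choice (fun j => fg j d d0).
pose F0 := (J0 `|` \bigcup_(j <- K) F j)%fset.
pose F1 := [fset i in F0 | p i \in K]%fset.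
have JF : (J0 `<=` F1)%fset.
  apply/fsubsetP => i iJ; rewrite !inE iJ/= (fsubsetP hK)//.
  by apply/imfsetP; exists i.
rewrite (le_trans (distcD (\sum_(i <- F1) f i) _ _))// [leRHS]splitr lerD ?h0//.
have -> : \sum_(i <- F1) f i =
    \sum_(j <- K) \sum_(i <- F0) (if p i == j then f i else 0).
  rewrite exchange_big/= -big_fset_condE/= big_mkcond/=; apply: eq_bigr => i _.
  case: ifPn => [pK|pK].
    rewrite (big_fsetD1 (p i))//= eqxx big1_fset ?addr0// => j.
    by rewrite !inE eq_sym => /andP[/negbTE ->].
  rewrite big1_fset// => j jK _; case: eqP => // pj; by rewrite pj jK in pK.
rewrite -sumrB (le_trans (normc_sum _ _ _))//.
rewrite (@le_trans _ _ (\sum_(j <- K) d))//.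
  rewrite big_seq [leRHS]big_seq; apply: ler_sum => j jK; rewrite distcC.
  apply: hF; apply: fsubset_trans (fsubsetUr _ _).
  by apply: bigfcup_sup.
rewrite big_const_seq count_predT iter_addr_0 -[leLHS]mulr_natr /d -mulrA.
rewrite ler_piMr ?(ltW e2)// mulrC ler_pdivrMr// mul1r lerDl; exact: ler01.
Qed.

End UnorderedSums.

(** * Complex exponential and logarithm *)

Section ComplexExp.
Context {R : realType}.
Implicit Types (x y : R) (z w : R[i]).

Lemma expcD z w : expc (z + w) = expc z * expc w.
Proof.
case: z w => a b [c d]; rewrite /expc /= expRD cosD sinD.
by apply: complexP => /=; ring.
Qed.

Lemma expc0 : expc (0 : R[i]) = 1.
Proof. by rewrite /expc /= expR0 cos0 sin0 mulr1 mulr0. Qed.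

Lemma normc_expc z : normc (expc z) = expR (complex.Re z).
Proof.
by rewrite /= !exprMn -mulrDr cos2Dsin2 mulr1 sqrtr_sqr ger0_norm// expR_ge0.
Qed.

Lemma expc_neq0 z : expc z != 0.
Proof. by rewrite -normc_gt0 normc_expc expR_gt0. Qed.

Lemma expcN z : expc (- z) = (expc z)^-1.
Proof.
by apply: (mulIf (expc_neq0 z)); rewrite -expcD addNr expc0 mulVf// expc_neq0.
Qed.

Lemma expcMn z n : expc (n%:R * z) = expc z ^+ n.
Proof.
elim: n => [|n IH]; first by rewrite mul0r expc0 expr0.
by rewrite -natr1 mulrDl mul1r expcD IH exprSr.
Qed.

Lemma e_D z w : e_ (z + w) = e_ z * e_ w.
Proof. by rewrite /e_ mulrDr expcD. Qed.

Lemma e_0 : e_ (0 : R[i]) = 1.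
Proof. by rewrite /e_ mulr0 expc0. Qed.

Lemma e_N z : e_ (- z) = (e_ z)^-1.
Proof. by rewrite /e_ mulrN expcN. Qed.

Lemma e_neq0 z : e_ z != 0.
Proof. exact: expc_neq0. Qed.

Lemma e_Mn z n : e_ (n%:R * z) = e_ z ^+ n.
Proof. by rewrite /e_ mulrCA expcMn. Qed.

Lemma e_nat n : e_ (n%:R : R[i]) = 1.
Proof.
have -> : (n%:R : R[i]) = n%:R * 1 by rewrite mulr1.
rewrite e_Mn (_ : e_ 1 = 1) ?expr1n// /e_ mulr1 /expc /=.
by rewrite expR0 !mul1r mulr_natl cos2pi sin2pi.
Qed.

Lemma e_int (n : int) : e_ (n%:~R : R[i]) = 1.
Proof. by case: n => n; rewrite ?NegzE ?mulrNz ?e_N e_nat ?invr1. Qed.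

Lemma normc_e z : normc (e_ z) = expR (- (2 * pi * complex.Im z)).
Proof. by rewrite normc_expc; case: z => a b /=; rewrite mul0r sub0r. Qed.

Lemma mvt_bound (f df : R -> R) C x : 0 <= x ->
  (forall t : R, is_derive t 1 f (df t)) -> (forall t, 0 <= t <= x -> `|df t| <= C) ->
  `|f x - f 0| <= C * x.
Proof.
move=> x0 fd dC.
have h1 t : t \in `]0, x[ -> is_derive t 1 f (df t) by move=> _; exact: fd.
have h2 : {within `[0, x], continuous f}.
  apply: derivable_within_continuous => t _; exact: (@ex_derive _ _ _ _ _ _ _ (fd t)).
have [c] := MVT_segment x0 h1 h2.
rewrite in_itv/= subr0 => /dC cC ->; rewrite normrM (ger0_norm x0).
exact: ler_wpM2r.
Qed.

Lemma norm_sin_le x : `|sin x| <= `|x|.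
Proof.
wlog x0 : x / 0 <= x => [h|].
  have [/h//|/ltW] := leP 0 x; rewrite -oppr_ge0 => /h; by rewrite sinN !normrN.
have := @mvt_bound sin cos 1 x x0 _ (fun t _ => cos_max t).
by rewrite sin0 subr0 mul1r (ger0_norm x0); apply => t; exact: is_derive_sin.
Qed.

Lemma norm_atan_le x : `|atan x| <= `|x|.
Proof.
wlog x0 : x / 0 <= x => [h|].
  have [/h//|/ltW] := leP 0 x; rewrite -oppr_ge0 => /h; by rewrite atanN !normrN.
have := @mvt_bound atan (fun t => (1 + t ^+ 2)^-1) 1 x x0 (fun t => is_derive1_atan t).
rewrite atan0 subr0 mul1r (ger0_norm x0); apply => t _.
have h : 1 <= 1 + t ^+ 2 by rewrite lerDl sqr_ge0.
by rewrite ger0_norm ?invr_ge0 ?(le_trans ler01 h)// invf_le1// (lt_le_trans ltr01 h).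
Qed.

Lemma cos_ge_sqr x : 1 - x ^+ 2 <= cos x.
Proof.
have xE : x / 2 *+ 2 = x by rewrite -mulr_natr divfK ?pnatr_eq0.
have := cos_mulr2n (x / 2); rewrite xE => ->.
have := norm_sin_le (x / 2); rewrite -ler_sqr ?nnegrE// !real_normK ?num_real// sin2cos2.
by have := sqr_ge0 x; rewrite exprMn exprVn; lra.
Qed.

Lemma sin_sub_le x : `|x| <= 1 -> `|sin x - x| <= x ^+ 2.
Proof.
wlog x0 : x / 0 <= x => [h|].
  have [/h//|/ltW] := leP 0 x; rewrite -oppr_ge0 => /h.
  by rewrite sinN !normrN sqrrN -opprD normrN.
rewrite (ger0_norm x0) => x1.
have hd (t : R) : is_derive t 1 (@sin R - id) (cos t - 1) by exact: is_deriveB.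
have := @mvt_bound _ _ (x ^+ 2) x x0 hd.
rewrite -[(sin - id) x]/(sin x - x) -[(sin - id) 0]/(sin 0 - 0).
rewrite sin0 !subr0 => h; apply: (le_trans (h _)).
- move=> t /andP[t0 tx]; have h1 := cos_ge_sqr t; have h2 := cos_le1 t.
  rewrite ler0_norm; last by lra.
  have h3 : t ^+ 2 <= x ^+ 2 by rewrite ler_sqr ?nnegrE.
  lra.
by rewrite ler_piMr ?sqr_ge0.
Qed.

Lemma expR_quad x : `|x| <= 1/2 -> `|expR x - 1 - x| <= 2 * x ^+ 2.
Proof.
rewrite ler_norml => /andP[x1 x2].
have h1 := expR_ge1Dx x; have := expR_ge1Dx (- x); rewrite expRN => h2.
have e0 := expR_gt0 x.
have h3 : expR x * (1 - x) <= 1 by rewrite mulrC -ler_pdivlMr// div1r.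
have h4 : expR x <= 1 + x + 2 * x ^+ 2.
  (* The product equals [1 + x^2 (1 - 2 x)], so this rests on [x <= 1/2]. *)
  have h5 : 1 <= (1 + x + 2 * x ^+ 2) * (1 - x) by nra.
  have x1' : 0 < 1 - x by lra.
  by rewrite -(ler_pM2r x1'); lra.
rewrite ger0_norm; lra.
Qed.

Lemma expc_quad z : normc z <= 1/2 -> normc (expc z - 1 - z) <= 8 * normc z ^+ 2.
Proof.
move=> z1; rewrite (le_trans (normc_le_ReIm _))//.
have := Re_le_normc z; have := Im_le_normc z; rewrite normc_sqr.
case: z z1 => a b /=; set r := Num.sqrt _ => r1 br ar.
have a1 := le_trans ar r1; have b1 := le_trans br r1.
have := expR_quad a1; have a2 := a1; have b2 := b1.
move: a2 b2; rewrite !ler_norml => /andP[a2 a3] /andP[b2 b3] /andP[e1 e2].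
have e3 : expR a <= 2 by nra.
have e4 := expR_gt0 a.
have b1' : `|b| <= 1 by apply: le_trans b1 _; lra.
have := sin_sub_le b1'; rewrite ler_norml => /andP[s1 s2].
have c1 := cos_ge_sqr b; have c2 := cos_le1 b.
have -> : 8 * (a ^+ 2 + b ^+ 2) = (2 * a ^+ 2 + 2 * b ^+ 2) + (6 * a ^+ 2 + 6 * b ^+ 2) by ring.
apply: lerD.
  have h : expR a * (1 - cos b) <= 2 * b ^+ 2.
    by apply: ler_pM; [exact: ltW|lra|lra|lra].
  have h' : 0 <= expR a * (1 - cos b) by apply: mulr_ge0; [exact: ltW|lra].
  by rewrite ler_norml; apply/andP; split; lra.
have -> : expR a * sin b - 0 - b = expR a * (sin b - b) + b * (expR a - 1) by ring.
have h1 : `|expR a * (sin b - b)| <= 2 * b ^+ 2.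
  rewrite normrM (gtr0_norm e4) ler_pM ?(ltW e4)//.
  by rewrite ler_norml s1 s2.
have h2 : `|b * (expR a - 1)| <= `|b| * (2 * `|a|).
  rewrite normrM ler_wpM2l// (_ : expR a - 1 = (expR a - 1 - a) + a); last by ring.
  rewrite (le_trans (ler_normD _ _))// (_ : 2 * `|a| = `|a| + `|a|); last by ring.
  rewrite lerD2r (le_trans (_ : _ <= 2 * a ^+ 2)) ?ler_norml ?e1//.
  by rewrite -(real_normK (num_real a)) expr2 mulrA ler_piMl//; lra.
have h3 : `|b| * (2 * `|a|) <= a ^+ 2 + b ^+ 2.
  rewrite -(real_normK (num_real a)) -(real_normK (num_real b)).
  by have := sqr_ge0 (`|a| - `|b|); rewrite sqrrB; lra.
have := ler_normD (expR a * (sin b - b)) (b * (expR a - 1)).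
have := sqr_ge0 a; have := sqr_ge0 b; lra.
Qed.

Lemma upper_neq0 z : 0 < complex.Im z -> z != 0.
Proof. by case: z => a b /= b0; rewrite eq_complex /= (gt_eqF b0) andbF. Qed.

Lemma Im_le_normc_id z : complex.Im z <= normc z.
Proof. exact: le_trans (ler_norm _) (Im_le_normc z). Qed.

Lemma cos_arg_itv z : 0 < complex.Im z -> -1 < complex.Re z / normc z < 1.
Proof.
move=> z0; have n0 : 0 < normc z by rewrite normc_gt0 upper_neq0.
have : `|complex.Re z| < normc z.
  rewrite -ltr_sqr ?nnegrE ?normc_ge0// normc_sqr real_normK ?num_real//.
  by rewrite ltrDl exprn_gt0.
by rewrite ltr_norml ltr_pdivrMr// mul1r ltr_pdivlMr// mulN1r.
Qed.

Lemma argc_upper z : 0 < complex.Im z -> 0 < argc z < pi.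
Proof.
move=> z0; have /andP[h1 h2] := cos_arg_itv z0.
by rewrite /argc (ltW z0) acos_gt0 ?(ltW h1)// acos_ltpi// (ltW h2) h1.
Qed.

Lemma expc_logc z : 0 < complex.Im z -> expc (logc z) = z.
Proof.
move=> z0; have /andP[h1 h2] := cos_arg_itv z0.
have n0 : 0 < normc z by rewrite normc_gt0 upper_neq0.
rewrite /expc /logc /= lnK// /argc (ltW z0) acosK ?in_itv/= ?(ltW h1) ?(ltW h2)//.
rewrite sin_acos ?(ltW h1) ?(ltW h2)//.
have -> : 1 - (complex.Re z / normc z) ^+ 2 = (complex.Im z / normc z) ^+ 2.
  apply: (mulIf (lt0r_neq0 (exprn_gt0 2 n0))).
  rewrite mulrBl -!exprMn !divfK ?(lt0r_neq0 n0)// mul1r normc_sqr; ring.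
rewrite sqrtr_sqr ger0_norm ?divr_ge0 ?normc_ge0 ?(ltW z0)//.
by rewrite ![normc z * _]mulrC !divfK ?(lt0r_neq0 n0)//; case: (z).
Qed.

Lemma cos_eq1 x : `|x| < 2 * pi -> cos x = 1 -> x = 0.
Proof.
have xE : x / 2 *+ 2 = x by rewrite -mulr_natr divfK ?pnatr_eq0.
move=> xpi c1; have := cos_mulr2n (x / 2); rewrite xE c1 => h.
have s0 : sin (x / 2) = 0.
  by apply/eqP; rewrite -sqrf_eq0 sin2cos2; apply/eqP; lra.
move: xpi; rewrite ltr_norml => /andP[h1 h2].
have [x0|x0|//] := ltgtP x 0.
  have : 0 < sin (- (x / 2)) by apply: sin_gt0_pi; apply/andP; split; lra.
  by rewrite sinN s0 oppr0 ltxx.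
have : 0 < sin (x / 2) by apply: sin_gt0_pi; apply/andP; split; lra.
by rewrite s0 ltxx.
Qed.

Lemma expc_inj z w : `|complex.Im z - complex.Im w| < 2 * pi -> expc z = expc w -> z = w.
Proof.
move=> h zw; apply: complexP.
  by apply: expR_inj; rewrite -!normc_expc zw.
apply/eqP; rewrite -subr_eq0; apply/eqP; apply: cos_eq1 => //.
have : expc (z - w) = 1 by rewrite expcD expcN zw mulfV// expc_neq0.
have r0 : complex.Re (z - w) = 0.
  apply: expR_inj; rewrite -normc_expc expcD expcN zw mulfV ?expc_neq0//.
  by rewrite normc1 expR0.
by move/(congr1 (@complex.Re R)); rewrite /= r0 expR0 mul1r; case: (z) (w) => ? ? [].
Qed.

(* A branch constant: [log (- u)] exceeds [log u] by [i pi] when [- u] lies in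
   the upper half plane. *)
Definition sgn_log (s : R) : R[i] := if 0 < s then 0 else 0 +i* pi.

Lemma expc_sgn_log (s : R) : s != 0 -> expc (sgn_log s) = (Num.sg s)%:C.
Proof.
rewrite /sgn_log; case: (ltrgt0P s) => // s0 _; first by rewrite expc0 gtr0_sg.
by rewrite /expc /= expR0 cospi sinpi ltr0_sg// mulr0 mul1r.
Qed.

(** Both sides have the same exponential, and since all three arguments lie in []0, pi[] their
    imaginary parts differ by less than [2 pi]. *)
Lemma logc_div (s : R) z w : s != 0 -> 0 < complex.Im z -> 0 < complex.Im w ->
  0 < complex.Im (s%:C * (z / w)) ->
  logc (s%:C * (z / w)) = (ln `|s|)%:C + sgn_log s + (logc z - logc w).
Proof.
move=> s0 z0 w0 zw0; have sn0 : 0 < `|s| by rewrite normr_gt0.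
apply: expc_inj; last first.
  rewrite expc_logc// !expcD expcN !expc_logc// expc_sgn_log//; congr (_ * _).
  rewrite {1}[s]numEsg mulrC rmorphM; congr (_ * _).
  by rewrite /expc /= cos0 sin0 lnK// mulr1 mulr0.
have /andP[a1 a2] := argc_upper zw0.
have /andP[b1 b2] := argc_upper z0; have /andP[c1 c2] := argc_upper w0.
move: a1 a2; rewrite /sgn_log /logc /=; set A := argc _ => a1 a2.
rewrite ltr_norml; case: ifP => _ /=; lra.
Qed.

Lemma logc_near z w : 0 < complex.Im z -> 0 < complex.Im (z + w) ->
  normc (w / z) <= 1/8 ->
  normc (logc (z + w) - logc z - w / z) <= 128 * normc (w / z) ^+ 2.
Proof.
move=> z0 zw0; set x := w / z => x8.
set l := logc (z + w) - logc z.
have el : expc l = 1 + x.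
  rewrite expcD expcN !expc_logc// mulrDl mulfV// upper_neq0//.
(* This crude bound brings [l] into the range of [expc_quad], applied to [expc l = 1 + x]; inserting
   it there gives [128 = 8 * 4^2]. *)
have l1 : normc l <= 4 * normc x; last first.
  have l2 : normc l <= 1/2 by lra.
  have := expc_quad l2; rewrite el [1 + x - 1]addrC addKr distcC => /le_trans; apply.
  have -> : 128 * normc x ^+ 2 = 8 * (4 * normc x) ^+ 2 by ring.
  by rewrite ler_wpM2l// ler_sqr// nnegrE ?normc_ge0 ?mulr_ge0 ?normc_ge0.
have x1 := Re_le_normc x; have x2 := Im_le_normc x.
have nx := normcD 1 x; have nx' := normcB (1 + x) x.
rewrite addrK normc1 in nx nx'.
have e1 : expR (complex.Re l) = normc (1 + x) by rewrite -normc_expc el.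
have e2 := expR_ge1Dx (complex.Re l); have := expR_ge1Dx (- complex.Re l).
rewrite expRN e1 => e3; rewrite e1 in e2.
have r1 : `|complex.Re l| <= 2 * normc x.
  have n0 : 0 < normc (1 + x) by lra.
  have e4 : (1 - complex.Re l) * normc (1 + x) <= 1 by rewrite -ler_pdivlMr// div1r.
  rewrite ler_norml; apply/andP; split; last by lra.
  rewrite leNgt; apply/negP => h; nra.
have r2 : `|complex.Im l| <= 2 * normc x.
  have lre : complex.Re (expc l) = complex.Re (1 + x) by rewrite el.
  have lim : complex.Im (expc l) = complex.Im (1 + x) by rewrite el.
  move: lre lim; rewrite Re_add Im_add /=.
  have x1' : - complex.Re x <= normc x by apply: le_trans x1; rewrite -normrN ler_norm.
  set t := complex.Im l => lre lim; have E0 := expR_gt0 (complex.Re l).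
  have c0 : 0 < cos t by rewrite -(pmulr_rgt0 _ E0) lre; lra.
  have tpi : -pi < t < pi.
    have /andP[b1 b2] := argc_upper z0; have /andP[c1 c2] := argc_upper zw0.
    have -> : t = argc (z + w) - argc z by rewrite /t /l Im_add Im_opp.
    by apply/andP; split; lra.
  (* [cos t] is positive because [expc l = 1 + x] has positive real part; together with
     [-pi < t < pi] this confines [t] to the interval where [atan] inverts [tan]. *)
  have tpi2 : - (pi / 2) < t < pi / 2.
    move: tpi => /andP[t1 t2]; rewrite !ltNge -negb_or; apply/negP => /orP[h|h].
      have : 0 <= sin (- t - pi / 2) by apply: sin_ge0_pi; apply/andP; split; lra.
      by rewrite sinBpihalf cosN oppr_ge0 leNgt c0.
    have : 0 <= sin (t - pi / 2) by apply: sin_ge0_pi; apply/andP; split; lra.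
    by rewrite sinBpihalf oppr_ge0 leNgt c0.
  rewrite -[X in `|X| <= _](@tanK _ t) ?in_itv//= (le_trans (norm_atan_le _))//.
  have -> : tan t = complex.Im x / (1 + complex.Re x).
    rewrite /tan -lre -[complex.Im x]add0r -lim -mulf_div divff ?(gt_eqF E0)// mul1r//.
  have p0 : 0 < 1 + complex.Re x by lra.
  rewrite normrM normfV (gtr0_norm p0) ler_pdivrMr//; nra.
by have := normc_le_ReIm l; lra.
Qed.

End ComplexExp.

(** * Products of complex powers on the upper half plane *)

Section Psi.
Context {R : realType}.
Variables (q : nat) (tau : R).
Implicit Types (x y : R) (z w : R[i]).

Definition psi_exp : R[i] := (- q%:R) +i* tau.

(* [(z + al)^(- q + i tau) (z + be)^(- q - i tau)], each factor with its own
   logarithm on the upper half plane *)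
Definition psi (al be : R) z : R[i] :=
  expc (psi_exp * logc (z + al%:C) + (psi_exp^*)%C * logc (z + be%:C)).

Lemma Im_addR z x : complex.Im (z + x%:C) = complex.Im z.
Proof. by rewrite Im_add addr0. Qed.

Lemma upper_addR_neq0 z x : 0 < complex.Im z -> z + x%:C != 0.
Proof. by move=> z0; rewrite upper_neq0// Im_addR. Qed.

Lemma Im_le_addR z x : complex.Im z <= normc (z + x%:C).
Proof. by rewrite -(Im_addR z x) Im_le_normc_id. Qed.

Lemma psiE al be z : 0 < complex.Im z ->
  psi al be z = (z + al%:C) ^- q * (z + be%:C) ^- q *
    expc ((0 +i* tau) * (logc (z + al%:C) - logc (z + be%:C))).
Proof.
move=> z0; have e0 := (@expc_logc R).
have -> : (z + al%:C) ^- q = expc (- (q%:R * logc (z + al%:C))).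
  by rewrite expcN expcMn e0// Im_addR.
have -> : (z + be%:C) ^- q = expc (- (q%:R * logc (z + be%:C))).
  by rewrite expcN expcMn e0// Im_addR.
rewrite /psi -!expcD; congr expc; rewrite -(rmorph_nat (real_complex R)).
by apply: complexP; rewrite /psi_exp ?(Re_add, Im_add, Re_opp, Im_opp, Re_mul, Im_mul)/=; ring.
Qed.

Lemma psi_shift al be z x : psi al be (z + x%:C) = psi (al + x) (be + x) z.
Proof.
have e c : z + x%:C + c%:C = z + (c + x)%:C by rewrite rmorphD -addrA (addrC x%:C).
by rewrite /psi !e.
Qed.

Lemma normc_psi al be z : 0 < complex.Im z -> exists2 t : R, `|t| <= `|tau| * pi &
  normc (psi al be z) = (normc (z + al%:C) * normc (z + be%:C)) ^- q * expR t.
Proof.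
move=> z0; rewrite psiE// 2!normcM !normcV !normcX normc_expc exprMn invfM.
eexists; last by [].
rewrite Re_mul /= mul0r sub0r normrN normrM ler_wpM2l//.
have /andP[h1 h2] : 0 < argc (z + al%:C) < pi by rewrite argc_upper// Im_addR.
have /andP[h3 h4] : 0 < argc (z + be%:C) < pi by rewrite argc_upper// Im_addR.
by rewrite ler_norml; apply/andP; split; rewrite ?Im_add ?Im_opp/=; lra.
Qed.

Lemma normc_psi_le al be z : 0 < complex.Im z ->
  normc (psi al be z) <= expR (`|tau| * pi) * (normc (z + al%:C) * normc (z + be%:C)) ^- q.
Proof.
move=> z0; have [t] := normc_psi al be z0; rewrite ler_norml => /andP[_ t1] ->.
rewrite mulrC ler_wpM2r ?ler_expR//.
by rewrite invr_ge0 exprn_ge0// mulr_ge0// normc_ge0.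
Qed.

Lemma normc_psi_ge al be z : 0 < complex.Im z ->
  expR (- (`|tau| * pi)) * (normc (z + al%:C) * normc (z + be%:C)) ^- q <= normc (psi al be z).
Proof.
move=> z0; have [t] := normc_psi al be z0; rewrite ler_norml => /andP[t1 _] ->.
rewrite [leRHS]mulrC ler_wpM2r ?ler_expR//.
by rewrite invr_ge0 exprn_ge0// mulr_ge0// normc_ge0.
Qed.

Lemma normc_addR_le y W z w x : 0 < y -> y <= complex.Im (z + w) -> normc w <= W ->
  normc (z + x%:C) <= (1 + W / y) * normc (z + w + x%:C).
Proof.
move=> y0 yw wW; have h : y <= normc (z + w + x%:C) by apply: le_trans yw (Im_le_addR _ _).
have W0 : 0 <= W := le_trans (normc_ge0 _) wW.
have -> : z + x%:C = z + w + x%:C - w by ring.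
rewrite (le_trans (normcB _ _))// mulrDl mul1r lerD2l (le_trans wW)//.
by rewrite mulrAC ler_pdivlMr// ler_wpM2l.
Qed.

(** A Harnack inequality uniform in [al] and [be]: absolute convergence at the single point [i] then
    controls the family locally uniformly. Moving by [w] changes each of the two moduli by a factor
    of at most [1 + W / y], and the argument part of the power is bounded. *)
Lemma psi_harnack y W : 0 < y -> exists2 K, 0 <= K &
  forall al be z w, 0 < complex.Im z -> y <= complex.Im (z + w) -> normc w <= W ->
    normc (psi al be (z + w)) <= K * normc (psi al be z).
Proof.
move=> y0; set T := `|tau| * pi; set B := 1 + W / y.
exists (expR T * expR T * `|B| ^+ 2 ^+ q); first by rewrite !mulr_ge0 ?expR_ge0.
move=> al be z w z0 yw wW.
have W0 : 0 <= W := le_trans (normc_ge0 _) wW.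
have B0 : 0 < B by rewrite ltr_wpDr// divr_ge0// ltW.
have w0 : 0 < complex.Im (z + w) := lt_le_trans y0 yw.
apply: le_trans (normc_psi_le _ _ w0) _.
rewrite (gtr0_norm B0) -!mulrA ler_wpM2l ?expR_ge0//.
have := normc_psi_ge al be z0; rewrite expRN mulrC ler_pdivrMr ?expR_gt0//.
have n0 x u : 0 < complex.Im u -> 0 < normc (u + x%:C).
  by move=> u0; rewrite normc_gt0 upper_addR_neq0.
move=> h; apply: (@le_trans _ _ (B ^+ 2 ^+ q * (normc (z + al%:C) * normc (z + be%:C)) ^- q)).
  rewrite ler_pdivlMr ?exprn_gt0 ?mulr_gt0 ?n0// mulrC ler_pdivrMr ?exprn_gt0 ?mulr_gt0 ?n0//.
  rewrite -exprMn lerXn2r ?nnegrE ?mulr_ge0 ?normc_ge0 ?exprn_ge0 ?(ltW B0)//.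
  have := normc_addR_le al y0 yw wW; have := normc_addR_le be y0 yw wW.
  rewrite -/B expr2 => h1 h2.
  have -> : B * B * (normc (z + w + al%:C) * normc (z + w + be%:C)) =
    (B * normc (z + w + al%:C)) * (B * normc (z + w + be%:C)) by ring.
  by rewrite ler_pM ?normc_ge0.
have -> : expR T * (B ^+ 2 ^+ q * normc (psi al be z)) = B ^+ 2 ^+ q * (normc (psi al be z) * expR T) by ring.
by rewrite ler_wpM2l ?exprn_ge0 ?(ltW B0).
Qed.

(** The remainder is relative to [normc (psi al be z)], with [d] and [K] independent of [al] and
    [be], so that the expansions of all summands can be added up. [lam] is the logarithmic
    derivative of [psi al be]. *)
Lemma psi_taylor y : 0 < y -> exists2 d, 0 < d & exists2 K, 0 <= K &
  forall al be z, y <= complex.Im z -> exists2 lam, normc lam <= K &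
    forall w, normc w <= d ->
      normc (psi al be (z + w) - psi al be z * (1 + lam * w)) <=
      K * normc (psi al be z) * normc w ^+ 2.
Proof.
move=> y0; set S := normc psi_exp; have S0 : 0 <= S := normc_ge0 _.
have S2 : normc (psi_exp^*)%C = S by rewrite /S; case: psi_exp => u v /=; rewrite sqrrN.
set K := 2 * S / y + (8 * (34 * S) ^+ 2 + 256 * S) / y ^+ 2.
have K1 : 0 <= 2 * S / y by rewrite divr_ge0 ?mulr_ge0 ?(ltW y0).
have K2 : 0 <= (8 * (34 * S) ^+ 2 + 256 * S) / y ^+ 2.
  apply: divr_ge0; last exact: sqr_ge0.
  by apply: addr_ge0; apply: mulr_ge0 => //; exact: sqr_ge0.
have D0 : 0 < 8 + 68 * S by rewrite ltr_wpDr ?mulr_ge0.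
(* With [r = normc w / y] this radius means [8 r + 68 S r <= 1]. Then [r <= 1/8], as [logc_near]
   requires, and the change [mu] of the exponent is at most [256 S r^2 + 2 S r <= 34 S r <= 1/2], as
   [expc_quad] requires. *)
exists (y / (8 + 68 * S)); first by rewrite divr_gt0.
exists K; first by rewrite addr_ge0.
move=> al be z yz; have z0 : 0 < complex.Im z := lt_le_trans y0 yz.
have ny x : y <= normc (z + x%:C) := le_trans yz (Im_le_addR z x).
have iy x : normc (z + x%:C)^-1 <= y^-1.
  by rewrite normcV lef_pV2 ?posrE// (lt_le_trans y0).
exists (psi_exp / (z + al%:C) + (psi_exp^*)%C / (z + be%:C)).
  rewrite (le_trans (normcD _ _))// !normcM S2 -/S.
  rewrite (le_trans (lerD (ler_wpM2l S0 (iy _)) (ler_wpM2l S0 (iy _))))//.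
  have -> : S / y + S / y = 2 * S / y by field; rewrite gt_eqF.
  by rewrite lerDl.
move=> w; rewrite ler_pdivlMr// => wd; set lam := psi_exp / (z + al%:C) + (psi_exp^*)%C / (z + be%:C).
have wn := normc_ge0 w.
set r := normc w / y; have r0 : 0 <= r by rewrite divr_ge0 ?(ltW y0).
have wE : normc w = r * y by rewrite divfK ?gt_eqF.
have rS : 8 * r + 68 * (S * r) <= 1.
  by rewrite -(ler_pM2r y0) mul1r; move: wd; rewrite wE; lra.
have Sr0 : 0 <= S * r by rewrite mulr_ge0.
have pw x : normc (w / (z + x%:C)) <= r by rewrite normcM ler_wpM2l.
have zw0 : 0 < complex.Im (z + w).
  rewrite Im_add; have := Im_le_normc w; rewrite ler_norml => /andP[+ _].
  have : normc w <= y / 8 by rewrite wE; nra.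
  lra.
have ll x : normc (logc (z + w + x%:C) - logc (z + x%:C) - w / (z + x%:C)) <= 128 * r ^+ 2.
  have -> : z + w + x%:C = z + x%:C + w by rewrite addrAC.
  have h1 : 0 < complex.Im (z + x%:C) by rewrite Im_addR.
  have h2 : 0 < complex.Im (z + x%:C + w) by rewrite addrAC Im_addR.
  have h3 : normc (w / (z + x%:C)) <= 1/8 by apply: le_trans (pw x) _; lra.
  apply: le_trans (logc_near h1 h2 h3) _.
  by rewrite ler_wpM2l// ler_sqr ?nnegrE ?normc_ge0.
set mu := psi_exp * (logc (z + w + al%:C) - logc (z + al%:C)) +
  (psi_exp^*)%C * (logc (z + w + be%:C) - logc (z + be%:C)).
have -> : psi al be (z + w) = psi al be z * expc mu.
  by rewrite /psi -expcD; congr expc; rewrite /mu; ring.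
have mul : normc (mu - lam * w) <= 256 * S * r ^+ 2.
  have -> : mu - lam * w =
    psi_exp * (logc (z + w + al%:C) - logc (z + al%:C) - w / (z + al%:C)) +
    (psi_exp^*)%C * (logc (z + w + be%:C) - logc (z + be%:C) - w / (z + be%:C)).
    by rewrite /mu /lam; ring.
  rewrite (le_trans (normcD _ _))// !normcM S2 -/S.
  have h1 := ler_wpM2l S0 (ll al); have h2 := ler_wpM2l S0 (ll be).
  by rewrite (le_trans (lerD h1 h2))//; lra.
have lw : normc (lam * w) <= 2 * (S * r).
  have -> : lam * w = psi_exp * (w / (z + al%:C)) + (psi_exp^*)%C * (w / (z + be%:C)).
    by rewrite /lam; ring.
  rewrite (le_trans (normcD _ _))// [normc (psi_exp * _)]normcM [normc (_^*%C * _)]normcM S2 -/S.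
  by have := ler_wpM2l S0 (pw al); have := ler_wpM2l S0 (pw be); lra.
have mu34 : normc mu <= 34 * (S * r).
  have -> : mu = (mu - lam * w) + lam * w by rewrite subrK.
  rewrite (le_trans (normcD _ _))//.
  have : S * r ^+ 2 <= S * r / 8.
    rewrite expr2 mulrA ler_wpM2l//; lra.
  lra.
have mu2 : normc mu <= 1/2 by lra.
have -> : psi al be z * expc mu - psi al be z * (1 + lam * w) =
  psi al be z * ((expc mu - 1 - mu) + (mu - lam * w)) by ring.
rewrite normcM [K * _]mulrC -mulrA ler_wpM2l ?normc_ge0//.
rewrite (le_trans (normcD _ _))//.
have mus : normc mu ^+ 2 <= (34 * (S * r)) ^+ 2.
  have p34 : 0 <= 34 * (S * r) by rewrite mulr_ge0.
  by rewrite ler_sqr ?nnegrE ?normc_ge0.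
have := expc_quad mu2.
have -> : normc w ^+ 2 = r ^+ 2 * y ^+ 2 by rewrite wE exprMn.
have -> : K * (r ^+ 2 * y ^+ 2) = 2 * S / y * (r ^+ 2 * y ^+ 2) + (8 * (34 * S) ^+ 2 + 256 * S) * r ^+ 2.
  by rewrite /K; field; rewrite gt_eqF.
have : 0 <= 2 * S / y * (r ^+ 2 * y ^+ 2) by rewrite mulr_ge0// mulr_ge0 ?sqr_ge0.
have : (34 * (S * r)) ^+ 2 = (34 * S) ^+ 2 * r ^+ 2 by ring.
lra.
Qed.

End Psi.

(** * Counting in fibres and a summable weight on the integers *)

Section FiniteSums.
Context {R : realType}.

Lemma bounded_sums_fiber (I J : choiceType) (p : I -> J) (S : set I) (t : J -> R) M (m : nat) :
  (forall j, 0 <= t j) -> bounded_sums t M ->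
  (forall K : {fset I}, (forall i, i \in K -> S i) ->
     (forall i i', i \in K -> i' \in K -> p i = p i') -> (#|` K | <= m)%N) ->
  bounded_sums (fun i => if i \in S then t (p i) else 0) (m%:R * M).
Proof.
move=> t0 tM fib K; pose K' := [fset i in K | i \in S]%fset.
rewrite -big_mkcond/= big_fset_condE -/K' (partition_big_imfset _ p)/=.
apply: (@le_trans _ _ (\sum_(j <- [fset p i | i in K']%fset) m%:R * t j)); last first.
  by rewrite -mulr_sumr ler_wpM2l.
apply: ler_sum => j _; rewrite big_fset_condE/=.
rewrite (@le_trans _ _ (\sum_(i <- [fset i in K' | p i == j]%fset) t j))//.
  rewrite big_seq [leRHS]big_seq; apply: ler_sum => i.
  by rewrite !inE => /andP[_ /eqP ->].
rewrite big_const_seq count_predT iter_addr_0 -[leLHS]mulr_natl ler_wpM2r// ler_nat.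
apply: fib => [i|i i'].
  by rewrite !inE => /andP[/andP[_ /set_mem]].
by rewrite !inE => /andP[_ /eqP ->] /andP[_ /eqP ->].
Qed.

Lemma bounded_sums_nat (t : nat -> R) M : (forall k, 0 <= t k) ->
  (forall P, \sum_(k < P) t k <= M) -> bounded_sums t M.
Proof.
move=> t0 tM K; pose P := (\max_(k <- K) k).+1.
apply: le_trans (tM P); rewrite -(big_mkord xpredT t).
rewrite [leRHS](bigID (fun k => k \in K))/=.
rewrite -[leLHS]addr0 lerD ?sumr_ge0// le_eqVlt; apply/orP; left; apply/eqP.
rewrite -[RHS]big_filter; apply: perm_big; apply: uniq_perm; rewrite ?fset_uniq//.
  by rewrite filter_uniq// iota_uniq.
move=> k; rewrite mem_filter mem_index_iota leq0n/=.
case: (boolP (k \in K)) => //= kK; rewrite ltnS.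
by rewrite (big_rem k kK)/= leq_maxl.
Qed.

(** A stand-in for [1 / n^2] that is finite at 0 and whose sums over the naturals telescope. *)
Definition int_weight (n : int) : R := (`|n|%N.+1%:R * `|n|%N.+2%:R)^-1.

Lemma int_weight_ge0 n : 0 <= int_weight n.
Proof. by rewrite invr_ge0 mulr_ge0. Qed.

Lemma int_weight_bounded : bounded_sums int_weight 2.
Proof.
pose t k : R := (k.+1%:R * k.+2%:R)^-1.
have t0 k : 0 <= t k by rewrite invr_ge0 mulr_ge0.
have tE P : \sum_(k < P) t k = 1 - P.+1%:R^-1.
  elim: P => [|P IH]; first by rewrite big_ord0 invr1 subrr.
  rewrite big_ord_recr/= IH /t -[P.+2]addn1 -[P.+1]addn1 !natrD.
  have : 0 <= P%:R :> R by []. move: (P%:R : R) => p p0.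
  by field; apply/andP; split; apply/eqP; lra.
have tM : bounded_sums t 1.
  by apply: bounded_sums_nat => // P; rewrite tE gerBl invr_ge0.
have := @bounded_sums_fiber _ _ absz setT t 1 2 t0 tM.
rewrite mulr1 => h; move=> K; have := h _ K; under eq_bigr do rewrite in_setT.
apply => {}K _ hK; have [->|/fset0Pn[i iK]] := eqVneq K fset0; first by rewrite cardfs0.
rewrite (leq_trans (fsubset_leq_card (_ : K `<=` [fset i; - i])%fset))//.
  apply/fsubsetP => j jK; rewrite !inE; have := hK _ _ jK iK.
  by move=> /(congr1 Posz)/eqP; rewrite !abszE eqr_norm2; case/orP => ->; rewrite ?orbT.
by rewrite cardfs2; case: (_ != _).
Qed.

Lemma sums_ord (I : choiceType) N (s : 'I_N -> I) (f : I -> R[i]) : injective s ->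
  (forall i, (forall k, i <> s k) -> f i = 0) -> sums f (\sum_k f (s k)).
Proof.
move=> s_inj f0 e e0; pose J0 := [fset i in map s (enum 'I_N)]%fset.
exists J0 => J JJ; rewrite -(big_fset_incl _ JJ); last first.
  move=> i _ iJ; apply: f0 => k ik; move/negP : iJ; apply.
  by rewrite !inE ik map_f// mem_enum.
have -> : \sum_(i <- J0) f i = \sum_(i <- map s (enum 'I_N)) f i.
  apply: perm_big; apply: uniq_perm; rewrite ?fset_uniq ?map_inj_uniq// -?enumT ?enum_uniq//.
  by move=> i; rewrite !inE.
by rewrite big_map big_enum/= subrr normc0 ltW.
Qed.

End FiniteSums.

(** * Orthogonality of roots of unity and a lower bound for the sine *)

Section RootsOfUnity.
Context {R : realType}.

Lemma e_eq1 (x : R) : `|x| < 1 -> e_ x%:C = 1 -> x = 0.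
Proof.
move=> x1; rewrite /e_ -expc0 => /expc_inj h.
have pi0 := pi_gt0 R; have p0 : 0 < 2 * pi :> R by rewrite mulr_gt0.
have /(congr1 (@complex.Im R)) : (0 +i* (2 * pi)) * x%:C = 0 :> R[i].
  apply: h => /=; rewrite mul0r add0r subr0 normrM (gtr0_norm p0).
  by rewrite -[ltRHS]mulr1 ltr_pM2l.
by rewrite /= mul0r add0r => /eqP; rewrite mulf_eq0 (gt_eqF p0)/= => /eqP.
Qed.

Lemma sum_e_eq0 (k : int) (N : nat) : k != 0 -> (`|k| < N)%N ->
  \sum_(j < N) e_ (k%:~R * (j%:R / N%:R : R)%:C) = 0.
Proof.
move=> k0 kN; have N0 : 0 < N%:R :> R by rewrite ltr0n (leq_trans _ kN).
pose z := e_ ((k%:~R / N%:R : R)%:C).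
have zE j : e_ (k%:~R * (j%:R / N%:R : R)%:C) = z ^+ j.
  rewrite -e_Mn; congr e_; rewrite -(rmorph_int (real_complex R)) -(rmorph_nat (real_complex R)) -!rmorphM.
  by congr _%:C; ring.
have zN : z ^+ N = 1.
  rewrite -zE divff ?gt_eqF// mulr1; exact: e_int.
have z1 : z - 1 != 0.
  rewrite subr_eq0; apply/eqP => /e_eq1 h.
  have /eqP : k%:~R / N%:R = 0 :> R.
    apply: h; rewrite normrM normfV (gtr0_norm N0) ltr_pdivrMr// mul1r.
    by rewrite -intr_norm -[N%:R]/((N : int)%:~R) ltr_int -abszE ltz_nat.
  by rewrite mulf_eq0 intr_eq0 (negbTE k0) invr_eq0 (gt_eqF N0).
under eq_bigr do rewrite zE.
by apply: (mulfI z1); rewrite -subrX1 zN subrr mulr0.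
Qed.

(** For [x >= 0] put [y = x / 2]: then [sin x = 2 sin y cos y >= 2 y (cos y)^2] by [tan y >= y], and
    [2 (cos y)^2 = 1 + cos x >= 1]. *)
Lemma sin_ge_half (x : R) : `|x| <= pi / 2 -> (`|x| / 2) ^+ 2 <= sin x ^+ 2.
Proof.
wlog x0 : x / 0 <= x => [h|].
  have [/h//|/ltW] := leP 0 x; rewrite -oppr_ge0 => /h; by rewrite sinN !normrN sqrrN.
rewrite (ger0_norm x0) => xpi; set y := x / 2.
have pi0 := pi_gt0 R.
have yE : x = y *+ 2 by rewrite -mulr_natr divfK ?pnatr_eq0.
have y0 : 0 <= y by rewrite /y; lra.
have ypi : - (pi / 2) < y < pi / 2 by rewrite /y; apply/andP; split; lra.
have c0 := cos_gt0_pihalf ypi.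
have : 0 <= cos x by apply: cos_ge0_pihalf; apply/andP; split; lra.
rewrite {1}yE cos_mulr2n -mulr_natr => c2.
have t : y <= tan y.
  have := norm_atan_le (tan y); rewrite tanK ?in_itv//= (ger0_norm y0) ger0_norm//.
  rewrite divr_ge0 ?(ltW c0)// sin_ge0_pi//; apply/andP; split; lra.
have s1 : y * cos y <= sin y by rewrite -ler_pdivlMr.
rewrite ler_sqr ?nnegrE// ?sin_ge0_pi//; last by apply/andP; split; lra.
rewrite [in leRHS]yE sin_mulr2n -mulr_natr.
have : y * (cos y * cos y) <= cos y * sin y by rewrite mulrA mulrC ler_pM2l.
rewrite expr2 in c2; nra.
Qed.

End RootsOfUnity.

(** * Fourier expansion of a periodic function by finite Fourier analysis *)

Section LocTaylor.
Context {R : realType}.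
Implicit Types (x y : R) (z w : R[i]) (h g : R[i] -> R[i]).

(** [lam] acts by complex multiplication, so it is a complex derivative and the property stands in
    for holomorphy. The bounds on [h z] and [lam] are included to make it stable under products. *)
Definition taylor_at h (d K : R) z := normc (h z) <= K /\
  exists2 lam, normc lam <= K & forall w, normc w <= d ->
    normc (h (z + w) - h z - lam * w) <= K * normc w ^+ 2.

Definition loc_taylor h := forall y W, 0 < y -> exists2 d, 0 < d &
  exists2 K, 0 <= K & forall z, y <= complex.Im z -> normc z <= W -> taylor_at h d K z.

Lemma taylor_at_mul h g d d' K K' z : 0 < d -> 0 < d' -> 0 <= K -> 0 <= K' ->
  taylor_at h d K z -> taylor_at g d' K' z ->
  taylor_at (fun u => h u * g u) (Num.min (Num.min d d') 1) (6 * (K * K')) z.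
Proof.
move=> d0 d'0 K0 K'0 [hK [lam lK hT]] [gK [mu mK gT]].
have KK : 0 <= K * K' by rewrite mulr_ge0.
split; first by rewrite normcM (le_trans (ler_pM _ _ hK gK)) ?normc_ge0//; lra.
exists (lam * g z + h z * mu).
  rewrite (le_trans (normcD _ _))// !normcM.
  have h1 := ler_pM (normc_ge0 _) (normc_ge0 _) lK gK.
  have h2 := ler_pM (normc_ge0 _) (normc_ge0 _) hK mK; lra.
move=> w; rewrite !le_min => /andP[/andP[wd wd'] w1].
have {}hT := hT _ wd; have {}gT := gT _ wd'.
set r := h (z + w) - h z - lam * w in hT.
set s := g (z + w) - g z - mu * w in gT.
have -> : h (z + w) * g (z + w) - h z * g z - (lam * g z + h z * mu) * w =
   h z * s + r * g z + (lam * w + r) * (mu * w + s).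
  rewrite (_ : h (z + w) = h z + lam * w + r); last by rewrite /r; ring.
  by rewrite (_ : g (z + w) = g z + mu * w + s); [ring|rewrite /s; ring].
have w0 := normc_ge0 w; set W := normc w in hT gT w1 w0 *.
(* The cap 1 on the radius bounds both increments linearly, by [2 K W] and [2 K' W]; the three error
   terms then contribute [1 + 1 + 4 = 6]. *)
have W2 : W ^+ 2 <= W by rewrite expr2 ler_piMr.
have b1 (a b : R[i]) c : 0 <= c -> normc a <= c -> normc b <= c * W ^+ 2 -> normc (a * w + b) <= 2 * c * W.
  move=> c0 ac bc; rewrite (le_trans (normcD _ _))// normcM -/W.
  have := ler_wpM2r w0 ac; have := ler_wpM2l c0 W2; lra.
have h1 := ler_pM (normc_ge0 _) (normc_ge0 _) hK gT.
have h2 := ler_pM (normc_ge0 _) (normc_ge0 _) hT gK.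
have h3 := ler_pM (normc_ge0 _) (normc_ge0 _) (b1 _ _ _ K0 lK hT) (b1 _ _ _ K'0 mK gT).
rewrite (le_trans (normcD _ _))// (le_trans (lerD (normcD _ _) (lexx _)))// !normcM.
rewrite (le_trans (lerD (lerD h1 h2) h3))// le_eqVlt; apply/orP; left; apply/eqP; ring.
Qed.

Lemma loc_taylor_mul h g : loc_taylor h -> loc_taylor g -> loc_taylor (fun u => h u * g u).
Proof.
move=> hT gT y W y0; have [d d0 [K K0 hK]] := hT y W y0.
have [d' d'0 [K' K'0 gK]] := gT y W y0.
exists (Num.min (Num.min d d') 1); first by rewrite !lt_min d0 d'0 ltr01.
exists (6 * (K * K')); first by rewrite !mulr_ge0.
by move=> z yz zW; apply: taylor_at_mul => //; [exact: hK|exact: gK].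
Qed.

Lemma loc_taylor_e (n : int) : loc_taylor (fun z => e_ (- (n%:~R * z))).
Proof.
move=> y W y0; pose nu : R[i] := (0 +i* (2 * pi)) * - n%:~R.
have eE z : e_ (- (n%:~R * z)) = expc (nu * z) by rewrite /e_ /nu; congr expc; ring.
set V := normc nu; have V0 : 0 <= V := normc_ge0 _.
have V1 : 0 < 2 * V + 1 by rewrite ltr_wpDl ?mulr_ge0.
pose E := expR (V * W); have E0 : 0 < E := expR_gt0 _.
exists (2 * V + 1)^-1; first by rewrite invr_gt0.
exists (E * (1 + V + 8 * V ^+ 2)).
  by rewrite mulr_ge0 ?(ltW E0)// !addr_ge0 ?mulr_ge0 ?sqr_ge0.
have V8 : 0 <= 8 * V ^+ 2 by rewrite mulr_ge0 ?sqr_ge0.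
move=> z _ zW; have zE : normc (e_ (- (n%:~R * z))) <= E.
  rewrite eE normc_expc ler_expR (le_trans (ler_norm _))// (le_trans (Re_le_normc _))//.
  by rewrite normcM ler_wpM2l.
split; first by rewrite (le_trans zE)// ler_peMr ?(ltW E0)//; lra.
exists (e_ (- (n%:~R * z)) * nu).
  by rewrite normcM -/V ler_pM ?normc_ge0//; lra.
move=> w; rewrite -[X in _ <= X]div1r ler_pdivlMr// => wd.
have -> : e_ (- (n%:~R * (z + w))) = e_ (- (n%:~R * z)) * expc (nu * w).
  by rewrite !eE mulrDr expcD.
set u := e_ _ in zE *.
have -> : u * expc (nu * w) - u - u * nu * w = u * (expc (nu * w) - 1 - nu * w) by ring.
have w0 := normc_ge0 w.
have nw : normc (nu * w) <= 1/2 by rewrite normcM -/V; lra.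
rewrite normcM -mulrA ler_pM ?normc_ge0//.
apply: le_trans (expc_quad nw) _; rewrite normcM -/V exprMn mulrA ler_wpM2r ?sqr_ge0//.
lra.
Qed.

End LocTaylor.

Section Fourier.
Context {R : realType}.
Implicit Types (x y : R) (z w : R[i]).

Definition frac (j N : nat) : R[i] := (j%:R / N%:R : R)%:C.

Lemma frac0 N : frac 0 N = 0.
Proof. by rewrite /frac mul0r. Qed.

Lemma fracNN N : (0 < N)%N -> frac N N = 1.
Proof. by move=> N0; rewrite /frac divff// pnatr_eq0 -lt0n. Qed.

Lemma fracS j N : frac j.+1 N = frac j N + frac 1 N.
Proof. by rewrite /frac -rmorphD -mulrDl -natrD addn1. Qed.

Lemma fracE j N : frac j N = j%:R / N%:R.
Proof. by rewrite /frac rmorphM /= fmorphV !(rmorph_nat (real_complex R)). Qed.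

Lemma normc_frac j N : normc (frac j N) = j%:R / N%:R.
Proof. by rewrite normcR ger0_norm// divr_ge0. Qed.

Lemma normc_frac_le1 j N : (j <= N)%N -> normc (frac j N) <= 1.
Proof.
case: N => [|N] jN; first by rewrite normc_frac invr0 mulr0.
by rewrite normc_frac ler_pdivrMr ?ltr0n// mul1r ler_nat.
Qed.

(** A Riemann sum for the integral of [h u * e_ (- n u)] along the horizontal segment from [z] to
    [z + 1]. The exponential is taken at the complex point, not at its offset, so that the limit can
    be independent of [z]. *)
Definition dft (h : R[i] -> R[i]) (N : nat) (n : int) z : R[i] :=
  N%:R^-1 * \sum_(j < N) h (z + frac j N) * e_ (- (n%:~R * (z + frac j N))).

Variable h : R[i] -> R[i].
Hypothesis h_per : forall z, 0 < complex.Im z -> h (z + 1) = h z.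
Hypothesis h_tay : loc_taylor h.

Variable al : int -> R[i] -> R[i].
Hypothesis h_lim : forall n z, 0 < complex.Im z -> clim (fun N => dft h N n z) (al n z).

Local Notation tw n := (fun z => h z * e_ (- (n%:~R * z))).

Lemma tw_per n z : 0 < complex.Im z -> tw n (z + 1) = tw n z.
Proof.
move=> z0 /=; rewrite h_per// mulrDr mulr1 opprD e_D.
by rewrite -[- n%:~R]mulrNz e_int mulr1.
Qed.

Lemma Im_addfrac z j N : complex.Im (z + frac j N) = complex.Im z.
Proof. by rewrite Im_add /= addr0. Qed.

Lemma dft_step n y W : 0 < y -> exists2 d, 0 < d & exists2 K, 0 <= K &
  forall z w, y <= complex.Im z -> y <= complex.Im (z + w) -> normc z <= W -> normc w <= d ->
    normc (al n (z + w) - al n z) <= K * normc w ^+ 2.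
Proof.
move=> y0; have [d d0 [K K0 hT]] := loc_taylor_mul h_tay (loc_taylor_e n) (W + 1) y0.
exists d => //; exists K => // z w yz yzw zW wd.
have z0 := lt_le_trans y0 yz; have zw0 := lt_le_trans y0 yzw.
suff bnd N : (0 < N)%N -> N%:R^-1 <= d ->
    normc (dft h N n (z + w) - dft h N n z) <= K * normc w ^+ 2 + K * normc w * N%:R^-1.
  apply/ler_addgt0Pr => e e0; have l1 := h_lim n zw0; have l2 := h_lim n z0.
  have -> : al n (z + w) - al n z = -1 * al n z + al n (z + w) by rewrite mulN1r addrC.
  apply: (clim_norm_le (clim_lin (-1) l2 l1)).
  have [N0 hN0] : exists N0 : nat, forall N, (N0 <= N)%N ->
      [/\ (0 < N)%N, N%:R^-1 <= d & K * normc w * N%:R^-1 <= e].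
    pose B := Num.max d^-1 (K * normc w / e).
    have B0 : 0 <= B by rewrite le_max invr_ge0 (ltW d0).
    exists (Num.bound B).+1 => N hN; have N1 : (0 < N)%N by exact: leq_ltn_trans hN.
    have N0 : 0 < N%:R :> R by rewrite ltr0n.
    have BN : B <= N%:R.
      rewrite (le_trans (ltW (archi_boundP B0)))// ler_nat; exact: ltnW.
    move: BN; rewrite ge_max => /andP[h1 h2]; split=> //.
      by rewrite -[d]invrK lef_pV2 ?posrE ?invr_gt0.
    by rewrite ler_pdivrMr// [e * _]mulrC -ler_pdivrMr.
  exists N0 => N /hN0[N1 Nd Ne]; rewrite mulN1r addrC.
  by rewrite (le_trans (bnd _ N1 Nd))// lerD2l.
move=> N0 Nd; have NR : 0 < N%:R :> R by rewrite ltr0n.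
have nN : normc N%:R^-1 = N%:R^-1 :> R by rewrite normcV normc_nat.
rewrite /dft -mulrBr -sumrB.
(* By periodicity the grid increments [D j] add up to 0, so [w * N * D j], which approximates
   [lam * w], may be subtracted from each term. The unknown derivative cancels and only second order
   errors remain. *)
pose D j := tw n (z + frac j.+1 N) - tw n (z + frac j N).
have sD : \sum_(j < N) D j = 0.
  rewrite -(big_mkord xpredT D) telescope_sumr// fracNN// frac0 addr0.
  by rewrite (tw_per n z0) subrr.
have -> : \sum_(j < N) (tw n (z + w + frac j N) - tw n (z + frac j N)) =
    \sum_(j < N) (tw n (z + frac j N + w) - tw n (z + frac j N) - w * N%:R * D j).
  rewrite [RHS]sumrB -mulr_sumr sD mulr0 subr0; apply: eq_bigr => j _.
  by rewrite (addrAC z w).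
rewrite normcM nN mulrC ler_pdivrMr//; apply: le_trans (normc_sum _ _ _) _.
have -> : (K * normc w ^+ 2 + K * normc w / N%:R) * N%:R =
   \sum_(j < N) (K * normc w ^+ 2 + K * normc w / N%:R).
  by rewrite sumr_const card_ord mulr_natr.
apply: ler_sum => j _; have [||_ [lam _ hl]] := hT (z + frac j N).
- by rewrite Im_addfrac.
- rewrite (le_trans (normcD _ _))// lerD// normc_frac_le1//; exact: ltnW.
have h1 := hl _ wd; have := hl (frac 1 N); rewrite normc_frac div1r -(addrA z) -fracS.
move=> /(_ Nd) h2; rewrite /D; set A := tw n (z + frac j N) in h1 h2 *; set B := tw n (z + frac j.+1 N) in h2 *.
have -> : tw n (z + frac j N + w) - A - w * N%:R * (B - A) =
   (tw n (z + frac j N + w) - A - lam * w) - w * N%:R * (B - A - lam * frac 1 N).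
  rewrite fracE; field.
  by rewrite pnatr_eq0 -lt0n.
rewrite (le_trans (normcB _ _))// lerD// 2!normcM normc_nat.
rewrite -mulrA [K * _]mulrC -[leRHS]mulrA ler_wpM2l ?normc_ge0//.
rewrite (le_trans (ler_wpM2l _ h2)) ?ler0n// le_eqVlt; apply/orP; left; apply/eqP.
by field; rewrite gt_eqF.
Qed.

(** By [dft_step] the increments of [al n] are quadratic in the step, so cutting the segment from
    [z] to [w] into [P] equal parts bounds the total change by a multiple of [1 / P]. *)
Lemma dft_lim_const n z w : 0 < complex.Im z -> 0 < complex.Im w -> al n z = al n w.
Proof.
move=> z0 w0; pose y := Num.min (complex.Im z) (complex.Im w).
have y0 : 0 < y by rewrite lt_min z0 w0.
have [d d0 [K K0 hK]] := dft_step n (normc z + normc (w - z)) y0.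
set v := w - z in hK.
pose p P j := z + frac j P * v.
have pIm P j : (j <= P)%N -> y <= complex.Im (p P j).
  move=> jP; have /andP[t0 t1] : 0 <= (j%:R / P%:R : R) <= 1.
    by have := normc_frac_le1 jP; rewrite normc_frac => ->; rewrite divr_ge0.
  rewrite /p Im_add Im_mul /= mul0r addr0 /v Im_add Im_opp.
  set t := _ / _ in t0 t1 *.
  have y1 : y <= complex.Im z by rewrite ge_min lexx.
  have y2 : y <= complex.Im w by rewrite ge_min lexx orbT.
  nra.
suff bnd P : (0 < P)%N -> normc v / P%:R <= d -> normc (al n w - al n z) <= K * normc v ^+ 2 / P%:R.
  apply/esym/eqP; rewrite -subr_eq0 -normc_eq0 eq_le normc_ge0 andbT.
  apply/ler_addgt0Pr => e e0; rewrite add0r.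
  pose B := Num.max (normc v / d) (K * normc v ^+ 2 / e).
  have B0 : 0 <= B by rewrite le_max divr_ge0 ?normc_ge0 ?(ltW d0).
  pose P := (Num.bound B).+1; have P0 : 0 < P%:R :> R by [].
  have : B <= P%:R by rewrite (le_trans (ltW (archi_boundP B0)))// ler_nat.
  rewrite ge_max !ler_pdivrMr// => /andP[h1 h2].
  apply: le_trans (bnd P isT _) _; first by rewrite ler_pdivrMr// mulrC.
  by rewrite ler_pdivrMr// [e * _]mulrC.
move=> P0 Pd; have PR : 0 < P%:R :> R by rewrite ltr0n.
have -> : al n w - al n z = \sum_(0 <= j < P) (al n (p P j.+1) - al n (p P j)).
  by rewrite telescope_sumr// /p fracNN// frac0 mul1r mul0r addr0 /v (addrC z) subrK.
rewrite big_mkord (le_trans (normc_sum _ _ _))//.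
have -> : K * normc v ^+ 2 / P%:R = \sum_(j < P) K * (normc v / P%:R) ^+ 2.
  by rewrite sumr_const card_ord -[RHS]mulr_natr; field; rewrite gt_eqF.
apply: ler_sum => j _; have -> : p P j.+1 = p P j + frac 1 P * v.
  by rewrite /p fracS mulrDl addrA.
have vP : normc (frac 1 P * v) = normc v / P%:R by rewrite normcM normc_frac div1r mulrC.
rewrite -vP; apply: hK; rewrite ?vP//.
- by apply: pIm; exact: ltnW.
- by rewrite -addrA -mulrDl -fracS; exact: pIm.
- rewrite (le_trans (normcD _ _))// lerD2l normcM ler_piMl ?normc_ge0//.
  by rewrite normc_frac_le1// ltnW.
Qed.

Lemma dft_norm N n z (j : 'I_N) :
  e_ (- (n%:~R * (z + frac j N))) * e_ (n%:~R * z) = e_ (- (n%:~R * frac j N)).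
Proof. by rewrite -e_D; congr e_; ring. Qed.

Lemma dft_inversion M z :
  \sum_(k < M.*2.+1) dft h M.*2.+1 (k%:Z - M%:Z) z * e_ ((k%:Z - M%:Z)%:~R * z) = h z.
Proof.
set N := M.*2.+1; have N0 : (N%:R : R[i]) != 0 by rewrite pnatr_eq0.
have e1 (k : 'I_N) : dft h N (k%:Z - M%:Z) z * e_ ((k%:Z - M%:Z)%:~R * z) =
  \sum_(j < N) (N%:R^-1 * h (z + frac j N) * e_ (M%:R * frac j N)) * e_ (- j%:~R * frac k N).
  rewrite /dft -mulrA mulr_suml mulr_sumr; apply: eq_bigr => j _.
  rewrite -mulrA dft_norm -!mulrA; congr (_ * (_ * _)); rewrite -e_D; congr e_.
  rewrite /frac intrB !rmorphM /= !rmorph_nat; ring.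
under eq_bigr do rewrite e1.
rewrite exchange_big/= (bigD1 ord0)//= [X in _ + X]big1 => [|j j0].
  rewrite addr0 frac0 mulr0 addr0 e_0 mulr1.
  under eq_bigr do rewrite oppr0 mul0r e_0 mulr1.
  by rewrite sumr_const card_ord -[LHS]mulr_natr mulrC mulrA mulfV// mul1r.
rewrite -mulr_sumr (_ : \sum_(i < N) _ = 0) ?mulr0//.
have := @sum_e_eq0 R (- j%:Z) N; rewrite abszN absz_nat ltn_ord oppr_eq0 => /(_ _ isT).
by under eq_bigr do rewrite mulrNz; apply; rewrite -lt0n; move: j0; rewrite -val_eqE/= lt0n.
Qed.

Lemma sum_shift N (u : nat -> R[i]) : u N = u 0%N -> \sum_(j < N) u j.+1 = \sum_(j < N) u j.
Proof.
move=> uN; apply/eqP; rewrite -subr_eq0 -sumrB.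
by rewrite -(big_mkord xpredT (fun j => u j.+1 - u j)) telescope_sumr// uN subrr.
Qed.

(** Taking second differences of [h] on the grid multiplies the coefficient by
    [- 4 sin^2 (pi n / N)], while the Taylor expansion bounds each of them by [2 K / N^2]. For
    [|n| <= M] the angle stays below [pi / 2], where [sin_ge_half] applies. *)
Lemma dft_decay z : 0 < complex.Im z -> exists M0, exists2 K, 0 <= K &
  forall M (n : int), (M0 <= M)%N -> (`|n| <= M)%N ->
    normc (dft h M.*2.+1 n z * e_ (n%:~R * z)) <= K * int_weight n.
Proof.
move=> z0; have [d d0 [K K0 hT]] := h_tay (normc z + 1) z0.
(* [2 * K] serves [n = 0], where the weight is [1/2]; [3 * K] serves the others, where
   [normc T * n^2 <= K N / 2] and [(m + 1) (m + 2) <= 6 m^2] for [m = |n|]. *)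
exists (Num.bound d^-1); exists (2 * K + 3 * K) => [|M n MM nM]; first by lra.
set N := M.*2.+1.
have NR : 0 < N%:R :> R by rewrite ltr0n.
have Nd : N%:R^-1 <= d.
  rewrite -[d]invrK lef_pV2 ?posrE ?invr_gt0//.
  have : 0 <= d^-1 by rewrite invr_ge0 ltW.
  move=> /archi_boundP/ltW/le_trans; apply; rewrite ler_nat (leq_trans MM)//.
  by rewrite (leq_trans (_ : _ <= M.*2)%N) ?leqnSn// -addnn leq_addr.
have nN : normc N%:R^-1 = N%:R^-1 :> R by rewrite normcV normc_nat.
pose c j := e_ (- (n%:~R * frac j N)).
pose T := \sum_(j < N) h (z + frac j N) * c j.
have -> : dft h N n z * e_ (n%:~R * z) = N%:R^-1 * T.
  rewrite /dft -mulrA mulr_suml; congr (_ * _); apply: eq_bigr => j _.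
  by rewrite -mulrA dft_norm.
have hTj j : (j <= N)%N -> taylor_at h d K (z + frac j N).
  move=> jN; apply: hT; first by rewrite Im_addfrac.
  by rewrite (le_trans (normcD _ _))// lerD// normc_frac_le1.
have nc j : normc (c j) = 1.
  by rewrite normc_e Im_opp Im_mul -(rmorph_int (real_complex R))/= mulr0 mul0r addr0 oppr0 mulr0 oppr0 expR0.
rewrite normcM nN mulrC ler_pdivrMr//.
have TK : normc T <= K * N%:R.
  apply: le_trans (normc_sum _ _ _) _.
  have -> : K * N%:R = \sum_(j < N) K by rewrite sumr_const card_ord mulr_natr.
  apply: ler_sum => j _; rewrite normcM nc mulr1.
  by have [] := hTj j (ltnW (ltn_ord j)).
have [n0|n0] := eqVneq n 0.
  have -> : int_weight n = 1/2 :> R by rewrite n0 /int_weight absz0 !mul1r.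
  have KN0 : 0 <= K * N%:R by rewrite mulr_ge0.
  lra.
have cS j : c j.+1 = c j * c 1%N.
  by rewrite /c fracS -e_D; congr e_; ring.
have c0 : c 0%N = 1 by rewrite /c frac0 mulr0 oppr0 e_0.
have cN : c N = 1 by rewrite /c fracNN// mulr1 -[- _]mulrNz e_int.
have s1 : \sum_(j < N) h (z + frac j.+1 N) * c j = (c 1%N)^-1 * T.
  rewrite /T mulr_sumr.
  pose u j := (c 1%N)^-1 * (h (z + frac j N) * c j).
  have uN : u N = u 0%N by rewrite /u cN c0 fracNN// frac0 addr0 h_per.
  rewrite -[RHS](sum_shift uN); apply: eq_bigr => j _; rewrite /u (cS j).
  by rewrite [RHS]mulrC -!mulrA mulfV ?e_neq0// mulr1.
have s2 : \sum_(j < N) h (z + frac j N - frac 1 N) * c j = c 1%N * T.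
  pose u j := h (z + frac j N - frac 1 N) * c j.
  have uN : u N = u 0%N.
    rewrite /u cN c0 fracNN// frac0 addr0 addrAC h_per//.
    by rewrite Im_add Im_opp /= oppr0 addr0.
  rewrite -(sum_shift uN) /T mulr_sumr; apply: eq_bigr => j _.
  by rewrite /u (cS j) fracS addrA addrK; ring.
have key : normc (((c 1%N)^-1 + c 1%N - 2) * T) <= N%:R * (2 * K * N%:R^-1 ^+ 2).
  have -> : ((c 1%N)^-1 + c 1%N - 2) * T = \sum_(j < N)
      (h (z + frac j.+1 N) + h (z + frac j N - frac 1 N) - 2 * h (z + frac j N)) * c j.
    rewrite mulrBl mulrDl -s1 -s2 /T mulr_sumr -big_split -sumrB/=.
    by apply: eq_bigr => j _; ring.
  apply: le_trans (normc_sum _ _ _) _.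
  have -> : N%:R * (2 * K * N%:R^-1 ^+ 2) = \sum_(j < N) 2 * K * N%:R^-1 ^+ 2 :> R.
    by rewrite sumr_const card_ord mulr_natl.
  apply: ler_sum => j _; rewrite normcM nc mulr1.
  have [_ [lam _ hl]] := hTj j (ltnW (ltn_ord j)).
  have h1 := hl (frac 1 N); have h2 := hl (- frac 1 N).
  move: h1 h2; rewrite normcN normc_frac div1r -(addrA z) -fracS => /(_ Nd) h1 /(_ Nd) h2.
  have -> : h (z + frac j.+1 N) + h (z + frac j N - frac 1 N) - 2 * h (z + frac j N) =
    (h (z + frac j.+1 N) - h (z + frac j N) - lam * frac 1 N) +
    (h (z + frac j N - frac 1 N) - h (z + frac j N) - lam * - frac 1 N) by ring.
  by rewrite (le_trans (normcD _ _))//; lra.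
pose th : R := pi * n%:~R / N%:R.
have cE : normc ((c 1%N)^-1 + c 1%N - 2) = 4 * sin th ^+ 2.
  have -> : (c 1%N)^-1 + c 1%N - 2 = (- (4 * sin th ^+ 2))%:C.
    rewrite /c e_N invrK /e_ /frac -(rmorph_int (real_complex R)).
    have -> : (0 +i* (2 * pi)) * ((n%:~R)%:C * (1%:R / N%:R)%:C) = 0 +i* (th *+ 2).
      by apply: complexP => /=; rewrite /th mulr2n; ring.
    rewrite -expcN /expc /= oppr0 expR0 !mul1r cosN sinN cos_mulr2n sin2cos2.
    by apply: complexP => /=; rewrite !mulr2n; ring.
  by rewrite normcR normrN ger0_norm// mulr_ge0// sqr_ge0.
rewrite normcM cE in key.
have nR : (1 : R) <= `|n|%N%:R by rewrite ler1n absz_gt0.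
have nth : `|th| = pi * `|n|%N%:R / N%:R.
  rewrite /th !normrM normfV (gtr0_norm NR) (gtr0_norm (pi_gt0 R)).
  by rewrite -intr_norm -abszE.
have nMR : 2 * `|n|%N%:R <= N%:R :> R.
  by rewrite -natrM ler_nat mul2n (leq_trans (_ : _ <= M.*2)%N)// leq_double.
have th2 : `|th| <= pi / 2.
  rewrite nth ler_pdivrMr//; have := ler_wpM2l (pi_ge0 R) nMR; lra.
have := sin_ge_half th2; rewrite nth => sl.
have pi2 := pi_ge2 R.
have sl2 : `|n|%N%:R ^+ 2 / N%:R ^+ 2 <= sin th ^+ 2.
  apply: le_trans sl; rewrite -expr_div_n ler_sqr ?nnegrE ?divr_ge0 ?mulr_ge0 ?pi_ge0//.
  have -> : pi * `|n|%N%:R / N%:R / 2 = (pi / 2) * (`|n|%N%:R / N%:R) :> R by ring.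
  by rewrite ler_peMl ?divr_ge0//; lra.
have T0 := normc_ge0 T.
have T2 : normc T * `|n|%N%:R ^+ 2 <= K / 2 * N%:R.
  have := le_trans (ler_wpM2r T0 (ler_wpM2l (ler0n _ 4) sl2)) key.
  rewrite -(ler_pM2r NR) => h1; rewrite -(ler_pM2r (_ : 0 < 4 / N%:R :> R)) ?divr_gt0//.
  move: h1; rewrite !exprVn.
  have -> : 4 * (`|n|%N%:R ^+ 2 / N%:R ^+ 2) * normc T * N%:R = normc T * `|n|%N%:R ^+ 2 * (4 / N%:R).
    by field; rewrite gt_eqF.
  have -> : N%:R * (2 * K / N%:R ^+ 2) * N%:R = K / 2 * N%:R * (4 / N%:R).
    by field; rewrite gt_eqF.
  by [].
rewrite /int_weight.
have -> : `|n|%N.+1%:R = `|n|%N%:R + 1%:R :> R by rewrite natr1.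
have -> : `|n|%N.+2%:R = `|n|%N%:R + 2%:R :> R by rewrite -natrD addn2.
set m := `|n|%N%:R in nR T2 *.
rewrite mulrAC ler_pdivlMr ?mulr_gt0//; [|lra|lra].
have m2 : (m + 1%:R) * (m + 2%:R) <= 6 * m ^+ 2 by nra.
rewrite (le_trans (ler_wpM2l T0 m2))// mulrCA.
have := mulr_ge0 K0 (ltW NR); lra.
Qed.

Theorem fourier_expansion : exists a : int -> R[i],
  (forall n z, 0 < complex.Im z -> clim (fun N => dft h N n z) (a n)) /\
  (forall z, 0 < complex.Im z -> sums (fun n => a n * e_ (n%:~R * z)) (h z)).
Proof.
have i0 : 0 < complex.Im ('i : R[i]) by rewrite /= ltr01.
exists (fun n => al n 'i); split=> [n z z0|z z0].
  by rewrite -(dft_lim_const n z0 i0); exact: h_lim.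
have [M0 [K K0 hK]] := dft_decay z0.
(* The offset [M0] makes [dft_decay] available for every [M]. Each truncated family sums exactly to
   [h z] by inversion, so the sequence passed to [tannery] is constant. *)
pose f M (n : int) := if (`|n| <= M + M0)%N then
   dft h (M + M0).*2.+1 n z * e_ (n%:~R * z) else 0.
have [||||S FS Sl] := @tannery _ _ f (fun n => al n 'i * e_ (n%:~R * z))
    (fun n => K * int_weight n) (K * 2) (fun=> h z).
- move=> M n; rewrite /f; case: ifP => [|_]; first by apply: hK; exact: leq_addl.
  by rewrite normc0 mulr_ge0// int_weight_ge0.
- exact: bounded_sumsZ int_weight_bounded.
- move=> n e e0; rewrite -(dft_lim_const n z0 i0).
  have en : 0 < normc (e_ (n%:~R * z)) by rewrite normc_gt0 e_neq0.
  have [N0 hN0] := h_lim n z0 (divr_gt0 e0 en).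
  exists (maxn N0 `|n|) => M; rewrite geq_max => /andP[NM nM].
  rewrite /f (leq_trans nM (leq_addr _ _)) -mulrBl normcM -ler_pdivlMr//.
  apply: hN0; rewrite (leq_trans NM)// (leq_trans (leq_addr M0 M))//.
  by rewrite (leq_trans (_ : _ <= (M + M0).*2)%N) ?leqnSn// -addnn leq_addr.
- move=> M; have s_inj : injective (fun k : 'I_(M + M0).*2.+1 => k%:Z - (M + M0)%:Z).
    by move=> k k' /addIr[] /val_inj.
  have := @sums_ord R _ _ _ (f M) s_inj; rewrite (_ : \sum_k _ = h z).
    apply=> n nk; rewrite /f; case: ifP => // nM; exfalso.
    have kP : (absz (n + (M + M0)%:Z)%R < (M + M0).*2.+1)%N by lia.
    apply: (nk (Ordinal kP)) => /=; lia.
  rewrite -[RHS](dft_inversion (M + M0) z); apply: eq_bigr => k _; rewrite /f.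
  by case: ifPn => //; have := ltn_ord k; lia.
by rewrite (clim_unique (clim_cst (h z)) Sl).
Qed.

End Fourier.

(** * Uniqueness of Fourier coefficients *)

Section FourierUniqueness.
Context {R : realType}.

(** Averaging the difference of the two series against [e_ (- n0 x)] over [N.+1] equally spaced
    points isolates the coefficient [n0], apart from the indices congruent to [n0] modulo [N.+1].
    For a fixed other index this stops as [N] grows, and absolute convergence at [x = 0] dominates
    the averages. *)
Lemma fourier_unique (h : R[i] -> R[i]) (a b : int -> R[i]) :
  (forall z, 0 < complex.Im z -> sums (fun n => a n * e_ (n%:~R * z)) (h z)) ->
  (forall z, 0 < complex.Im z -> sums (fun n => b n * e_ (n%:~R * z)) (h z)) ->
  a = b.
Proof.
move=> ha hb; apply/funext => n0.
pose d n : R[i] := (a n - b n) * e_ (n%:~R * 'i).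
have hd (x : R) : sums (fun n => d n * e_ (n%:~R * x%:C)) 0.
  have z0 : 0 < complex.Im ('i + x%:C) by rewrite /= addr0 ltr01.
  have := sums_lin (-1) (hb _ z0) (ha _ z0); rewrite mulN1r addNr.
  by congr sums; apply/funext => n; rewrite /d -mulrA -e_D -mulrDr; ring.
have [M dM] : exists M, bounded_sums (fun n => normc (d n)) M.
  apply: (@sums_bounded _ _ _ 0); have := hd 0; congr sums; apply/funext => n.
  by rewrite -[0%:C]/(0 : R[i]) mulr0 e_0 mulr1.
pose f N n : R[i] := \sum_(j < N.+1)
  (N.+1%:R^-1 * e_ (- (n0%:~R * frac j N.+1))) * (d n * e_ (n%:~R * frac j N.+1)).
have fE N n : f N n = d n * (N.+1%:R^-1 * \sum_(j < N.+1) e_ ((n - n0)%:~R * frac j N.+1)).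
  rewrite /f !mulr_sumr; apply: eq_bigr => j _.
  have -> : (n - n0)%:~R * frac j N.+1 = - (n0%:~R * frac j N.+1) + n%:~R * frac j N.+1 :> R[i].
    by rewrite intrB; ring.
  by rewrite e_D; ring.
have ne (k : int) j N : normc (e_ (k%:~R * frac j N) : R[i]) = 1.
  by rewrite normc_e Im_mul -(rmorph_int (real_complex R))/= mulr0 mul0r addr0 mulr0 oppr0 expR0.
have NR N : 0 < N.+1%:R :> R by rewrite ltr0n.
have [||||S FS Sl] := @tannery _ _ f (fun n => if n == n0 then d n0 else 0)
    (fun n => normc (d n)) M (fun=> 0).
- move=> N n; rewrite fE normcM ler_piMr ?normc_ge0// normcM normcV normc_nat.
  rewrite mulrC ler_pdivrMr// mul1r (le_trans (normc_sum _ _ _))//.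
  by under eq_bigr do rewrite ne; rewrite sumr_const card_ord.
- exact: dM.
- move=> n e e0; exists `|n - n0|%N => N hN; rewrite fE.
  case: eqVneq => [->|nn0].
    rewrite subrr; under eq_bigr do rewrite mul0r e_0.
    rewrite sumr_const card_ord mulVf ?pnatr_eq0// mulr1 subrr normc0; exact: ltW.
  by rewrite sum_e_eq0 ?mulr0 ?subrr ?normc0 ?(ltW e0)// subr_eq0.
- move=> N; have := sums_sum N.+1 (fun j => sumsZ
    (N.+1%:R^-1 * e_ (- (n0%:~R * frac j N.+1))) (hd (j%:R / N.+1%:R))).
  by rewrite big1// => j _; rewrite mulr0.
have S0 := clim_unique (clim_cst 0) Sl; rewrite -S0 in FS.
have := @sums_ord R _ 1 (fun=> n0) (fun n => if n == n0 then d n0 else 0).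
rewrite big_ord1 eqxx => /(_ _ _)/(sums_unique FS) h0.
have /eqP : 0 = d n0.
  apply: h0 => [i j _|i ni]; first by rewrite !ord1.
  by case: eqP => // /(ni ord0).
by rewrite eq_sym mulf_eq0 (negbTE (e_neq0 _)) orbF subr_eq0 => /eqP.
Qed.

End FourierUniqueness.

(** * Integrals over unit cells *)

Section RealIntegrals.
Context {R : realType}.
Local Notation mu := (@lebesgue_measure R).
Implicit Types g : R -> R.

Lemma continuous_integrable_itv g (u v : R) : continuous g ->
  mu.-integrable `[u, v[ (EFin \o g).
Proof.
move=> gc; apply: (@integrableS _ _ _ mu `[u, v]%classic) => //.
  by apply: subset_itvl; rewrite bnd_simp.
apply: continuous_compact_integrable; first exact: segment_compact.
by apply: continuous_subspaceT => x; exact: gc.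
Qed.

Lemma Rintegral_itvU g (u v w : R) : continuous g -> u <= v -> v <= w ->
  \int[mu]_(x in `[u, w[) g x = \int[mu]_(x in `[u, v[) g x + \int[mu]_(x in `[v, w[) g x.
Proof.
move=> gc uv vw; rewrite (@itv_bndbnd_setU _ _ (BLeft u) (BLeft v) (BLeft w)) ?bnd_simp//.
rewrite Rintegral_setU//; last first.
  apply/disj_setPS => x [/=]; rewrite !in_itv/= => /andP[_ h1] /andP[h2 _].
  by move: (lt_le_trans h1 h2); rewrite ltxx.
rewrite -itv_bndbnd_setU ?bnd_simp//; exact: continuous_integrable_itv.
Qed.

Lemma Rintegral_steps g (b d : R) m : continuous g -> 0 <= d ->
  \int[mu]_(x in `[b, b + m%:R * d[) g x =
  \sum_(j < m) \int[mu]_(x in `[b + j%:R * d, b + j.+1%:R * d[) g x.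
Proof.
move=> gc d0; elim: m => [|m IH].
  by rewrite mul0r addr0 big_ord0 set_itv_ge ?Rintegral_set0// bnd_simp ltxx.
rewrite big_ord_recr/= -IH; apply: Rintegral_itvU => //.
  by rewrite lerDl mulr_ge0.
by rewrite lerD2l ler_wpM2r// ler_nat.
Qed.

Lemma Rintegral_itv_cst (u v c : R) : u <= v -> \int[mu]_(x in `[u, v[) c = c * (v - u).
Proof.
move=> uv; rewrite Rintegral_cst//; congr (_ * _).
transitivity (fine (if (BLeft u < BLeft v :> itv_bound R)%O then (v%:E - u%:E)%E else 0%E)).
  exact: (congr1 fine (lebesgue_measure_itv _)).
rewrite bnd_simp; case: ltP => //= vu.
by apply/eqP; rewrite eq_sym subr_eq0 eq_le vu uv.
Qed.

Lemma normr_Rintegral_le g (u v c : R) : continuous g -> u <= v ->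
  (forall x, u <= x < v -> `|g x| <= c) -> `|\int[mu]_(x in `[u, v[) g x| <= c * (v - u).
Proof.
move=> gc uv gb; have gi := @continuous_integrable_itv g u v gc.
rewrite (le_trans (le_normr_Rintegral _ gi))// -Rintegral_itv_cst//.
apply: le_Rintegral => //.
- have gnc : continuous (fun x => `|g x|).
    by move=> x; apply: (continuous_comp (gc x)); exact: norm_continuous.
  exact: continuous_integrable_itv.
- by apply: continuous_integrable_itv => x; exact: cst_continuous.
Qed.

Lemma riemann_cell g (b d L : R) : continuous g -> 0 <= d ->
  (forall x, b <= x <= b + d -> `|g x - g b| <= L * d) ->
  `|\int[mu]_(x in `[b, b + d[) g x - g b * d| <= L * d * d.
Proof.
move=> gc d0 gL; have bd : b <= b + d by rewrite lerDl.
have dE : b + d - b = d by rewrite addrC addKr.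
have ccst : continuous (fun _ : R => g b) by move=> x; exact: cst_continuous.
rewrite -[X in g b * X]dE -Rintegral_itv_cst// -RintegralB//;
  [|exact: continuous_integrable_itv|exact: continuous_integrable_itv].
rewrite -[X in _ <= _ * X]dE; apply: normr_Rintegral_le => //.
  by move=> x; apply: continuousB; [exact: gc|exact: ccst].
by move=> x /andP[h1 h2]; apply: gL; rewrite h1 ltW.
Qed.

Lemma riemann_sum_bound g (b L : R) N : continuous g -> (0 < N)%N ->
  (forall x y, b <= x <= b + 1 -> b <= y <= b + 1 -> `|g x - g y| <= L * `|x - y|) ->
  `|\int[mu]_(x in `[b, b + 1[) g x - N%:R^-1 * \sum_(j < N) g (b + j%:R / N%:R)| <= L / N%:R.
Proof.
move=> gc N0 gL; have NR : 0 < N%:R :> R by rewrite ltr0n.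
pose d : R := N%:R^-1; have d0 : 0 < d by rewrite invr_gt0.
have Nd : N%:R * d = 1 by rewrite mulfV// gt_eqF.
rewrite -{1}Nd Rintegral_steps ?(ltW d0)// mulr_sumr -sumrB (le_trans (ler_norm_sum _ _ _))//.
have -> : L / N%:R = \sum_(j < N) L * d * d.
  by rewrite sumr_const card_ord -[RHS]mulr_natr -!mulrA [d * N%:R]mulrC Nd mulr1.
apply: ler_sum => j _; rewrite -[j.+1%:R]natr1 mulrDl mul1r addrA [d * _]mulrC.
have j0 : 0 <= j%:R * d by rewrite mulr_ge0// ltW.
have j1 : j%:R * d + d <= 1.
  have : (j%:R + 1) * d <= N%:R * d by rewrite ler_pM2r// natr1 ler_nat.
  by rewrite Nd mulrDl mul1r.
apply: riemann_cell; rewrite ?(ltW d0)// => x /andP[x1 x2].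
have L0 : 0 <= L.
  have := gL (b + 1) b; rewrite lexx lerDl ler01 lexx /= => /(_ isT isT).
  have -> : b + 1 - b = 1 by ring.
  by rewrite normr1 mulr1; exact: le_trans.
rewrite (le_trans (gL _ _ _ _))//; [by apply/andP; split; lra|by apply/andP; split; lra|].
by rewrite ler_wpM2l// ger0_norm; lra.
Qed.

(** Monotone convergence for [|g|] yields integrability on the whole line; the error is then at most
    the integral of [|g|] over the complement of the window, which tends to 0. *)
Lemma Rintegral_exhaust g (b M : R) : continuous g ->
  (forall n : nat, \int[mu]_(x in `[b - n%:R, b + n%:R[) `|g x| <= M) ->
  forall e, 0 < e -> exists n0, forall n : nat, (n0 <= n)%N ->
    `|\int[mu]_(x in `[b - n%:R, b + n%:R[) g x - \int[mu]_x g x| <= e.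
Proof.
move=> gc gM e e0.
pose F (n : nat) : set R := `[b - n%:R, b + n%:R[%classic.
have gnc : continuous (fun x => `|g x|).
  by move=> x; apply: (continuous_comp (gc x)); exact: norm_continuous.
have mg : measurable_fun [set: R] g by exact: continuous_measurable_fun.
have mgn : measurable_fun [set: R] (fun x => `|g x|) by exact: continuous_measurable_fun.
have FT : \bigcup_n F n = [set: R].
  apply/seteqP; split=> // x _; exists (Num.bound `|x - b|) => //.
  rewrite /F /= in_itv/=.
  have := archi_boundP (normr_ge0 (x - b)).
  rewrite ltr_norml => /andP[h1 h2]; apply/andP; split; lra.
have F_int n h : continuous h -> mu.-integrable (F n) (EFin \o h).
  by move=> hc; exact: continuous_integrable_itv.
have cvg1 : (\int[mu]_(x in F n) (`|g x|)%:E)%E @[n --> \oo] --> (\int[mu]_x (`|g x|)%:E)%E.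
  rewrite -FT; apply: ge0_nondecreasing_set_cvg_integral => //.
  - apply/nondecreasing_seqP => n; apply/subsetPset => x; rewrite /F /= !in_itv/= -natr1.
    by move=> /andP[h1 h2]; apply/andP; split; lra.
  - move=> n; exact: measurable_itv.
  - by move=> n; apply/measurable_EFinP; exact: measurable_funTS.
have FE n : (\int[mu]_(x in F n) (`|g x|)%:E = (\int[mu]_(x in F n) `|g x|)%:E)%E.
  rewrite /Rintegral fineK// integrable_fin_num//; first exact: measurable_itv.
  exact: (F_int n _ gnc).
have gfin : (\int[mu]_x (`|g x|)%:E < +oo)%E.
  apply: (@le_lt_trans _ _ M%:E); last by rewrite ltry.
  rewrite -(cvg_lim _ cvg1)//; apply: lime_le; first by apply/cvg_ex; eexists; exact: cvg1.
  by apply: nearW => n; rewrite FE lee_fin; exact: gM.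
have gi : mu.-integrable [set: R] (EFin \o g).
  by apply/integrableP; split => //; exact: measurableT_comp.
have gni : mu.-integrable [set: R] (EFin \o (fun x => `|g x|)).
  exact: (integrable_norm gi).
move: cvg1; under eq_cvg do rewrite FE.
have -> : (\int[mu]_x (`|g x|)%:E = (\int[mu]_x `|g x|)%:E)%E.
  by rewrite /Rintegral fineK// integrable_fin_num.
move=> /fine_cvgP[_] /cvgrPdist_le /(_ _ e0)[n0 _ hn0].
exists n0 => n nn0; have := hn0 n nn0; rewrite /= => hn.
have mF : measurable (F n) by exact: measurable_itv.
have split h : mu.-integrable [set: R] (EFin \o h) ->
    \int[mu]_x h x = \int[mu]_(x in F n) h x + \int[mu]_(x in ~` F n) h x.
  move=> hi; rewrite -(setvU (F n)) setUC Rintegral_setU//.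
  - exact: measurableC.
  - by rewrite setUC setvU.
  - by apply/disj_setPS => x [].
have sub h : mu.-integrable [set: R] (EFin \o h) -> mu.-integrable (~` F n) (EFin \o h).
  by apply: integrableS => //; exact: measurableC.
rewrite (split g gi) opprD addrA subrr add0r normrN.
apply: le_trans (le_normr_Rintegral _ _) _.
- exact: measurableC.
- exact: sub.
apply: le_trans hn.
by rewrite (split _ gni) addrC addKr ler_norm.
Qed.

End RealIntegrals.

(** * Complex integrals over unit cells and over the line *)

Section ComplexIntegrals.
Context {R : realType}.
Local Notation mu := (@lebesgue_measure R).
Implicit Types g : R -> R[i].

Definition cell g (b : R) : R[i] :=
  (\int[mu]_(x in `[b, b + 1[) complex.Re (g x)) +i*
  (\int[mu]_(x in `[b, b + 1[) complex.Im (g x)).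

Definition loc_lip g := forall b : R, exists L, forall x y,
  b <= x <= b + 1 -> b <= y <= b + 1 -> normc (g x - g y) <= L * `|x - y|.

Lemma loc_lip_cont (p : R[i] -> R) g : loc_lip g ->
  (forall z w, `|p z - p w| <= normc (z - w)) -> continuous (fun x => p (g x)).
Proof.
(* Starting at [x - 1/2] makes the unit interval a neighbourhood of [x]. *)
move=> gL pl x; apply/cvgrPdist_le => e e0; have [L hL] := gL (x - 1/2).
have L1 : 0 < `|L| + 1 by rewrite ltr_wpDl.
near=> t.
have t1 : `|x - t| < 1/2 by near: t; apply: cvgr_dist_lt; [exact: cvg_id|rewrite divr_gt0].
have : `|x - t| < e / (`|L| + 1).
  by near: t; apply: cvgr_dist_lt; [exact: cvg_id|rewrite divr_gt0].
rewrite ltr_pdivlMr// => t2.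
move: (t1); rewrite ltr_norml => /andP[t3 t4].
rewrite (le_trans (pl _ _))// (le_trans (hL _ _ _ _))//; [apply/andP; split; lra|apply/andP; split; lra|].
rewrite (le_trans _ (ltW t2))// mulrC ler_wpM2l//.
by rewrite (le_trans (ler_norm L))// lerDl.
Unshelve. all: by end_near.
Qed.

Lemma Re_dist (z w : R[i]) : `|complex.Re z - complex.Re w| <= normc (z - w).
Proof. by rewrite -Re_opp -Re_add Re_le_normc. Qed.

Lemma Im_dist (z w : R[i]) : `|complex.Im z - complex.Im w| <= normc (z - w).
Proof. by rewrite -Im_opp -Im_add Im_le_normc. Qed.

Lemma riemann_clim g b : loc_lip g ->
  clim (fun N => N%:R^-1 * \sum_(j < N) g (b + j%:R / N%:R)) (cell g b).
Proof.
move=> gL; have cR := loc_lip_cont gL Re_dist; have cI := loc_lip_cont gL Im_dist.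
have [L hL] := gL b => e e0.
have L0 : 0 <= L.
  have := hL (b + 1) b; rewrite lexx lerDl ler01 lexx /= => /(_ isT isT).
  have -> : b + 1 - b = 1 by ring.
  by rewrite normr1 mulr1; apply: le_trans; exact: normc_ge0.
have B0 : 0 <= 2 * L / e by rewrite divr_ge0 ?mulr_ge0// ltW.
exists (Num.bound (2 * L / e)).+1 => N hN.
have N0 : (0 < N)%N by exact: leq_ltn_trans hN.
have NR : 0 < N%:R :> R by rewrite ltr0n.
have hb : 2 * L / N%:R <= e.
  rewrite ler_pdivrMr// [e * _]mulrC -ler_pdivrMr//.
  by rewrite (le_trans (ltW (archi_boundP B0)))// ler_nat ltnW.
rewrite (le_trans (normc_le_ReIm _))//.
have -> : e = e / 2 + e / 2 by rewrite -splitr.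
have NE : (N%:R^-1 : R[i]) = (N%:R^-1 : R)%:C by rewrite fmorphV (rmorph_nat (real_complex R)).
apply: lerD.
  rewrite Re_add Re_opp NE Re_mul /= mul0r subr0 Re_sum distrC.
  rewrite (le_trans (riemann_sum_bound (L := L) cR N0 _))//; last by lra.
  by move=> x y xb yb; rewrite (le_trans (Re_dist _ _))// hL.
rewrite Im_add Im_opp NE Im_mul /= mul0r addr0 Im_sum distrC.
rewrite (le_trans (riemann_sum_bound (L := L) cI N0 _))//; last by lra.
by move=> x y xb yb; rewrite (le_trans (Im_dist _ _))// hL.
Qed.

Lemma int_window (f : int -> R[i]) s : sums f s ->
  clim (fun n : nat => \sum_(k < n + n) f (k%:Z - n%:Z)) s.
Proof.
move=> fs; have [M fM] := sums_bounded fs.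
pose F (n : nat) (i : int) := if (- n%:Z <= i < n%:Z) then f i else 0.
have [||||S FS Sl] := @tannery _ _ F f (fun i => normc (f i)) M
    (fun n => \sum_(k < n + n) f (k%:Z - n%:Z)).
- by move=> n i; rewrite /F; case: ifP => // _; rewrite normc0 normc_ge0.
- exact: fM.
- move=> i e e0; exists `|i|.+1 => n ni; rewrite /F ifT ?subrr ?normc0 ?(ltW e0)//; lia.
- move=> n; have s_inj : injective (fun k : 'I_(n + n) => k%:Z - n%:Z).
    by move=> k k' /addIr[] /val_inj.
  have := @sums_ord R _ _ _ (F n) s_inj; rewrite (_ : \sum_k _ = \sum_(k < n + n) f (k%:Z - n%:Z)).
    apply=> i nk; rewrite /F; case: ifP => // ni; exfalso.
    have kP : (absz (i + n%:Z)%R < n + n)%N by lia.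
    apply: (nk (Ordinal kP)) => /=; lia.
  apply: eq_bigr => k _; rewrite /F ifT//; have := ltn_ord k; lia.
by rewrite (sums_unique fs FS).
Qed.

(** The bounds [c] do two things: they make the integrand absolutely integrable, so that the
    integral over the line is the limit over symmetric windows, and they make the sum of the cells
    absolutely convergent. The two values are then compared along those windows. *)
Lemma sums_cells g (b : R) (c : int -> R) M : loc_lip g ->
  (forall (j : int) t, 0 <= t <= 1 -> normc (g (b + j%:~R + t)) <= c j) ->
  bounded_sums c M ->
  sums (fun j : int => cell g (b + j%:~R)) (integralc g).
Proof.
move=> gL gc cM; have cR := loc_lip_cont gL Re_dist; have cI := loc_lip_cont gL Im_dist.
have part (p : R[i] -> R) : (forall z w, `|p z - p w| <= normc (z - w)) -> p 0 = 0 ->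
    (forall j : int, `|\int[mu]_(x in `[b + j%:~R, b + j%:~R + 1[) p (g x)| <= c j) /\
    (forall e, 0 < e -> exists n0, forall n : nat, (n0 <= n)%N ->
    `|\sum_(k < n + n) \int[mu]_(x in `[b + (k%:Z - n%:Z)%:~R, b + (k%:Z - n%:Z)%:~R + 1[) p (g x)
      - \int[mu]_x p (g x)| <= e).
  move=> pl p0; have pc := loc_lip_cont gL pl.
  have pn z : `|p z| <= normc z by have := pl z 0; rewrite p0 !subr0.
  have apc : continuous (fun x => `|p (g x)|).
    by move=> x; apply: (continuous_comp (pc x)); exact: norm_continuous.
  have bnd q (j : int) : continuous q -> (forall x, `|q x| <= normc (g x)) ->
      `|\int[mu]_(x in `[b + j%:~R, b + j%:~R + 1[) q x| <= c j.
    move=> qc qn; rewrite -[leRHS]mulr1.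
    rewrite -[X in _ <= _ * X](addrK (b + j%:~R) 1) [1 + _]addrC.
    apply: normr_Rintegral_le => //; first by rewrite lerDl.
    move=> x /andP[x1 x2]; rewrite (le_trans (qn x))//.
    have -> : x = b + j%:~R + (x - (b + j%:~R)) by rewrite addrC subrK.
    by apply: gc; apply/andP; split; lra.
  have stp q (n : nat) : continuous q -> \int[mu]_(x in `[b - n%:R, b + n%:R[) q x =
      \sum_(k < n + n) \int[mu]_(x in `[b + (k%:Z - n%:Z)%:~R, b + (k%:Z - n%:Z)%:~R + 1[) q x.
    move=> qc; have := @Rintegral_steps R q (b - n%:R) 1 (n + n) qc ler01.
    rewrite mulr1 natrD addrA subrK => ->; apply: eq_bigr => k _.
    rewrite !mulr1 -natr1 addrA.
    by have -> : b - n%:R + k%:R = b + (k%:Z - n%:Z)%:~R by rewrite intrB addrA addrAC.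
  split; first by move=> j; exact: bnd.
  have aM (n : nat) : \int[mu]_(x in `[b - n%:R, b + n%:R[) `|p (g x)| <= M.
    rewrite (stp _ _ apc).
    have k_inj : injective (fun k : 'I_(n + n) => k%:Z - n%:Z).
      by move=> k k' /addIr[] /val_inj.
    pose J := [fset i in map (fun k : 'I_(n + n) => k%:Z - n%:Z) (enum 'I_(n + n))]%fset.
    apply: le_trans (cM J).
    have -> : \sum_(i <- J) c i = \sum_(k < n + n) c (k%:Z - n%:Z).
      transitivity (\sum_(i <- map (fun k : 'I_(n + n) => k%:Z - n%:Z) (enum 'I_(n + n))) c i).
        apply: perm_big; apply: uniq_perm; rewrite ?fset_uniq ?map_inj_uniq// -?enumT ?enum_uniq//.
        by move=> i; rewrite !inE.
      by rewrite big_map big_enum.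
    apply: ler_sum => k _; rewrite (le_trans (ler_norm _))// bnd// => x.
    by rewrite normr_id.
  move=> e e0; have [n0 hn0] := Rintegral_exhaust pc aM e0.
  by exists n0 => n /hn0; rewrite (stp _ _ pc).
have [R1 R2] := part _ Re_dist erefl; have [I1 I2] := part _ Im_dist erefl.
have [s hs] : exists s, sums (fun j : int => cell g (b + j%:~R)) s.
  apply: (@sums_exists _ _ _ (2 * M)); apply: bounded_sumsW (bounded_sumsZ _ cM) => // j.
  by rewrite (le_trans (normc_le_ReIm _))//= mulrDl mul1r lerD.
suff : clim (fun n : nat => \sum_(k < n + n) cell g (b + (k%:Z - n%:Z)%:~R)) (integralc g).
  by move/(clim_unique (int_window hs)) => <-.
move=> e e0; have e2 : 0 < e / 2 by rewrite divr_gt0.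
have [n1 h1] := R2 _ e2; have [n2 h2] := I2 _ e2.
exists (maxn n1 n2) => n; rewrite geq_max => /andP[/h1{}h1 /h2{}h2].
rewrite (le_trans (normc_le_ReIm _))// [leRHS]splitr.
by rewrite Re_add Im_add Re_opp Im_opp Re_sum Im_sum lerD.
Qed.

End ComplexIntegrals.

(** * Fourier coefficients of a sum of products of powers *)

Section TaylorFamilies.
Context {R : realType}.
Local Notation mu := (@lebesgue_measure R).
Implicit Types (x y : R) (z w : R[i]).

Definition hline y x : R[i] := x +i* y.

Lemma hlineD y x x' : hline y (x + x') = hline y x + x'%:C.
Proof. by apply: complexP => //=; rewrite addr0. Qed.

Lemma loc_taylor_lip (h : R[i] -> R[i]) y : loc_taylor h -> 0 < y ->
  loc_lip (fun x => h (hline y x)).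
Proof.
move=> hT y0 b; have [d d0 [K K0 hK]] := hT y (`|b| + 1 + `|y|) y0.
(* The term [2 * K / d] handles points more than [d] apart, where only the bound [K] on the values
   is available; closer points use the expansion, with slope at most [K + K * d]. *)
exists (2 * K + 2 * K / d * 1 + K * d) => s t /andP[s0 s1] /andP[t0 t1].
have bnd r : b <= r <= b + 1 -> taylor_at h d K (hline y r).
  move=> /andP[r0 r1]; apply: hK; first exact: lexx.
  rewrite (le_trans (normc_le_ReIm _))//= lerD2r ler_norml.
  by have := ler_norm b; have := ler_norm (- b); rewrite normrN => *; apply/andP; split; lra.
have [ts [lam lamK tl]] := bnd s (introT andP (conj s0 s1)).
have [tt _] := bnd t (introT andP (conj t0 t1)).
set D := `|s - t|; have D0 : 0 <= D by exact: normr_ge0.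
have KD : 0 <= 2 * K / d by rewrite divr_ge0 ?mulr_ge0// ltW.
have Kd : 0 <= K * d by rewrite mulr_ge0// ltW.
have [Dd|dD] := leP D d; last first.
  rewrite (le_trans (normcB _ _))//.
  have : 2 * K <= 2 * K / d * D by rewrite mulrAC ler_pdivlMr// ler_wpM2l ?mulr_ge0// ltW.
  have := mulr_ge0 K0 D0; have := mulr_ge0 Kd D0; lra.
have hst : hline y t = hline y s + (t - s)%:C by rewrite -hlineD addrC subrK.
have nD : normc (t - s)%:C = D by rewrite normcR distrC.
have := tl ((t - s)%:C); rewrite nD -hst => /(_ Dd) h1.
rewrite distcC.
have -> : h (hline y t) - h (hline y s) =
  (h (hline y t) - h (hline y s) - lam * (t - s)%:C) + lam * (t - s)%:C by rewrite subrK.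
rewrite (le_trans (normcD _ _))// normcM nD.
have h2 : normc lam * D <= K * D by rewrite ler_wpM2r.
have h3 : K * D ^+ 2 <= K * d * D by rewrite expr2 mulrA ler_wpM2r// ler_wpM2l.
have := mulr_ge0 K0 D0; have := mulr_ge0 KD D0; lra.
Qed.

Lemma loc_lip_shift (g : R -> R[i]) s : loc_lip g -> loc_lip (fun x => g (x + s)).
Proof.
move=> gL b; have [L hL] := gL (b + s); exists L => x y /andP[x0 x1] /andP[y0 y1].
have -> : x - y = x + s - (y + s) by ring.
by apply: hL; apply/andP; split; lra.
Qed.

Lemma loc_lipZ (g : R -> R[i]) c : loc_lip g -> loc_lip (fun x => c * g x).
Proof.
move=> gL b; have [L hL] := gL b; exists (normc c * L) => x y xb yb.
by rewrite -mulrBr normcM -mulrA ler_wpM2l ?normc_ge0// hL.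
Qed.

(** Both sides are limits of the same Riemann sums, which takes the place of a change of variables;
    [cellZ] is obtained in the same way. *)
Lemma cell_shift (g : R -> R[i]) s b : loc_lip g ->
  cell (fun x => g (x + s)) b = cell g (b + s).
Proof.
move=> gL; have h1 := riemann_clim b (loc_lip_shift s gL).
have h2 := riemann_clim (b + s) gL; apply: (clim_unique h1).
move: h2; congr clim; apply/funext => N; congr (_ * _); apply: eq_bigr => j _.
by rewrite addrAC.
Qed.

Lemma cellZ (g : R -> R[i]) c b : loc_lip g -> cell (fun x => c * g x) b = c * cell g b.
Proof.
move=> gL; have h1 := riemann_clim b (loc_lipZ c gL).
have := clim_lin c (riemann_clim b gL) (clim_cst 0); rewrite addr0 => h2.
apply: (clim_unique h1); move: h2; congr clim; apply/funext => N.
by rewrite addr0 mulrCA mulr_sumr.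
Qed.

Variables (q : nat) (tau : R).
Local Notation psi := (psi q tau).

Lemma psi_bound al be y z : 0 < y -> y <= complex.Im z ->
  normc (psi al be z) <= expR (`|tau| * pi) * (y * y) ^- q.
Proof.
move=> y0 yz; have z0 := lt_le_trans y0 yz.
rewrite (le_trans (normc_psi_le q tau al be z0))// ler_wpM2l ?expR_ge0//.
have yy : 0 < y * y by rewrite mulr_gt0.
have h : y * y <= normc (z + al%:C) * normc (z + be%:C).
  by apply: ler_pM; rewrite ?(ltW y0)//; apply: le_trans yz (Im_le_addR _ _).
rewrite lef_pV2 ?posrE ?exprn_gt0 ?(lt_le_trans yy h)//.
by rewrite lerXn2r ?nnegrE ?(ltW yy)// (le_trans (ltW yy)).
Qed.

Lemma psi_loc_taylor al be : loc_taylor (psi al be).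
Proof.
move=> y W y0; have [d d0 [K K0 hK]] := psi_taylor q tau y0.
set B := expR (`|tau| * pi) * (y * y) ^- q.
have B0 : 0 <= B by rewrite mulr_ge0 ?expR_ge0// invr_ge0 exprn_ge0// mulr_ge0// ltW.
exists d => //; exists (B * (1 + K)); first by rewrite mulr_ge0// addr_ge0.
move=> z yz _; have zB := psi_bound al be y0 yz; rewrite -/B in zB.
have KB : 0 <= K * B by rewrite mulr_ge0.
split; first by lra.
have [lam lamK hl] := hK al be z yz.
exists (psi al be z * lam).
  rewrite normcM; have := ler_pM (normc_ge0 _) (normc_ge0 _) zB lamK; lra.
move=> w wd; have -> : psi al be (z + w) - psi al be z - psi al be z * lam * w =
  psi al be (z + w) - psi al be z * (1 + lam * w) by ring.
rewrite (le_trans (hl w wd))// ler_wpM2r ?sqr_ge0//.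
have := ler_wpM2l K0 zB; lra.
Qed.

Variables (I : choiceType) (c : I -> R[i]) (al be : I -> R) (M : R).
Let f i z := c i * psi (al i) (be i) z.
Hypothesis f_bnd : bounded_sums (fun i => normc (f i 'i)) M.
Variable h : R[i] -> R[i].
Hypothesis h_sum : forall z, 0 < complex.Im z -> sums (f^~ z) (h z).
Hypothesis h_per : forall z, 0 < complex.Im z -> h (z + 1) = h z.

Let i_upper : 0 < complex.Im ('i : R[i]). Proof. by rewrite /= ltr01. Qed.

Lemma family_bound y W : 0 < y -> exists2 K, 0 <= K &
  forall i z, y <= complex.Im z -> normc z <= W -> normc (f i z) <= K * normc (f i 'i).
Proof.
move=> y0; have [K K0 hK] := psi_harnack q tau (W + 1) y0; exists K => // i z yz zW.
have := hK (al i) (be i) 'i (z - 'i) i_upper; rewrite addrC subrK => /(_ yz) h1.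
rewrite /f !normcM mulrCA ler_wpM2l ?normc_ge0// h1// (le_trans (normcB _ _))// lerD//.
by rewrite /= expr0n expr1n add0r sqrtr1.
Qed.

(** The constants of [psi_taylor] do not depend on [i] and its remainder is relative, so the
    derivatives [f i z * lam i] and the remainders are dominated by multiples of [normc (f i 'i)]
    and can be summed. *)
Lemma family_loc_taylor : loc_taylor h.
Proof.
move=> y W y0; have [K1 K10 hK1] := family_bound W y0.
have [d d0 [K K0 hK]] := psi_taylor q tau y0.
have M0 := bounded_sums_ge0 f_bnd.
have KM : 0 <= K1 * M by rewrite mulr_ge0.
have KKM : 0 <= K * (K1 * M) by rewrite mulr_ge0.
exists (Num.min d (y / 2)); first by rewrite lt_min d0 divr_gt0.
exists (K1 * M * (1 + K)); first by rewrite mulr_ge0// addr_ge0.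
move=> z yz zW; have z0 := lt_le_trans y0 yz.
have bz : bounded_sums (fun i => normc (f i z)) (K1 * M).
  by apply: bounded_sumsW (bounded_sumsZ K10 f_bnd) => i; exact: hK1.
split; first by have := sums_norm_le (h_sum z0) bz; lra.
have [lam hlam] := choice (fun i => let: ex_intro2 l l1 l2 := hK (al i) (be i) z yz in
  ex_intro (fun l => normc l <= K /\ forall w, normc w <= d ->
      normc (psi (al i) (be i) (z + w) - psi (al i) (be i) z * (1 + l * w)) <=
      K * normc (psi (al i) (be i) z) * normc w ^+ 2) l (conj l1 l2)).
have lb : bounded_sums (fun i => normc (f i z * lam i)) (K * (K1 * M)).
  apply: bounded_sumsW (bounded_sumsZ K0 bz) => i.
  by rewrite normcM mulrC ler_wpM2r ?normc_ge0//; have [] := hlam i.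
have [L hL] := sums_exists lb.
exists L; first by have := sums_norm_le hL lb; lra.
move=> w; rewrite le_min => /andP[wd wy].
have zw0 : 0 < complex.Im (z + w).
  rewrite Im_add; have := Im_le_normc w; rewrite ler_norml => /andP[+ _]; lra.
have s1 := sums_lin (-1) (h_sum z0) (h_sum zw0).
have s2 := sums_lin (- w) hL s1.
have -> : h (z + w) - h z - L * w = - w * L + (-1 * h z + h (z + w)) by ring.
apply: (@le_trans _ _ (K * (K1 * M) * normc w ^+ 2)); last first.
  by rewrite ler_wpM2r ?sqr_ge0//; lra.
apply: (sums_norm_le s2).
have : bounded_sums (fun i => K * normc w ^+ 2 * normc (f i z)) (K * normc w ^+ 2 * (K1 * M)).
  by apply: bounded_sumsZ => //; rewrite mulr_ge0// sqr_ge0.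
rewrite mulrAC; apply: bounded_sumsW => i.
have -> : - w * (f i z * lam i) + (-1 * f i z + f i (z + w)) =
  c i * (psi (al i) (be i) (z + w) - psi (al i) (be i) z * (1 + lam i * w)) by rewrite /f; ring.
have [_ /(_ w wd) hw] := hlam i.
rewrite normcM (le_trans (ler_wpM2l (normc_ge0 _) hw))// le_eqVlt; apply/orP; left.
by apply/eqP; rewrite /f normcM; ring.
Qed.

(** The exchange of sum and integral, carried out on Riemann sums: for fixed [i] they converge to a
    cell, and a multiple of [normc (f i 'i)] dominates them uniformly in [N]. *)
Lemma family_dft n y x0 : 0 < y -> exists2 S,
  sums (fun i => cell (fun x => f i (hline y x) * e_ (- (n%:~R * hline y x))) x0) S &
  clim (fun N => dft h N n (hline y x0)) S.
Proof.
move=> y0; have [K K0 hK] := family_bound (normc (hline y x0) + 1) y0.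
have M0 := bounded_sums_ge0 f_bnd.
pose E := expR (2 * pi * (n%:~R * y)).
have zf j N : y <= complex.Im (hline y x0 + frac j N) by rewrite Im_addfrac.
have zfW j N : (j <= N)%N -> normc (hline y x0 + frac j N) <= normc (hline y x0) + 1.
  by move=> jN; rewrite (le_trans (normcD _ _))// lerD ?normc_frac_le1.
have eE j N : normc (e_ (- (n%:~R * (hline y x0 + frac j N)))) = E.
  rewrite normc_e Im_opp Im_mul -(rmorph_int (real_complex R))/= mul0r !addr0.
  by rewrite mulrN opprK.
apply: (@tannery _ _ (fun N i => dft (f i) N n (hline y x0)) _
    (fun i => K * E * normc (f i 'i)) (K * E * M)).
- move=> N i; rewrite /dft; have [->|N0] := posnP N.
    rewrite big_ord0 mulr0 normc0 mulr_ge0 ?normc_ge0// mulr_ge0// expR_ge0//.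
  rewrite normcM normcV normc_nat mulrC ler_pdivrMr ?ltr0n//.
  rewrite (le_trans (normc_sum _ _ _))//.
  have -> : K * E * normc (f i 'i) * N%:R = \sum_(j < N) K * E * normc (f i 'i).
    by rewrite sumr_const card_ord mulr_natr.
  apply: ler_sum => j _; rewrite normcM eE mulrAC ler_wpM2r ?expR_ge0//.
  by apply: hK; [exact: zf|apply: zfW; exact: ltnW].
- by apply: bounded_sumsZ => //; rewrite mulr_ge0// expR_ge0.
- move=> i; have fT : loc_lip (fun x => f i (hline y x) * e_ (- (n%:~R * hline y x))).
    have := loc_lipZ (c i) (loc_taylor_lip
      (loc_taylor_mul (psi_loc_taylor (al i) (be i)) (loc_taylor_e n)) y0).
    by congr loc_lip; apply/funext => x; rewrite mulrA.
  have := riemann_clim x0 fT; congr clim; apply/funext => N; congr (_ * _).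
  by apply: eq_bigr => j _; rewrite hlineD.
- move=> N; rewrite /dft; under eq_fun do rewrite mulr_sumr; rewrite mulr_sumr.
  have := @sums_sum R N I (fun j i => N%:R^-1 * (f i (hline y x0 + frac j N) *
       e_ (- (n%:~R * (hline y x0 + frac j N)))))
    (fun j => N%:R^-1 * (h (hline y x0 + frac j N) * e_ (- (n%:~R * (hline y x0 + frac j N))))).
  apply => j; have zj : 0 < complex.Im (hline y x0 + frac j N) by rewrite Im_addfrac.
  apply: sumsZ; rewrite [h _ * _]mulrC; set e := e_ _.
  rewrite (_ : (fun i => _) = (fun i => e * f i (hline y x0 + frac j N))).
    exact: sumsZ (h_sum zj).
  by apply/funext => i; rewrite mulrC.
Qed.

Theorem family_fourier : exists a : int -> R[i],
  (forall z, 0 < complex.Im z -> sums (fun n => a n * e_ (n%:~R * z)) (h z)) /\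
  forall n y x0, 0 < y ->
    sums (fun i => cell (fun x => f i (hline y x) * e_ (- (n%:~R * hline y x))) x0) (a n).
Proof.
(* [choice] needs a value for every [z]; off the upper half plane it is the arbitrary 0. *)
have lim_ex n z : exists l, 0 < complex.Im z -> clim (fun N => dft h N n z) l.
  have [z0|] := boolP (0 < complex.Im z); last by exists 0.
  have [S _ hS] := family_dft n (complex.Re z) z0.
  by exists S => _; move: hS; case: (z).
have [co hal] := choice (fun nz : int * R[i] => lim_ex nz.1 nz.2).
have [a [a1 a2]] := @fourier_expansion R h h_per family_loc_taylor (fun n z => co (n, z))
  (fun n z => hal (n, z)).
exists a; split=> // n y x0 y0; have [S hS1 hS2] := family_dft n x0 y0.
by rewrite (clim_unique (a1 n (hline y x0) y0) hS2).
Qed.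

End TaylorFamilies.

(** * Moebius action and the summand of the Poincare series *)

Section Matrices.
Context {R : realType}.
Implicit Types (g h s : 'M[R]_2) (z : R[i]).

Lemma ord2P (i : 'I_2) : i = 0 \/ i = 1.
Proof. by case: i => [[|[|//]] ?]; [left|right]; exact: val_inj. Qed.

Lemma mx2P g h : g 0 0 = h 0 0 -> g 0 1 = h 0 1 -> g 1 0 = h 1 0 -> g 1 1 = h 1 1 -> g = h.
Proof.
by move=> *; apply/matrixP => i j; case: (ord2P i) => ->; case: (ord2P j) => ->.
Qed.

Lemma mulmx2 g h i j : (g *m h) i j = g i 0 * h 0 j + g i 1 * h 1 j.
Proof.
rewrite mxE !big_ord_recl big_ord0 addr0; congr (_ + g _ _ * h _ _); exact: val_inj.
Qed.

Lemma mx2E a b c d : ((mx2 a b c d 0 0 = a) * (mx2 a b c d 0 1 = b) *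
  (mx2 a b c d 1 0 = c) * (mx2 a b c d 1 1 = d :> R))%type.
Proof. by rewrite !mxE. Qed.

Lemma det2 g : \det g = g 0 0 * g 1 1 - g 0 1 * g 1 0.
Proof.
rewrite (expand_det_row _ 0) !big_ord_recl big_ord0 addr0 /cofactor !det_mx11 !mxE.
have e1 : lift 0 0 = 1 :> 'I_2 by exact: val_inj.
have e2 : lift (1 : 'I_2) 0 = 0 :> 'I_2 by exact: val_inj.
by rewrite /= !e1 !e2 /= addn0 expr0 expr1; ring.
Qed.

Lemma SL2E g : SL2 g -> g 0 0 * g 1 1 - g 0 1 * g 1 0 = 1.
Proof. by rewrite /SL2 /= det2. Qed.

Lemma SL2_unit g : SL2 g -> g \in unitmx.
Proof. by rewrite unitmxE => ->; exact: unitr1. Qed.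

Lemma SL2M g h : SL2 g -> SL2 h -> SL2 (g *m h).
Proof. by rewrite /SL2 /= det_mulmx => -> ->; rewrite mulr1. Qed.

Lemma invmx2 g : SL2 g -> invmx g = mx2 (g 1 1) (- g 0 1) (- g 1 0) (g 0 0).
Proof.
move=> gS; have dE := SL2E gS; set h := mx2 _ _ _ _.
have gh : g *m h = 1%:M.
  by apply: mx2P; rewrite mulmx2 /h !mx2E !mxE/=; rewrite -?[RHS]dE; ring.
by rewrite -[RHS]mul1mx -(mulVmx (SL2_unit gS)) -mulmxA gh mulmx1.
Qed.

Lemma SL2V g : SL2 g -> SL2 (invmx g).
Proof. by rewrite /SL2 /= det_inv => ->; rewrite invr1. Qed.

Lemma invmxM2 g h : SL2 g -> SL2 h -> invmx (g *m h) = invmx h *m invmx g.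
Proof.
move=> gS hS; have ug := SL2_unit gS; have uh := SL2_unit hS.
have e : (g *m h) *m (invmx h *m invmx g) = 1%:M by rewrite mulmxA mulmxK// mulmxV.
by rewrite -[RHS]mul1mx -(mulVmx (SL2_unit (SL2M gS hS))) -mulmxA e mulmx1.
Qed.

Lemma Im_num g z : complex.Im (jfac g z) = g 1 0 * complex.Im z.
Proof. by case: z => x y; rewrite /jfac /= mul0r !addr0. Qed.

Lemma jfac_neq0 g z : SL2 g -> 0 < complex.Im z -> jfac g z != 0.
Proof.
move=> /SL2E dE z0; apply/eqP => j0.
have := Im_num g z; rewrite j0 /= => /esym/eqP; rewrite mulf_eq0 (gt_eqF z0) orbF => /eqP c0.
have d0 : g 1 1 = 0.
  by move: j0; rewrite /jfac c0 rmorph0 mul0r add0r => /(congr1 (@complex.Re R)).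
by move/eqP: dE; rewrite c0 d0 !mulr0 subrr eq_sym oner_eq0.
Qed.

(** The determinant is left general: besides [SL2], this serves the matrix of determinant [2 |r|]
    that sends [u] to the base of the power in [I_par]. *)
Lemma Im_moebius g z : jfac g z != 0 ->
  complex.Im (moebius g z) * normc (jfac g z) ^+ 2 = \det g * complex.Im z.
Proof.
move=> j0; have : moebius g z * jfac g z = (g 0 0)%:C * z + (g 0 1)%:C by rewrite divfK.
rewrite normc_sqr det2 /jfac; move: (moebius g z) => [u v].
case: z {j0} => x y /= [e1 e2].
rewrite !mul0r ?addr0 ?subr0 in e1 e2 *.
transitivity ((g 1 0 * x + g 1 1) * (u * (g 1 0 * y) + v * (g 1 0 * x + g 1 1)) -
  (g 1 0 * y) * (u * (g 1 0 * x + g 1 1) - v * (g 1 0 * y))); first by ring.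
by rewrite e1 e2; ring.
Qed.

Lemma Im_moebius_gt0 g z : SL2 g -> 0 < complex.Im z -> 0 < complex.Im (moebius g z).
Proof.
move=> gS z0; have j0 := jfac_neq0 gS z0.
have n0 : 0 < normc (jfac g z) ^+ 2 by rewrite exprn_gt0// normc_gt0.
by rewrite -(pmulr_lgt0 _ n0) Im_moebius// gS mul1r.
Qed.

Lemma jfacM g h z : jfac h z != 0 -> jfac (g *m h) z = jfac g (moebius h z) * jfac h z.
Proof.
move=> j0; rewrite {2}/jfac /moebius mulrDl mulrA divfK// {1}/jfac !mulmx2 /jfac.
by rewrite !(rmorphD, rmorphM)/=; ring.
Qed.

Lemma moebiusM g h z : SL2 g -> SL2 h -> 0 < complex.Im z ->
  moebius (g *m h) z = moebius g (moebius h z).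
Proof.
move=> gS hS z0; have jh := jfac_neq0 hS z0; have jg := jfac_neq0 gS (Im_moebius_gt0 hS z0).
rewrite {1}/moebius jfacM// [in RHS]/moebius; set w := moebius h z in jg *.
have wE : w * jfac h z = (h 0 0)%:C * z + (h 0 1)%:C by rewrite /w divfK.
have -> : ((g *m h) 0 0)%:C * z + ((g *m h) 0 1)%:C = ((g 0 0)%:C * w + (g 0 1)%:C) * jfac h z.
  rewrite mulrDl -mulrA wE !mulmx2 /jfac !(rmorphD, rmorphM)/=; ring.
by rewrite -mulf_div divff// mulr1.
Qed.

End Matrices.

Section Summand.
Context {R : realType}.
Variables (k : nat) (l : R) (m : int).
Hypotheses (k_even : ~~ odd k) (l_gt0 : 0 < l).
Implicit Types (g h s : 'M[R]_2) (z : R[i]).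

Local Notation q := (k./2).
Let tau : R := 2 * pi * m%:~R / l.

Definition phi g z : R[i] :=
  powc (moebius g z) (- (k%:R / 2) + twist l m) * jfac g z ^- k.

Lemma k_half : k = (q + q)%N.
Proof. by rewrite addnn even_halfK. Qed.

Lemma phi_slash g s z : SL2 g -> SL2 s -> 0 < complex.Im z ->
  jfac s z ^- k * phi g (moebius s z) = phi (g *m s) z.
Proof.
move=> gS sS z0; have js := jfac_neq0 sS z0.
by rewrite /phi moebiusM// jfacM// exprMn invfM; ring.
Qed.

Lemma phiN g z : phi (- g) z = phi g z.
Proof.
rewrite /phi; have jN : jfac (- g) z = - jfac g z.
  by rewrite /jfac !mxE !rmorphN/= mulNr opprD.
have -> : moebius (- g) z = moebius g z.
  by rewrite /moebius jN !mxE !rmorphN/= mulNr -opprD invrN mulrNN.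
by rewrite jN exprNn -signr_odd (negbTE k_even) expr0 mul1r.
Qed.

(** The part of the summand that does not depend on [z]. Its factor with [ln |a / c|] becomes the
    [m]-part of the Kloosterman summand; the one with [sgn_log] goes into [I_par]. *)
Definition phi_cst g : R[i] := ((g 0 0 * g 1 0) ^- q)%:C *
  expc ((0 +i* tau) * ((ln `|g 0 0 / g 1 0|)%:C + sgn_log (g 0 0 / g 1 0))).

(** [moebius g z] is [a / c] times [(z + b/a) / (z + d/c)], whose logarithm [logc_div] splits. As
    [k = 2 q], the factor [jfac g z ^- k] turns the real power [- q] of this quotient into a product
    of two powers [- q]. *)
Lemma phi_psi g z : SL2 g -> g 0 0 != 0 -> g 1 0 != 0 -> 0 < complex.Im z ->
  phi g z = phi_cst g * psi q tau (g 0 1 / g 0 0) (g 1 1 / g 1 0) z.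
Proof.
move=> gS a0 c0 z0; have M0 := Im_moebius_gt0 gS z0; have j0 := jfac_neq0 gS z0.
set al := g 0 1 / g 0 0; set be := g 1 1 / g 1 0.
have za : z + al%:C != 0 by exact: upper_addR_neq0.
have zb : z + be%:C != 0 by exact: upper_addR_neq0.
have aC : (g 0 0)%:C != 0 :> R[i] by rewrite (inj_eq (@complexI R)).
have cC : (g 1 0)%:C != 0 :> R[i] by rewrite (inj_eq (@complexI R)).
have nE : (g 0 0)%:C * z + (g 0 1)%:C = (g 0 0)%:C * (z + al%:C).
  by rewrite mulrDr -rmorphM /al mulrCA mulfV// mulr1.
have jE : jfac g z = (g 1 0)%:C * (z + be%:C).
  by rewrite mulrDr -rmorphM /be mulrCA mulfV// mulr1.
have mE : moebius g z = (g 0 0 / g 1 0)%:C * ((z + al%:C) / (z + be%:C)).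
  rewrite (_ : (g 0 0 / g 1 0)%:C = (g 0 0)%:C / (g 1 0)%:C) ?mulf_div -?nE -?jE//.
  by rewrite rmorphM/= fmorphV.
have ac0 : g 0 0 / g 1 0 != 0 by rewrite mulf_neq0// invr_eq0.
have lE : logc (moebius g z) = (ln `|g 0 0 / g 1 0|)%:C + sgn_log (g 0 0 / g 1 0) +
    (logc (z + al%:C) - logc (z + be%:C)).
  by rewrite mE logc_div ?Im_addR// -mE.
rewrite /phi /powc mulrDl expcD.
have -> : - (k%:R / 2) * logc (moebius g z) = - (q%:R * logc (moebius g z)).
  by rewrite {1}k_half natrD; field.
rewrite expcN expcMn expc_logc// lE mulrDr expcD psiE// /phi_cst.
have -> : moebius g z ^- q * (expc (twist l m * ((ln `|g 0 0 / g 1 0|)%:C + sgn_log (g 0 0 / g 1 0))) *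
   expc (twist l m * (logc (z + al%:C) - logc (z + be%:C)))) * jfac g z ^- k =
   (moebius g z ^- q * jfac g z ^- k) *
   (expc (twist l m * ((ln `|g 0 0 / g 1 0|)%:C + sgn_log (g 0 0 / g 1 0))) *
   expc (twist l m * (logc (z + al%:C) - logc (z + be%:C)))) by ring.
have -> : moebius g z ^- q * jfac g z ^- k =
   ((g 0 0 * g 1 0) ^- q)%:C * ((z + al%:C) ^- q * (z + be%:C) ^- q).
  rewrite {2}k_half exprD invfM -!exprVn rmorphXn/= fmorphV rmorphM/=.
  rewrite -!exprMn; congr (_ ^+ _); rewrite mE jE rmorphM/= fmorphV.
  by field; rewrite aC cC za zb.
by rewrite /twist -/tau; ring.
Qed.

(** The diagonal matrix multiplies [a / c] by [e^(j l)], so the phase changes by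
    [tau j l = 2 pi m j]. This is what the exponent [2 pi m / l] is made for. *)
Lemma phi_diag g z (j : int) : SL2 g -> g 0 0 != 0 -> g 1 0 != 0 -> 0 < complex.Im z ->
  phi (mx2 (expR (j%:~R * l / 2)) 0 0 (expR (- (j%:~R * l / 2))) *m g) z = phi g z.
Proof.
move=> gS a0 c0 z0; set t := expR (j%:~R * l / 2); rewrite expRN -/t.
have t0 : 0 < t := expR_gt0 _; have tn := lt0r_neq0 t0.
set D := mx2 _ _ _ _; have DS : SL2 D by rewrite /SL2 /= det2 !mx2E mul0r subr0 mulfV.
have e00 : (D *m g) 0 0 = t * g 0 0 by rewrite mulmx2 !mx2E mul0r addr0.
have e01 : (D *m g) 0 1 = t * g 0 1 by rewrite mulmx2 !mx2E mul0r addr0.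
have e10 : (D *m g) 1 0 = t^-1 * g 1 0 by rewrite mulmx2 !mx2E mul0r add0r.
have e11 : (D *m g) 1 1 = t^-1 * g 1 1 by rewrite mulmx2 !mx2E mul0r add0r.
rewrite !phi_psi ?e00 ?e10 ?mulf_neq0 ?invr_eq0//; last exact: SL2M.
rewrite e01 e11 -!mulf_div !divff ?invr_eq0// !mul1r; congr (_ * _).
rewrite /phi_cst e00 e10; have -> : t * g 0 0 * (t^-1 * g 1 0) = g 0 0 * g 1 0 by field; rewrite tn.
have -> : t * g 0 0 / (t^-1 * g 1 0) = t ^+ 2 * (g 0 0 / g 1 0) by field; rewrite c0 tn.
congr (_ * _); have ac0 : g 0 0 / g 1 0 != 0 by rewrite mulf_neq0// invr_eq0.
have -> : sgn_log (t ^+ 2 * (g 0 0 / g 1 0)) = sgn_log (g 0 0 / g 1 0).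
  by rewrite /sgn_log pmulr_rgt0// exprn_gt0.
rewrite normrM lnM ?posrE ?normr_gt0 ?expf_neq0// gtr0_norm ?exprn_gt0//.
have -> : ln (t ^+ 2) = j%:~R * l.
  by rewrite -expRM_natr expRK divfK ?pnatr_eq0.
rewrite rmorphD/= -addrA mulrDr expcD.
have -> : (0 +i* tau) * (j%:~R * l)%:C = (0 +i* (2 * pi)) * (m * j)%:~R.
  rewrite -(rmorph_int (real_complex R)); apply: complexP => /=; first by ring.
  by rewrite /tau intrM; field; rewrite gt_eqF.
by have := e_int (m * j) : e_ _ = 1 :> R[i]; rewrite /e_ => ->; rewrite mul1r.
Qed.

Lemma phi_translate g z x : SL2 g -> 0 < complex.Im z ->
  phi (g *m mx2 1 x 0 1) z = phi g (z + x%:C).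
Proof.
move=> gS z0; have TS : SL2 (mx2 1 x 0 1) by rewrite /SL2 /= det2 !mx2E mulr0 subr0 mulr1.
have jT : jfac (mx2 1 x 0 1) z = 1 by rewrite /jfac !mx2E rmorph0 mul0r add0r.
rewrite -phi_slash// jT expr1n invr1 mul1r; congr phi.
by rewrite /moebius jT !mx2E rmorph1 mul1r divr1.
Qed.

End Summand.

(** * Discrete groups *)

Section Discreteness.
Context {R : realType}.
Implicit Types (g h s : 'M[R]_2) (G : set 'M[R]_2).

Lemma isolated_one G : G 1%:M -> G `<=` isolated G -> exists2 e : R, 0 < e &
  forall g, G g -> (forall i j, `|g i j - (1%:M : 'M[R]_2) i j| < e) -> g = 1%:M.
Proof.
move=> G1 /(_ _ G1)[_ [V nV VG]].
have /nbhs_ballP[e e0 he] := nV; exists e => // g Gg gl.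
suff : (V `&` G) g by rewrite VG.
split=> //; apply: he; split=> // i j; rewrite -ball_normE /= distrC; exact: gl.
Qed.

Lemma normr_mulmx2 g h (A B : R) : 0 <= A -> (forall i j, `|g i j| <= A) ->
  (forall i j, `|h i j| <= B) -> forall i j, `|(g *m h) i j| <= 2 * (A * B).
Proof.
move=> A0 gA hB i j; rewrite mulmx2 (le_trans (ler_normD _ _))// !normrM mulrDl mul1r.
by rewrite lerD// ler_pM.
Qed.

Lemma normr_mx2_le g : exists2 A : R, 0 <= A & forall i j, `|g i j| <= A.
Proof.
exists (`|g 0 0| + `|g 0 1| + `|g 1 0| + `|g 1 1|); first by rewrite !addr_ge0.
have := normr_ge0 (g 0 0); have := normr_ge0 (g 0 1).
have := normr_ge0 (g 1 0); have := normr_ge0 (g 1 1) => h1 h2 h3 h4 i j.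
by case: (ord2P i) => ->; case: (ord2P j) => ->; lra.
Qed.

Lemma normr_invmx2 g (A : R) : SL2 g -> (forall i j, `|g i j| <= A) ->
  forall i j, `|invmx g i j| <= A.
Proof.
move=> gS gA i j; rewrite invmx2//.
by case: (ord2P i) => ->; case: (ord2P j) => ->; rewrite mx2E ?normrN.
Qed.

Lemma floor_near (x y : R) : Num.floor x = Num.floor y -> `|x - y| < 1.
Proof.
move=> xy; have /andP[x1 x2] := floor_itv x; have /andP[y1 y2] := floor_itv y.
move: x1 x2 y1 y2; rewrite xy intrD; set n := _%:~R => *.
by rewrite ltr_norml; apply/andP; split; lra.
Qed.

Lemma discrete_count G (B : R) : subgroup_SL2 G -> G `<=` isolated G -> 0 <= B ->
  exists m : nat, forall K : {fset 'M[R]_2},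
    (forall g, g \in K -> G g /\ forall i j, `|g i j| <= B) -> (#|` K | <= m)%N.
Proof.
move=> [GS G1 GM GV] Giso B0; have [e e0 he] := isolated_one G1 Giso.
have B1 : 0 < 2 * B + 1 by lra.
(* Two elements of [G] in the same box of side [d] satisfy [|g^-1 h - 1| <= 2 B d < e] entrywise,
   hence coincide; the boxes are counted by [T]. *)
pose d := e / (2 * B + 1); have d0 : 0 < d by rewrite divr_gt0.
pose N := Num.bound (B / d); pose T := {ffun 'I_2 * 'I_2 -> 'I_(N.*2).+1}.
pose f g : T := [ffun p => inord (absz (Num.floor (g p.1 p.2 / d) + N%:Z)%R)].
exists #|T| => K hK.
have rng g p : g \in K -> (- N%:Z <= Num.floor (g p.1 p.2 / d) < N%:Z)%R.
  move=> /hK[_ /(_ p.1 p.2)]; rewrite ler_norml => /andP[g1 g2].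
  have BN : B / d < N%:R by apply: archi_boundP; rewrite divr_ge0// ltW.
  rewrite floor_ge_int floor_lt_int intrN -!pmulrn; apply/andP; split.
    rewrite lerNl -mulNr (le_trans _ (ltW BN))// ler_wpM2r ?invr_ge0 ?(ltW d0)//; lra.
  by rewrite (le_lt_trans _ BN)// ler_wpM2r ?invr_ge0 ?(ltW d0).
have f_inj : {in K &, injective f}.
  move=> g h gK hK' fgh; have [Gg gB] := hK _ gK; have [Gh hB] := hK _ hK'.
  have gh i j : `|(h - g) i j| <= d.
    have := congr1 (fun F : T => val (F (i, j))) fgh; rewrite !ffunE /=.
    have := rng _ (i, j) gK; have := rng _ (i, j) hK'; rewrite /=.
    set u := Num.floor _; set v := Num.floor _ => hu hv.
    rewrite !inordK; [|lia|lia] => uv; have /floor_near : v = u by lia.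
    rewrite -mulrBl normrM normfV (gtr0_norm d0) ltr_pdivrMr// mul1r => /ltW.
    by rewrite !mxE distrC.
  have gS : SL2 g by exact: GS.
  have ug := SL2_unit gS.
  have : invmx g *m h = 1%:M.
    apply: he; first by apply: GM => //; exact: GV.
    move=> i j; have -> : (invmx g *m h) i j - (1%:M : 'M[R]_2) i j = (invmx g *m (h - g)) i j.
      by rewrite mulmxBr mulVmx// !mxE.
    apply: le_lt_trans (normr_mulmx2 B0 (normr_invmx2 gS gB) gh i j) _.
    by rewrite /d mulrA mulrA ltr_pdivrMr// mulrC ltr_pM2l//; lra.
  by move=> e1; rewrite -[h](mulKVmx ug) e1 mulmx1.
have u : uniq (map f K) by rewrite map_inj_in_uniq ?fset_uniq.
by rewrite -(size_map f) -(card_uniqP u) max_card.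
Qed.

Lemma conj_count G s (B : R) : subgroup_SL2 G -> G `<=` isolated G -> SL2 s -> 0 <= B ->
  exists m : nat, forall K : {fset 'M[R]_2},
    (forall h, h \in K -> G (s *m h *m invmx s) /\ forall i j, `|h i j| <= B) -> (#|` K | <= m)%N.
Proof.
move=> Gg Giso sS B0; have [A A0 sA] := normr_mx2_le s.
have us := SL2_unit sS.
have AB : 0 <= 2 * (A * B) by rewrite !mulr_ge0.
have [m hm] := @discrete_count G (2 * (2 * (A * B) * A)) Gg Giso (mulr_ge0 (ler0n _ 2) (mulr_ge0 AB A0)).
exists m => K hK; have c_inj : injective (fun h => s *m h *m invmx s).
  by move=> h h' /(can_inj (mulmxKV us)) /(can_inj (mulKmx us)).
have <- : #|` [fset s *m h *m invmx s | h in K]%fset | = #|` K | by rewrite card_imfset.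
apply: hm => _ /imfsetP[h /= /hK[Gh hB] ->]; split => // i j.
by apply: normr_mulmx2 => //; [exact: normr_mulmx2|exact: normr_invmx2].
Qed.

Definition unip (x : R) : 'M[R]_2 := mx2 1 x 0 1.

Lemma unip_conj d x : SL2 d -> d 1 0 = 0 ->
  d *m unip x *m invmx d = unip (x * d 0 0 ^+ 2).
Proof.
move=> dS d10; have := SL2E dS; rewrite d10 mulr0 subr0 => dE.
rewrite invmx2//; apply: mx2P; rewrite !mulmx2 !mx2E ?d10.
- by rewrite -[RHS]dE; ring.
- by ring.
- by ring.
- by rewrite -[RHS]dE; ring.
Qed.

(* Conjugating a translation repeatedly by a contracting upper triangular
   matrix produces translations that accumulate at the identity. *)
Lemma parabolic_not_hyperbolic G s d x : subgroup_SL2 G -> G `<=` isolated G -> SL2 s ->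
  SL2 d -> G (s *m d *m invmx s) -> d 1 0 = 0 -> 0 < d 0 0 ^+ 2 < 1 ->
  x != 0 -> ~ G (s *m unip x *m invmx s).
Proof.
move=> Gg Giso sS dS Gd d10 /andP[r0 r1] x0 Gx; set r := d 0 0 ^+ 2 in r0 r1.
have us := SL2_unit sS; have [GS G1 GM GV] := Gg.
have Gj (j : nat) : G (s *m unip (x * r ^+ j) *m invmx s).
  elim: j => [|j IH]; first by rewrite expr0 mulr1.
  rewrite exprSr mulrA -(unip_conj _ dS d10).
  have := GM _ _ (GM _ _ Gd IH) (GV _ Gd).
  rewrite (invmxM2 (SL2M sS dS) (SL2V sS)) (invmxM2 sS dS) invmxK.
  by rewrite !mulmxA !mulmxKV// -!mulmxA mulKmx.
have [m hm] := @conj_count G s (1 + `|x|) Gg Giso sS (addr_ge0 ler01 (normr_ge0 x)).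
have r_inj (j j' : nat) : unip (x * r ^+ j) = unip (x * r ^+ j') -> j = j'.
  move=> /matrixP/(_ 0 1); rewrite !mx2E => /(mulfI x0).
  by case: (ltngtP j j') => // jj e; [have := ltr_iXn2l r0 r1 j' j|have := ltr_iXn2l r0 r1 j j'];
    rewrite e jj ltxx.
pose K := [fset unip (x * r ^+ (val j)) | j in 'I_m.+1]%fset.
have : (#|` K | <= m)%N.
  apply: hm => _ /imfsetP[j _ ->]; split; first exact: Gj.
  move=> i i'.
  have xr : `|x * r ^+ val j| <= `|x|.
    have rj0 : 0 <= r ^+ val j by apply: exprn_ge0; exact: ltW.
    by rewrite normrM ler_piMr// (ger0_norm rj0); exact: exprn_ile1 (ltW r0) (ltW r1).
  have := normr_ge0 x => xn.
  by case: (ord2P i) => ->; case: (ord2P i') => ->; rewrite mx2E ?normr1 ?normr0; lra.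
rewrite card_imfset/=; last by move=> j j' /r_inj /val_inj.
by rewrite -cardE card_ord ltnn.
Qed.

Lemma dyadic (x : R) : 1 <= x -> exists P : nat, 2 ^+ P <= x < 2 ^+ P.+1.
Proof.
move=> x1; have ex : exists n : nat, x < 2 ^+ n.
  exists (Num.bound x); have x0 : 0 <= x by lra.
  apply: lt_le_trans (archi_boundP x0) _.
  by rewrite -natrX ler_nat ltnW// ltn_expl.
case: (ex_minnP ex) => [[|P]] xP minP; first by move: xP; rewrite expr0; lra.
by exists P; rewrite xP andbT leNgt; apply/negP => /minP; rewrite ltnn.
Qed.

Definition row_sqr g (i : 'I_2) : R := g i 0 ^+ 2 + g i 1 ^+ 2.

Lemma row_sqr_gt0 g i : SL2 g -> 0 < row_sqr g i.
Proof.
move=> /SL2E dE; rewrite lt_neqAle addr_ge0 ?sqr_ge0// andbT eq_sym.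
rewrite paddr_eq0 ?sqr_ge0// !sqrf_eq0; apply/negP => /andP[/eqP e1 /eqP e2].
by move/eqP: dE; case: (ord2P i) e1 e2 => -> -> ->; rewrite ?(mul0r, mulr0) subrr eq_sym oner_eq0.
Qed.

Definition rows_dot g : R := g 0 0 * g 1 0 + g 0 1 * g 1 1.

Lemma row_sqrM g : SL2 g -> row_sqr g 0 * row_sqr g 1 = 1 + rows_dot g ^+ 2.
Proof.
move=> /SL2E dE; rewrite -[1 in RHS](expr1n _ 2) -{1}dE /row_sqr /rows_dot; ring.
Qed.

(* In terms of the points [g i], [g' i] of the upper half plane this expresses
   the Frobenius norm of [g^-1 g'] by their hyperbolic distance: [g i] has real
   part [rows_dot g / row_sqr g 1] and imaginary part [(row_sqr g 1)^-1]. *)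
Lemma frobenius_quotient g g' : SL2 g -> SL2 g' ->
  let N := row_sqr g 1 in let N' := row_sqr g' 1 in
  row_sqr (invmx g *m g') 0 + row_sqr (invmx g *m g') 1 =
  N * N' * (rows_dot g / N - rows_dot g' / N') ^+ 2 + N / N' + N' / N.
Proof.
move=> gS gS'; set N := row_sqr g 1; set N' := row_sqr g' 1.
have N0 : 0 < N by exact: row_sqr_gt0.
have N'0 : 0 < N' by exact: row_sqr_gt0.
have -> : row_sqr (invmx g *m g') 0 + row_sqr (invmx g *m g') 1 =
  N * row_sqr g' 0 + row_sqr g 0 * N' - 2 * (rows_dot g * rows_dot g').
  by rewrite invmx2// /N /N' /row_sqr /rows_dot !mulmx2 !mx2E; ring.
have -> : row_sqr g' 0 = (1 + rows_dot g' ^+ 2) / N' by rewrite -row_sqrM// mulfK ?gt_eqF.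
have -> : row_sqr g 0 = (1 + rows_dot g ^+ 2) / N by rewrite -row_sqrM// mulfK ?gt_eqF.
by field; rewrite !gt_eqF.
Qed.

(** The quotient of the two row lengths is the squared modulus of the image [w] of the imaginary
    unit, so the last hypothesis puts all these points in the half annulus [1 <= |w| <= E]. Their
    imaginary part is the inverse of [row_sqr (g i) 1], and each term of the sum is at most its
    square. *)
Lemma orbit_count G s (I : choiceType) (S : set I) (g : I -> 'M[R]_2) (E : R) :
  subgroup_SL2 G -> G `<=` isolated G -> SL2 s -> 1 <= E ->
  (forall i, S i -> SL2 (g i)) ->
  (forall i i', S i -> S i' -> G (s *m (invmx (g i) *m g i') *m invmx s)) ->
  (forall i i', S i -> S i' -> g i = g i' -> i = i') ->
  (forall i, S i -> row_sqr (g i) 1 <= row_sqr (g i) 0 <= E ^+ 2 * row_sqr (g i) 1) ->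
  exists M, bounded_sums (fun i => if i \in S then (row_sqr (g i) 0 * row_sqr (g i) 1)^-1 else 0) M.
Proof.
move=> Gg Giso sS E1 gS gG g_inj gE; have E0 : 0 < E by lra.
(* For two points of one cell the squared Frobenius norm of the quotient is at most
   [4 + 2 + 2 <= 3^2], so all its entries are at most 3. *)
have [m hm] := @conj_count G s 3 Gg Giso sS (ler0n _ 3).
pose N i := row_sqr (g i) 1; pose sg i := rows_dot (g i).
have N0 i : S i -> 0 < N i by move=> /gS; exact: row_sqr_gt0.
have MN i : S i -> row_sqr (g i) 0 * N i = 1 + sg i ^+ 2 by move=> /gS/row_sqrM.
have EN i : S i -> 1 + sg i ^+ 2 <= (E * N i) ^+ 2.
  move=> Si; rewrite -MN// exprMn [N i ^+ 2]expr2 mulrA ler_wpM2r ?(ltW (N0 _ Si))//.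
  by have /andP[] := gE _ Si.
have EN1 i : S i -> 1 <= N i * E.
  move=> Si; rewrite mulrC -[leLHS]ger0_norm// -[leRHS]ger0_norm ?mulr_ge0 ?(ltW E0) ?(ltW (N0 _ Si))//.
  by rewrite -ler_sqr ?nnegrE// !real_normK ?num_real// expr1n (le_trans _ (EN _ Si))// lerDl sqr_ge0.
have Pex i : exists P : nat, S i -> 2 ^+ P <= N i * E < 2 ^+ P.+1.
  have [Si|nS] := pselect (S i); last by exists 0%N.
  by have [P hP] := dyadic (EN1 _ Si); exists P.
have [P hP] := choice Pex.
pose Q i := Num.floor (2 ^+ P i * (sg i / N i)).
pose L := (Num.bound E).+2.
have LE : E + 1 < L%:R.
  have -> : L%:R = (Num.bound E)%:R + 2 :> R by rewrite /L -(addn2 (Num.bound E)) natrD.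
  by have := archi_boundP (ltW E0); lra.
(* This encodes the cell [(P, Q)] in one integer. As [|Q| < L 2^P] (the margin in [L > E + 1]
   absorbs the floor), it lies strictly between [2 L 2^P] and [4 L 2^P]; these ranges are disjoint
   for different [P], so [p] determines the cell, and [p i <= 4 L E N i]. *)
pose p i : int := Q i + (3 * L * 2 ^ P i)%N%:Z.
have P2 i : 1 <= 2 ^+ P i :> R by rewrite exprn_ege1// ler1n.
have sN i : S i -> `|sg i / N i| <= E.
  move=> Si; have n0 := N0 _ Si; rewrite normrM normfV (gtr0_norm n0) ler_pdivrMr//.
  rewrite -[leRHS]ger0_norm ?mulr_ge0 ?(ltW E0) ?(ltW n0)//.
  rewrite -ler_sqr ?nnegrE// !real_normK ?num_real//.
  by rewrite (le_trans _ (EN _ Si))// lerDr.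
have Qb i : S i -> (- (L * 2 ^ P i)%N%:Z < Q i < (L * 2 ^ P i)%N%:Z)%R.
  move=> Si; have := sN _ Si; rewrite ler_norml => /andP[s1 s2].
  have b1 : 2 ^+ P i * (sg i / N i) <= 2 ^+ P i * E by rewrite ler_wpM2l//; have := P2 i; lra.
  have b2 : - (2 ^+ P i * E) <= 2 ^+ P i * (sg i / N i).
    by rewrite -mulrN ler_wpM2l//; have := P2 i; lra.
  have b3 : 2 ^+ P i * E + 1 < (L * 2 ^ P i)%N%:R :> R.
    rewrite natrM natrX mulrC.
    have p2 := P2 i.
    have : (E + 1) * 2 ^+ P i < L%:R * 2 ^+ P i by rewrite ltr_pM2r//; lra.
    lra.
  have /andP[f1 f2] := floor_itv (2 ^+ P i * (sg i / N i)).
  rewrite -!(ltr_int R) intrN -!pmulrn; move: f1 f2; rewrite -/(Q i) intrD => f1 f2.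
  by apply/andP; split; lra.
have fib : forall K : {fset I}, (forall i, i \in K -> S i) ->
    (forall i i', i \in K -> i' \in K -> p i = p i') -> (#|` K | <= m)%N.
  move=> K KS Kp; have [->|/fset0Pn[i0 iK]] := eqVneq K fset0; first by rewrite cardfs0.
  have c_inj : {in K &, injective (fun i => invmx (g i0) *m g i)}.
    move=> i i' iK' iK'' /(can_inj (mulKVmx (SL2_unit (gS _ (KS _ iK))))).
    by apply: g_inj; exact: KS.
  have <- : #|` [fset invmx (g i0) *m g i | i in K]%fset | = #|` K | by rewrite card_in_imfset.
  apply: hm => _ /imfsetP[i /= iK' ->]; split; first by apply: gG; exact: KS.
  have Si := KS _ iK'; have Si0 := KS _ iK.
  have Pe : P i0 = P i.
    have := Kp _ _ iK iK'; rewrite /p; have := Qb _ Si; have := Qb _ Si0.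
    have L0 : (0 < L)%N by [].
    have key a b (x y : int) : (- (L * 2 ^ a)%N%:Z < x < (L * 2 ^ a)%N%:Z)%R ->
        (- (L * 2 ^ b)%N%:Z < y < (L * 2 ^ b)%N%:Z)%R ->
        (x + (3 * L * 2 ^ a)%N%:Z = y + (3 * L * 2 ^ b)%N%:Z)%R -> (a <= b)%N.
      move=> h1 h2 h3; rewrite -ltnS -(@ltn_exp2l 2)// expnS -(ltn_pmul2l L0); lia.
    move=> h1 h2 h3; apply/eqP; rewrite eqn_leq (key _ _ _ _ h1 h2 h3).
    by rewrite (key _ _ _ _ h2 h1 (esym h3)).
  have Qe : Q i0 = Q i by have := Kp _ _ iK iK'; rewrite /p Pe; apply: addIr.
  have := frobenius_quotient (gS _ Si0) (gS _ Si); rewrite /= -/(N i) -/(N i0) -/(sg i) -/(sg i0).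
  have := floor_near Qe; rewrite Pe -mulrBr normrM ger0_norm; last by have := P2 i; lra.
  set D := sg i0 / N i0 - sg i / N i => Dl.
  have /andP[u1 u2] := hP _ Si; have := hP _ Si0; rewrite Pe => /andP[v1 v2].
  set T := 2 ^+ P i in Dl u1 u2 v1 v2; have T1 : 1 <= T by exact: P2.
  have TS : 2 ^+ (P i).+1 = 2 * T by rewrite exprS.
  rewrite TS in u2 v2.
  have n0 := N0 _ Si; have n00 := N0 _ Si0.
  have r1 : N i0 / N i <= 2.
    rewrite ler_pdivrMr// -(ler_pM2r E0); lra.
  have r2 : N i / N i0 <= 2.
    rewrite ler_pdivrMr// -(ler_pM2r E0); lra.
  have r3 : N i0 * N i * D ^+ 2 <= 4.
    have w1 : N i0 <= 2 * T by rewrite (le_trans _ (ltW v2))// ler_peMr// ltW.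
    have w2 : N i <= 2 * T by rewrite (le_trans _ (ltW u2))// ler_peMr// ltW.
    have w3 : N i0 * N i <= (2 * T) * (2 * T) by rewrite ler_pM// ltW.
    rewrite (le_trans (ler_wpM2r (sqr_ge0 D) w3))//.
    have -> : 2 * T * (2 * T) * D ^+ 2 = 4 * (T * `|D|) ^+ 2.
      by rewrite [(T * _) ^+ 2]exprMn real_normK ?num_real//; ring.
    have d1 : (T * `|D|) ^+ 2 <= 1 by rewrite exprn_ile1 ?(ltW Dl)// mulr_ge0//; lra.
    lra.
  move=> fr; have {}fr : row_sqr (invmx (g i0) *m g i) 0 + row_sqr (invmx (g i0) *m g i) 1 <= 3 ^+ 2.
    by rewrite fr; lra.
  move=> a b; rewrite -[leRHS]ger0_norm// -ler_sqr ?nnegrE// !real_normK ?num_real//.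
  apply: le_trans fr; rewrite /row_sqr.
  set h := _ *m _; have := sqr_ge0 (h 0 0); have := sqr_ge0 (h 0 1).
  have := sqr_ge0 (h 1 0); have := sqr_ge0 (h 1 1) => *.
  by case: (ord2P a) => ->; case: (ord2P b) => ->; lra.
have := bounded_sums_fiber (@int_weight_ge0 R) int_weight_bounded fib.
(* [96 = 6 * 4^2], from [n <= 4 L E N i] and [(n + 1) (n + 2) <= 6 n^2]. *)
set C := 96 * (E * L%:R) ^+ 2.
have C0 : 0 <= C by rewrite mulr_ge0 ?sqr_ge0.
move=> /(bounded_sumsZ C0) bnd; eexists; apply: bounded_sumsW bnd => i.
case: ifPn => [/set_mem Si|_]; last by rewrite mulr0.
have n0 := N0 _ Si; have /andP[M1 _] := gE _ Si.
have pb : (0 < p i < (4 * L * 2 ^ P i)%N%:Z)%R by have := Qb _ Si; rewrite /p; lia.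
rewrite /int_weight; have := pb; case: (p i) => // n /andP[p0 pn].
have nR : 1 <= n%:R :> R by rewrite ler1n.
have nL : n%:R <= 4 * L%:R * 2 ^+ P i :> R.
  by rewrite -!natrM -natrX -natrM ler_nat; lia.
rewrite absz_nat.
have -> : n.+1%:R = n%:R + 1%:R :> R by rewrite natr1.
have -> : n.+2%:R = n%:R + 2%:R :> R by rewrite -natrD addn2.
have /andP[u1 _] := hP _ Si.
have key : n%:R <= 4 * L%:R * E * N i :> R.
  rewrite (le_trans nL)// -!mulrA ler_wpM2l// ler_wpM2l// mulrC; move: u1; lra.
apply: (@le_trans _ _ (N i ^+ 2)^-1).
  by rewrite lef_pV2 ?posrE ?mulr_gt0 ?exprn_gt0 ?(lt_le_trans n0)// expr2 ler_wpM2r ?(ltW n0).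
move: nR key; set x := n%:R => x1 key.
rewrite -[leLHS]mul1r ler_pdivrMr ?exprn_gt0// mulrAC ler_pdivlMr ?mulr_gt0//; [|lra|lra].
rewrite mul1r; have -> : C * N i ^+ 2 = 6 * (4 * L%:R * E * N i) ^+ 2 by rewrite /C; ring.
have : x ^+ 2 <= (4 * L%:R * E * N i) ^+ 2 by rewrite ler_sqr ?nnegrE; lra.
nra.
Qed.

End Discreteness.

(** * Stabilizers of cusps and of hyperbolic pairs *)

Section Stabilizers.
Context {R : realType}.
Implicit Types (g h s : 'M[R]_2) (G A : set 'M[R]_2).

Definition sim g h := g = h \/ g = - h.

Lemma simM g g' h h' : sim g g' -> sim h h' -> sim (g *m h) (g' *m h').
Proof.
by move=> [->|->] [->|->]; rewrite /sim ?mulmxN ?mulNmx ?opprK; [left|right|right|left].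
Qed.

Lemma moebius_bdN g x : moebius_bd (- g) x = moebius_bd g x.
Proof.
case: x => [t|] /=; rewrite !mxE.
  rewrite mulNr -opprD oppr_eq0; case: ifP => // _.
  by rewrite mulNr -opprD invrN mulrNN.
by rewrite oppr_eq0; case: ifP => // _; rewrite invrN mulrNN.
Qed.

Lemma conj_mxE s g h : s \in unitmx -> invmx s *m g *m s = h -> g = s *m h *m invmx s.
Proof. by move=> us <-; rewrite !mulmxA mulmxV// mul1mx mulmxK. Qed.

(* The scaling condition describes [A], up to sign, as the conjugate by [s] of a
   one-parameter family [X] of matrices. *)
Definition scaled G A s (X : int -> 'M[R]_2) :=
  forall g, A g <-> G g /\ exists j, sim (invmx s *m g *m s) (X j).

(** For the converse inclusion: an element of [G] whose conjugate is [X j] up to sign agrees up to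
    sign with an element of [A], and [A] is stable under sign change within [G]. *)
Lemma scaledP G A s (X : int -> 'M[R]_2) : s \in unitmx -> A `<=` G ->
  (forall g, A g -> G (- g) -> A (- g)) ->
  pm (conj_set s A) = pm [set X j | j in [set: int]] ->
  scaled G A s X /\ forall j, exists2 g, A g & sim (invmx s *m g *m s) (X j).
Proof.
move=> us AG AN e.
have ex j : exists2 g, A g & sim (invmx s *m g *m s) (X j).
  have : pm (conj_set s A) (X j) by rewrite e; left; exists j.
  by move=> [[g Ag gE]|[g Ag gE]]; exists g => //; [left|right].
split=> // g; split=> [Ag|[Gg [j gj]]].
  split; first exact: AG.
  have : pm [set X j | j in [set: int]] (invmx s *m g *m s) by rewrite -e; left; exists g.
  by move=> [[j _ jE]|[j _ jE]]; exists j; [left|right; rewrite jE opprK].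
have [g' Ag' g'j] := ex j.
have : sim g g'.
  case: gj => gj; case: g'j => g'j; rewrite (conj_mxE us gj) (conj_mxE us g'j) /sim.
  - by left.
  - by right; rewrite mulmxN mulNmx opprK.
  - by right; rewrite mulmxN mulNmx.
  - by left.
by move=> [gE|gE]; rewrite gE in Gg *; rewrite ?gE//; exact: AN.
Qed.

Lemma scaled_group G A s (X : int -> 'M[R]_2) : subgroup_SL2 G -> SL2 s -> scaled G A s X ->
  (forall i j, X (i + j) = X i *m X j) -> X 0 = 1%:M ->
  [/\ A 1%:M, (forall g h, A g -> A h -> A (g *m h)) & forall g, A g -> A (invmx g)].
Proof.
move=> [GS G1 GM GV] sS AE XD X0; have us := SL2_unit sS; split.
- apply/AE; split => //; exists 0; left.
  by rewrite mulmx1 mulVmx// X0.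
- move=> g h /AE[Gg [i gi]] /AE[Gh [j hj]]; apply/AE; split; first exact: GM.
  exists (i + j); have := simM gi hj; rewrite -XD; congr sim.
  by rewrite -!mulmxA mulKVmx// !mulmxA.
- move=> g /AE[Gg [i gi]]; apply/AE; split; first exact: GV.
  exists (- i); have gS : SL2 g by exact: GS.
  have Xi : X i *m X (- i) = 1%:M by rewrite -XD subrr.
  have e1 : invmx s *m invmx g *m s *m (invmx s *m g *m s) = 1%:M.
    by rewrite -!mulmxA mulKVmx// mulKmx ?SL2_unit// mulVmx.
  case: gi => gi; rewrite gi in e1; [left|right].
    by rewrite -[LHS]mulmx1 -Xi mulmxA e1 mul1mx.
  rewrite -[LHS]mulmx1 -Xi mulmxA -[X i]opprK mulmxN e1.
  by rewrite mulNmx mul1mx.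
Qed.

Lemma lcoset_repr (H : set 'M[R]_2) g : H 1%:M ->
  exists2 h, H h & Defs.repr_of [set h *m g | h in H] = h *m g.
Proof.
move=> H1; have : [set h *m g | h in H] (Defs.repr_of [set h *m g | h in H]).
  by apply: (xgetPex 1%:M); exists g, 1%:M => //; rewrite mul1mx.
by move=> [h Hh <-]; exists h.
Qed.

Lemma lcoset_eq (H : set 'M[R]_2) h g : H `<=` SL2 ->
  (forall g h, H g -> H h -> H (g *m h)) -> (forall g, H g -> H (invmx g)) ->
  H h -> [set x *m (h *m g) | x in H] = [set x *m g | x in H].
Proof.
move=> HS HM HV Hh; apply/seteqP; split=> [_ [x Hx <-]|_ [x Hx <-]].
  by exists (x *m h); [exact: HM|rewrite mulmxA].
exists (x *m invmx h); first by apply: HM => //; exact: HV.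
by rewrite mulmxA mulmxKV// SL2_unit//; exact: HS.
Qed.

Lemma dcoset_repr (H K : set 'M[R]_2) g : H 1%:M -> K 1%:M ->
  exists h u, [/\ H h, K u & Defs.repr_of [set h *m g *m u | h in H & u in K] = h *m g *m u].
Proof.
move=> H1 K1; have : [set h *m g *m u | h in H & u in K]
    (Defs.repr_of [set h *m g *m u | h in H & u in K]).
  apply: (xgetPex 1%:M); exists g, 1%:M => //; exists 1%:M => //.
  by rewrite mul1mx mulmx1.
by move=> [h Hh [u Ku <-]]; exists h, u.
Qed.

Lemma dcoset_eq (H K : set 'M[R]_2) h u g : H `<=` SL2 -> K `<=` SL2 ->
  (forall g h, H g -> H h -> H (g *m h)) -> (forall g, H g -> H (invmx g)) ->
  (forall g h, K g -> K h -> K (g *m h)) -> (forall g, K g -> K (invmx g)) ->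
  H h -> K u ->
  [set x *m (h *m g *m u) *m y | x in H & y in K] = [set x *m g *m y | x in H & y in K].
Proof.
move=> HS KS HM HV KM KV Hh Ku.
apply/seteqP; split=> [_ [x Hx [y Ky <-]]|_ [x Hx [y Ky <-]]].
  exists (x *m h); first exact: HM.
  by exists (u *m y); [exact: KM|rewrite !mulmxA].
exists (x *m invmx h); first by apply: HM => //; exact: HV.
exists (invmx u *m y); first by apply: KM => //; exact: KV.
have uh := SL2_unit (HS _ Hh); have uu := SL2_unit (KS _ Ku).
by rewrite !mulmxA mulmxKV// mulmxK.
Qed.

Lemma unipD (i j : int) : unip (R := R) (i + j)%:~R = unip i%:~R *m unip j%:~R.
Proof. by apply: mx2P; rewrite mulmx2 !mx2E ?intrD; ring. Qed.

Lemma unip0 : unip (R := R) 0 = 1%:M.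
Proof. by apply: mx2P; rewrite !mx2E !mxE. Qed.

Definition hypdiag (l : R) (j : int) : 'M[R]_2 :=
  mx2 (expR (j%:~R * l / 2)) 0 0 (expR (- (j%:~R * l / 2))).

Lemma hypdiagD l (i j : int) : hypdiag l (i + j) = hypdiag l i *m hypdiag l j.
Proof.
by apply: mx2P; rewrite mulmx2 !mx2E ?(mulr0, mul0r, addr0, add0r)// -expRD;
  congr expR; rewrite intrD; ring.
Qed.

Lemma hypdiag0 l : hypdiag l 0 = 1%:M.
Proof. by apply: mx2P; rewrite !mx2E !mxE//= !mul0r ?oppr0 expR0. Qed.

Lemma scaling_cuspP G (a : option R) s : subgroup_SL2 G -> scaling_cusp G a s ->
  let X j := unip j%:~R in scaled G (stab G a) s X /\
  forall j, exists2 g, stab G a g & sim (invmx s *m g *m s) (X j).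
Proof.
move=> Gg [sS _ e]; apply: scaledP e; first exact: SL2_unit.
  by move=> g [].
by move=> g [_ ga] GN; split=> //; rewrite moebius_bdN.
Qed.

Lemma scaling_pairP G (eta : option R * option R) s l : subgroup_SL2 G -> scaling_pair G eta s l ->
  scaled G (stab2 G eta) s (hypdiag l) /\
  forall j, exists2 g, stab2 G eta g & sim (invmx s *m g *m s) (hypdiag l j).
Proof.
move=> Gg [sS _ _ e]; apply: scaledP e; first exact: SL2_unit.
  by move=> g [[]].
by move=> g [[_ g1] [_ g2]] GN; split; split=> //; rewrite moebius_bdN.
Qed.

(** Squaring removes the sign ambiguity, so a conjugate of [X *m X] itself lies in [G], whether or
    not [-1] does. *)
Lemma sim_sqr G s g X : subgroup_SL2 G -> SL2 s -> G g -> sim (invmx s *m g *m s) X ->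
  G (s *m (X *m X) *m invmx s).
Proof.
move=> [_ _ GM _] /SL2_unit us Gg gX.
suff -> : s *m (X *m X) *m invmx s = g *m g by exact: GM.
case: gX => e; rewrite (conj_mxE us e) ?(mulmxN, mulNmx) ?opprK;
  by rewrite !mulmxA mulmxKV.
Qed.

Lemma hypdiag_conj_anti l j h : SL2 h -> h 0 0 = 0 ->
  (invmx h *m hypdiag l j *m h) 1 0 = 0 /\
  (invmx h *m hypdiag l j *m h) 0 0 = expR (- (j%:~R * l / 2)).
Proof.
move=> hS h0; have := SL2E hS; rewrite h0 mul0r sub0r => dE.
by rewrite invmx2// !mulmx2 !mx2E h0; split; [ring|rewrite -[RHS]mulr1 -dE; ring].
Qed.

Lemma hypdiag_conj_upper l j h : SL2 h -> h 1 0 = 0 ->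
  (invmx h *m hypdiag l j *m h) 1 0 = 0 /\
  (invmx h *m hypdiag l j *m h) 0 0 = expR (j%:~R * l / 2).
Proof.
move=> hS h0; have := SL2E hS; rewrite h0 mulr0 subr0 => dE.
by rewrite invmx2// !mulmx2 !mx2E h0; split; [ring|rewrite -[RHS]mulr1 -dE; ring].
Qed.

(* A zero entry would make the cusp a fixed point of the hyperbolic elements
   that fix [eta]. *)
Lemma cusp_entries_neq0 G (a : option R) (eta : option R * option R) sa se l g :
  subgroup_SL2 G -> G `<=` isolated G -> scaling_cusp G a sa -> 0 < l ->
  scaling_pair G eta se l -> G g ->
  (invmx se *m g *m sa) 0 0 != 0 /\ (invmx se *m g *m sa) 1 0 != 0.
Proof.
move=> Gg Giso sac l0 sep Gg'; have [GS G1 GM GV] := Gg.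
have saS : SL2 sa by case: sac.
have seS : SL2 se by case: sep.
have usa := SL2_unit saS; have use := SL2_unit seS.
have [_ exK] := scaling_cuspP Gg sac; have [_ exH] := scaling_pairP Gg sep.
have G2 : G (sa *m unip (1 + 1)%:~R *m invmx sa).
  by rewrite unipD; have [u [Gu _] uE] := exK 1; exact: sim_sqr uE.
have gS : SL2 g by exact: GS.
set h := invmx se *m g *m sa; have hS : SL2 h by do 2!apply: SL2M => //; exact: SL2V.
have uh := SL2_unit hS.
have Gd j : G (sa *m (invmx h *m hypdiag l (j + j) *m h) *m invmx sa).
  have [u [[Gu _] _] uE] := exH j; have := sim_sqr Gg seS Gu uE; rewrite -hypdiagD => Gse.
  have := GM _ _ (GM _ _ (GV _ Gg') Gse) Gg'.
  congr G; rewrite /h !invmxM2 ?invmxK//; [|exact: SL2V|exact: SL2M (SL2V seS) gS].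
  by rewrite !mulmxA mulmxV// mul1mx mulmxK.
have dS j : SL2 (invmx h *m hypdiag l (j + j) *m h).
  apply: SL2M => //; apply: SL2M; first exact: SL2V.
  by rewrite /SL2 /= det2 !mx2E mul0r subr0 -expRD subrr expR0.
have x0 : (1 + 1)%:~R != 0 :> R by rewrite intr_eq0.
have e1 : 0 < expR (- l) ^+ 2 < 1.
  by rewrite exprn_gt0 ?expR_gt0//= exprn_ilt1// ?expR_ge0// expR_lt1 oppr_lt0.
split; apply/eqP => h0.
- have [d10 d00] := hypdiag_conj_anti l (1 + 1) hS h0.
  have j2 : (1 + 1)%:~R * l / 2 = l by rewrite intrD; field.
  rewrite j2 in d00; rewrite -d00 in e1.
  exact: (parabolic_not_hyperbolic Gg Giso saS (dS 1) (Gd 1) d10 e1 x0 G2).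
- have [d10 d00] := hypdiag_conj_upper l (-1 + -1) hS h0.
  have j2 : (-1 + -1)%:~R * l / 2 = - l by rewrite intrD; field.
  rewrite j2 in d00; rewrite -d00 in e1.
  exact: (parabolic_not_hyperbolic Gg Giso saS (dS (-1)) (Gd (-1)) d10 e1 x0 G2).
Qed.

End Stabilizers.

(** * Size of the summand, and normalization by the hyperbolic stabilizer *)

Section SummandBound.
Context {R : realType}.
Variables (k : nat) (l : R) (m : int).
Hypotheses (k_even : ~~ odd k) (k_ge4 : (4 <= k)%N) (l_gt0 : 0 < l).
Implicit Types (g : 'M[R]_2).

Let tau : R := 2 * pi * m%:~R / l.

Lemma row_sqrN g i : row_sqr (- g) i = row_sqr g i.
Proof. by rewrite /row_sqr !mxE !sqrrN. Qed.

(** With [P = |a c| |i + b/a| |i + d/c|] the summand is at most [P^(- q)] times two factors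
    [e^(|tau| pi)], one from the branch constant and one from the arguments. Since [P^2] is the
    product of the row lengths, equal to [1 + rows_dot g ^ 2 >= 1], and [q >= 2], the power
    [P^(- q)] is at most [P^(- 2)]. *)
Lemma normc_phi_i g : SL2 g -> g 0 0 != 0 -> g 1 0 != 0 ->
  normc (phi k l m g 'i) <= expR (`|tau| * pi) ^+ 2 * (row_sqr g 0 * row_sqr g 1)^-1.
Proof.
move=> gS a0 c0; have i0 : 0 < complex.Im ('i : R[i]) by rewrite /= ltr01.
rewrite phi_psi// -/tau normcM; set al := _ / g 0 0; set be := _ / g 1 0.
set T := expR (`|tau| * pi); set q := k./2.
have T0 : 0 < T := expR_gt0 _.
have h1 : normc (phi_cst k l m g) <= `|g 0 0 * g 1 0| ^- q * T.
  rewrite /phi_cst normcM normcR normrV ?unitfE ?expf_neq0 ?mulf_neq0// normrX ler_wpM2l//.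
  rewrite normc_expc ler_expR Re_mul Im_add /= mul0r sub0r add0r.
  rewrite (le_trans (ler_norm _))// normrN normrM ler_wpM2l// /sgn_log.
  by case: ifP => _ /=; rewrite ?normr0 ?pi_ge0// ger0_norm ?pi_ge0.
have h2 := normc_psi_le q tau al be i0; rewrite -/T in h2.
have za (x : R) : 0 < normc ('i + x%:C) by rewrite normc_gt0 upper_addR_neq0.
set X := normc ('i + al%:C) in h2; set Y := normc ('i + be%:C) in h2.
have rowE (u v : R) : u != 0 -> u ^+ 2 + v ^+ 2 = (`|u| * normc ('i + (v / u)%:C)) ^+ 2.
  move=> u0; rewrite exprMn normc_sqr real_normK ?num_real//= add0r addr0.
  by rewrite expr1n; field.
have ME : row_sqr g 0 = (`|g 0 0| * X) ^+ 2 by rewrite /row_sqr rowE.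
have NE : row_sqr g 1 = (`|g 1 0| * Y) ^+ 2 by rewrite /row_sqr rowE.
set P := `|g 0 0 * g 1 0| * (X * Y).
have P0 : 0 < P by rewrite !mulr_gt0 ?normr_gt0 ?mulf_neq0 ?za.
have PE : row_sqr g 0 * row_sqr g 1 = P ^+ 2.
  by rewrite ME NE -exprMn /P normrM; congr (_ ^+ 2); ring.
have P1 : 1 <= P.
  rewrite -(ler_sqr (x := 1)) ?nnegrE ?(ltW P0)// expr1n -PE row_sqrM// lerDl.
  exact: sqr_ge0.
rewrite PE (le_trans (ler_pM (normc_ge0 _) (normc_ge0 _) h1 h2))//.
have -> : `|g 0 0 * g 1 0| ^- q * T * (T * (X * Y) ^- q) = T ^+ 2 * P ^- q.
  by rewrite /P [(_ * (X * Y)) ^+ q]exprMn invfM; ring.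
rewrite ler_wpM2l ?exprn_ge0 ?(ltW T0)// lef_pV2 ?posrE ?exprn_gt0//.
by rewrite ler_weXn2l//; exact: (half_leq k_ge4).
Qed.

Lemma hypdiag_normalize g : SL2 g -> exists j : int, let g' := hypdiag l j *m g in
  row_sqr g' 1 <= row_sqr g' 0 <= expR l ^+ 2 * row_sqr g' 1.
Proof.
move=> gS; have M0 := row_sqr_gt0 0 gS; have N0 := row_sqr_gt0 1 gS.
set M := row_sqr g 0 in M0; set N := row_sqr g 1 in N0.
(* [hypdiag l j] multiplies the quotient [M / N] by [e^(2 l j)]; the first integer [j] beyond [x]
   brings it into [[1, e^(2 l)]]. *)
pose x := ln (N / M) / (2 * l); exists (Num.floor x + 1); set j := Num.floor x + 1.
have /andP[x1 x2] := floor_itv x; rewrite -/j in x2.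
have l2 : 0 < 2 * l by rewrite mulr_gt0.
have jE : j%:~R = (Num.floor x)%:~R + 1 :> R by rewrite /j intrD.
have NM : 0 < N / M by rewrite divr_gt0.
have NMe : expR (ln (N / M)) = N / M by rewrite lnK.
have u1 : N / M <= expR (j%:~R * (2 * l)).
  by rewrite -[leLHS]NMe ler_expR -ler_pdivrMr// ltW.
have u2 : expR (j%:~R * (2 * l)) <= expR (2 * l) * (N / M).
  rewrite -[N / M]NMe -expRD ler_expR jE.
  have : (Num.floor x)%:~R * (2 * l) <= ln (N / M) by rewrite -ler_pdivlMr.
  lra.
set t := expR (j%:~R * l / 2); have t0 : 0 < t := expR_gt0 _.
have tE : expR (j%:~R * (2 * l)) = t ^+ 4.
  by rewrite /t -expRM_natl; congr expR; field.
have lE : expR (2 * l) = expR l ^+ 2 by rewrite expRM_natl.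
have r0 : row_sqr (hypdiag l j *m g) 0 = t ^+ 2 * M.
  by rewrite /M /row_sqr !mulmx2 !mx2E -/t; ring.
have r1 : row_sqr (hypdiag l j *m g) 1 = t ^- 2 * N.
  by rewrite /N /row_sqr !mulmx2 !mx2E expRN -/t; field; rewrite gt_eqF.
have t2 : 0 < t ^+ 2 by rewrite exprn_gt0.
rewrite tE in u1 u2; rewrite lE in u2; cbv zeta; rewrite r0 r1; apply/andP; split.
  rewrite mulrC ler_pdivrMr// mulrAC -exprD.
  by move: u1; rewrite ler_pdivrMr.
rewrite -(ler_pM2r t2) [leLHS]mulrAC -exprD.
have -> : expR l ^+ 2 * (t ^- 2 * N) * t ^+ 2 = expR l ^+ 2 * N by field; rewrite gt_eqF.
by move: u2; rewrite mulrA ler_pdivlMr.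
Qed.

End SummandBound.

(** * Change of index in unordered sums *)

Section SumTransport.
Context {R : realType}.

Lemma sums_single (I : choiceType) (i0 : I) (c : R[i]) :
  sums (fun i => if i == i0 then c else 0) c.
Proof.
have := @sums_ord R I 1 (fun=> i0) (fun i => if i == i0 then c else 0).
rewrite big_ord1 eqxx; apply => [i j _|i ni]; first by rewrite !ord1.
by case: eqP => // /(ni ord0).
Qed.

(** [p] has to be injective only on the support of [f], and [g] vanishes at the indices that this
    support does not reach. This lets a family be extended by 0 to a whole type before it is
    reindexed. *)
Lemma sums_reindex (I J : choiceType) (p : I -> J) (f : I -> R[i]) (g : J -> R[i]) s :
  (forall j, (exists i0, [/\ p i0 = j, g j = f i0 &
      forall i, p i = j -> f i != 0 -> i = i0]) \/
    (g j = 0 /\ forall i, p i = j -> f i = 0)) ->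
  sums f s -> sums g s.
Proof.
move=> h; apply: (@sums_partition _ _ _ p) => j.
have [[i0 [pi ge fi]]|[ge fi]] := h j.
  have := sums_single i0 (f i0); rewrite ge; congr sums; apply/funext => i.
  have [->|ii] := eqVneq i i0; first by rewrite pi eqxx.
  case: eqP => // pij; apply/esym/eqP; apply: contraT => f0.
  by move/eqP: ii => []; exact: fi.
rewrite ge; have := @sums_cst0 R I; congr sums; apply/funext => i.
by case: eqP => // /fi ->.
Qed.

End SumTransport.

(** * The integrand of [I_par] in terms of [psi] *)

Section Parabolic.
Context {R : realType}.
Variables (k : nat) (l : R) (m : int).
Hypotheses (k_even : ~~ odd k) (l_gt0 : 0 < l).
Let tau : R := 2 * pi * m%:~R / l.
Local Notation psi := (psi k./2 tau).

Definition par_kernel (y : R) (n : int) (r x : R) : R[i] :=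
  expc ((0 +i* tau) * sgn_log r) * psi (- r) r (hline y x) * e_ (- (n%:~R * hline y x)).

Lemma sgn_log_sg (r : R) : sgn_log (Num.sg r) = sgn_log r.
Proof. by rewrite /sgn_log sgr_gt0. Qed.

Lemma I_parE (y : R) (n : int) (r : R) : 0 < y -> r != 0 ->
  I_par k y l m n r = integralc (par_kernel y n r).
Proof.
move=> y0 r0; rewrite /I_par /hline_integral; congr integralc; apply/funext => x.
rewrite -/(hline y x) /par_kernel; set u := hline y x.
have u0 : 0 < complex.Im u by [].
have uE : u - r%:C = u + (- r)%:C by rewrite rmorphN.
have um : 0 < complex.Im (u - r%:C) by rewrite uE Im_addR.
have up : 0 < complex.Im (u + r%:C) by rewrite Im_addR.
have s0 : Num.sg r != 0 by rewrite sgr_eq0.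
have im : 0 < complex.Im ((Num.sg r)%:C * ((u - r%:C) / (u + r%:C))).
  (* The determinant is [2 |r| > 0]: the factor [sgn r] keeps the base of the power in the upper
     half plane, as [logc_div] requires. *)
  pose g := mx2 (Num.sg r) (- (Num.sg r * r)) 1 r.
  have jE : jfac g u = u + r%:C by rewrite /jfac !mx2E rmorph1 mul1r.
  have -> : (Num.sg r)%:C * ((u - r%:C) / (u + r%:C)) = moebius g u.
    by rewrite /moebius jE !mx2E rmorphN rmorphM/= mulrA mulrBr.
  have j0 : jfac g u != 0 by rewrite jE upper_neq0.
  have n0 : 0 < normc (jfac g u) ^+ 2 by rewrite exprn_gt0// normc_gt0.
  rewrite -(pmulr_lgt0 _ n0) Im_moebius// mulr_gt0// det2 !mx2E mulr1 opprK.
  have : 0 < Num.sg r * r by rewrite -normrEsg normr_gt0.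
  lra.
rewrite /powc logc_div// normr_sg r0 ln1 rmorph0 add0r sgn_log_sg mulrDr expcD.
rewrite psiE// -uE /twist -/tau -[in LHS]mulrA invfM; ring.
Qed.

End Parabolic.

(** * The Poincare series at a cusp *)

Section Expansion.
Context {R : realType}.
Variables (k : nat) (G : set 'M[R]_2) (a : option R) (eta : option R * option R).
Variables (sa se : 'M[R]_2) (l : R) (m : int).
Hypotheses (k_even : ~~ odd k) (k_ge4 : (4 <= k)%N) (l_gt0 : 0 < l).
Hypotheses (Gg : subgroup_SL2 G) (Giso : G `<=` isolated G).
Hypotheses (sac : scaling_cusp G a sa) (sep : scaling_pair G eta se l).

Let tau : R := 2 * pi * m%:~R / l.
Local Notation psi := (psi k./2 tau).
Local Notation H := (stab2 G eta).
Local Notation K := (stab G a).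
Local Notation phi := (phi k l m).
Let f_type := (set 'M[R]_2 * int)%type.
Implicit Types (g h u : 'M[R]_2) (B : set 'M[R]_2) (i : f_type) (z : R[i]).

Let saS : SL2 sa. Proof. by case: sac. Qed.
Let seS : SL2 se. Proof. by case: sep. Qed.
Let GS g : G g -> SL2 g. Proof. by case: Gg => + _ _ _; exact. Qed.
Let G1 : G 1%:M. Proof. by case: Gg. Qed.
Let GM g h : G g -> G h -> G (g *m h). Proof. by case: Gg => _ _ + _; exact. Qed.
Let GV g : G g -> G (invmx g). Proof. by case: Gg => _ _ _; exact. Qed.
Let usa : sa \in unitmx. Proof. exact: SL2_unit. Qed.
Let use : se \in unitmx. Proof. exact: SL2_unit. Qed.

Let KE := (scaling_cuspP Gg sac).1.
Let Kex := (scaling_cuspP Gg sac).2.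
Let HE := (scaling_pairP Gg sep).1.
Let Hex := (scaling_pairP Gg sep).2.

Let K_group : [/\ K 1%:M, (forall g h, K g -> K h -> K (g *m h)) & forall g, K g -> K (invmx g)].
Proof. by apply: (scaled_group Gg saS KE) => [i j|]; [exact: unipD|exact: unip0]. Qed.
Let H_group : [/\ H 1%:M, (forall g h, H g -> H h -> H (g *m h)) & forall g, H g -> H (invmx g)].
Proof. by apply: (scaled_group Gg seS HE) => [i j|]; [exact: hypdiagD|exact: hypdiag0]. Qed.
Let K1 : K 1%:M. Proof. by case: K_group. Qed.
Let KM g h : K g -> K h -> K (g *m h). Proof. by case: K_group => _ + _; exact. Qed.
Let KV g : K g -> K (invmx g). Proof. by case: K_group => _ _; exact. Qed.
Let H1 : H 1%:M. Proof. by case: H_group. Qed.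
Let HM g h : H g -> H h -> H (g *m h). Proof. by case: H_group => _ + _; exact. Qed.
Let HV g : H g -> H (invmx g). Proof. by case: H_group => _ _; exact. Qed.
Let KG g : K g -> G g. Proof. by case. Qed.
Let HG g : H g -> G g. Proof. by case=> [[]]. Qed.
Let HS : H `<=` SL2. Proof. by move=> g /HG/GS. Qed.
Let KS : K `<=` SL2. Proof. by move=> g /KG/GS. Qed.

Definition mid g : 'M[R]_2 := invmx se *m g *m sa.

Lemma mid_SL2 g : G g -> SL2 (mid g).
Proof. by move=> /GS gS; apply: SL2M => //; apply: SL2M => //; exact: SL2V. Qed.

Lemma mid_neq0 g : G g -> mid g 0 0 != 0 /\ mid g 1 0 != 0.
Proof. exact: cusp_entries_neq0 Gg Giso sac l_gt0 sep. Qed.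

Lemma mid_inj g h : mid g = mid h -> g = h.
Proof.
move=> e; have /(can_inj (mulmxK usa)) : invmx se *m g *m sa = invmx se *m h *m sa by [].
by move=> /(can_inj (mulKVmx use)).
Qed.

Lemma mid_left h g : mid (h *m g) = (invmx se *m h *m se) *m mid g.
Proof. by rewrite /mid -!mulmxA mulKVmx. Qed.

Lemma mid_right g u : mid (g *m u) = mid g *m (invmx sa *m u *m sa).
Proof. by rewrite /mid -!mulmxA mulKVmx. Qed.

Lemma phi_sim g h z : sim g h -> phi g z = phi h z.
Proof. by move=> [->|->] //; rewrite phiN. Qed.

Lemma phi_H h g z : H h -> G g -> 0 < complex.Im z -> phi (mid (h *m g)) z = phi (mid g) z.
Proof.
move=> /HE[Gh [j hj]] Gg' z0; rewrite mid_left.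
have /phi_sim -> := simM hj (or_introl (erefl (mid g))).
by have [a0 c0] := mid_neq0 Gg'; rewrite phi_diag//; exact: mid_SL2.
Qed.

(** A choice is made for each translation, as it may be that only one of the two matrices over it
    lies in the stabilizer. *)
Let Kchoice := choice (fun j => let: ex_intro2 u u1 u2 := Kex j in
  ex_intro (fun u => K u /\ sim (invmx sa *m u *m sa) (unip j%:~R)) u (conj u1 u2)).
Let Kj : int -> 'M[R]_2 := projT1 Kchoice.
Let KjP j : K (Kj j) /\ sim (invmx sa *m Kj j *m sa) (unip j%:~R).
Proof. exact: projT2 Kchoice j. Qed.

Local Notation dc := (dcosets H G K).
Local Notation lc := (lcosets H G).

Lemma repr_dc B : dc B -> G (Defs.repr_of B) /\
  B = [set h *m Defs.repr_of B *m u | h in H & u in K].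
Proof.
move=> [g Gg' <-]; have [h [u [Hh Ku ->]]] := dcoset_repr g H1 K1.
by split; [apply: GM; [apply: GM => //; exact: HG|exact: KG]|rewrite dcoset_eq].
Qed.

Definition gam i : 'M[R]_2 := Defs.repr_of i.1 *m Kj i.2.

Lemma gam_G i : dc i.1 -> G (gam i).
Proof. by move=> /repr_dc[Gr _]; apply: GM => //; apply: KG; have [] := KjP i.2. Qed.

Lemma mid_gam i : sim (mid (gam i)) (mid (Defs.repr_of i.1) *m unip i.2%:~R).
Proof. by rewrite mid_right; apply: simM; [left|have [] := KjP i.2]. Qed.

(** Representatives in the same left coset lie over the same double coset, and then [w T^j'] is
    [D w T^j] up to sign, with [D] diagonal of positive entries [t] and [1 / t]. Comparing the upper
    left entry, which is not 0, excludes the minus sign and gives [t = 1]; the upper right entry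
    then gives [j = j']. *)
Lemma gam_inj i i' h : dc i.1 -> dc i'.1 -> H h -> gam i' = h *m gam i -> i = i'.
Proof.
case: i i' => [B j] [B' j'] /= dB dB' Hh e.
have [Gr BE] := repr_dc dB; have [Gr' BE'] := repr_dc dB'.
have [Kjj _] := KjP j; have [Kjj' _] := KjP j'.
have re : Defs.repr_of B' = h *m Defs.repr_of B *m (Kj j *m invmx (Kj j')).
  have uj' := SL2_unit (KS Kjj').
  by rewrite mulmxA -(mulmxA h) -/(gam (B, j)) -e /gam /= mulmxK.
have BB : B' = B.
  rewrite BE' BE {1}re dcoset_eq//; apply: KM => //; exact: KV.
move: dB' e; rewrite BB => _ e; congr (_, _); move: e.
set b := Defs.repr_of B in Gr *; have [a0 c0] := mid_neq0 Gr.
move/(congr1 mid); rewrite mid_left => e.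
have /HE[_ [n hn]] := Hh.
have m1 := mid_gam (B, j'); have m2 := simM hn (mid_gam (B, j)); rewrite -e /= in m1 m2.
have : sim (mid b *m unip j'%:~R) (hypdiag l n *m (mid b *m unip j%:~R)).
  case: m1 => m1; case: m2 => m2; rewrite m2 in m1; rewrite /sim.
  - by left.
  - by right; rewrite m1.
  - by right; rewrite m1 opprK.
  - by left; apply: oppr_inj.
set t := expR (n%:~R * l / 2); have t0 : 0 < t := expR_gt0 _.
move=> sm; move: sm a0 {c0}; move: (mid b) => w sm a0.
have [t1 sm'] : t = 1 /\ w *m unip j'%:~R = hypdiag l n *m (w *m unip j%:~R).
  have opp (M : 'M[R]_2) : (- M) 0 0 = - M 0 0 by rewrite mxE.
  have simp := (mulr0, mulr1, mul0r, addr0).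
  case: sm => sm; have := congr1 (fun M : 'M[R]_2 => M 0 0) sm; rewrite ?opp !mulmx2 !mx2E -/t !simp.
    by move=> h1; split=> //; apply: (mulIf a0); rewrite mul1r; exact: esym.
  move=> /eqP; rewrite -addr_eq0 -{1}[w 0 0]mul1r -mulrDl mulf_eq0 (negbTE a0) orbF.
  by rewrite gt_eqF// addr_gt0.
have := congr1 (fun M : 'M[R]_2 => M 0 1) sm'.
rewrite !mulmx2 !mx2E -/t t1 mul1r mul0r addr0 mulr1.
by move=> /addIr/(mulfI a0)/intr_inj.
Qed.

Lemma gam_surj g : G g -> exists i h, [/\ dc i.1, H h & g = h *m gam i].
Proof.
move=> Gg'; set B := [set h *m g *m u | h in H & u in K].
have dB : dc B by exists g.
have [h [u [Hh Ku rE]]] := dcoset_repr g H1 K1; rewrite -/B in rE.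
have uh := SL2_unit (HS Hh); have uu := SL2_unit (KS Ku).
have gE : g = invmx h *m Defs.repr_of B *m invmx u.
  by rewrite rE -!mulmxA mulKmx// mulmxV// mulmx1.
have /KE[_ [j uj]] := KV Ku; have [Kjj Kjs] := KjP j.
have : sim (invmx u) (Kj j).
  case: uj => uj; case: Kjs => Kjs; rewrite (conj_mxE usa uj) (conj_mxE usa Kjs) /sim.
  - by left.
  - by right; rewrite mulmxN mulNmx opprK.
  - by right; rewrite mulmxN mulNmx.
  - by left.
move=> [e|e].
  exists (B, j), (invmx h); split => //; first exact: HV.
  by rewrite /gam /= mulmxA -e.
(* Here [u^-1 = - Kj j], so [-1] lies in [G] and therefore in [H], which absorbs the sign. *)
exists (B, j), (invmx h *m - 1%:M); split => //.
  apply: HM; first exact: HV.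
  apply/HE; split.
    have -> : - 1%:M = invmx u *m invmx (Kj j).
      by rewrite e mulNmx mulmxV// SL2_unit//; exact: KS.
    by apply: GM; apply: GV; exact: KG.
  by exists 0; right; rewrite mulmxN mulNmx mulmx1 mulVmx// hypdiag0.
by rewrite /gam /= mulmxN mulmx1 mulNmx {1}gE e mulmxN mulmxA.
Qed.

Let c i : R[i] := if i.1 \in dc then phi_cst k l m (mid (Defs.repr_of i.1)) else 0.
Let al i : R := mid (Defs.repr_of i.1) 0 1 / mid (Defs.repr_of i.1) 0 0 + i.2%:~R.
Let be i : R := mid (Defs.repr_of i.1) 1 1 / mid (Defs.repr_of i.1) 1 0 + i.2%:~R.
Let f i z : R[i] := c i * psi (al i) (be i) z.

Lemma fE i z : 0 < complex.Im z ->
  f i z = if i.1 \in dc then phi (mid (gam i)) z else 0.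
Proof.
move=> z0; rewrite /f /c; case: ifPn => [/set_mem di|_]; last by rewrite mul0r.
have [Gr _] := repr_dc di; have [a0 c0] := mid_neq0 Gr; have rS := mid_SL2 Gr.
rewrite (phi_sim _ (mid_gam i)) phi_translate// phi_psi ?Im_addR//.
by rewrite psi_shift.
Qed.

Lemma fD i z : 0 < complex.Im z -> f i (z + 1) = f (i.1, i.2 + 1) z.
Proof.
move=> z0; have -> : z + 1 = z + (1 : R)%:C by rewrite rmorph1.
by rewrite /f psi_shift /c /al /be /= intrD !addrA.
Qed.

(** By [phi_H] each [gam i] may be replaced by a translate [h i *m gam i] whose row lengths are
    normalized, which is the setting of [orbit_count] and [normc_phi_i]; [gam_inj] keeps the
    translates distinct. *)
Lemma f_bounded : exists M, bounded_sums (fun i => normc (f i 'i)) M.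
Proof.
pose S := [set i : f_type | dc i.1].
have nex i : exists h, S i -> H h /\ (let g := mid (h *m gam i) in
    row_sqr g 1 <= row_sqr g 0 <= expR l ^+ 2 * row_sqr g 1).
  have [Si|nS] := pselect (S i); last by exists 1%:M.
  have [j hj] := hypdiag_normalize l_gt0 (mid_SL2 (gam_G Si)).
  have [h Hh hs] := Hex j; exists h => _; split=> //.
  move: hj; rewrite /= mid_left; have := simM hs (or_introl (erefl (mid (gam i)))).
  by move=> [->|->]; rewrite ?row_sqrN.
have [h hP] := choice nex.
pose g i := mid (h i *m gam i).
have hG i : S i -> G (h i *m gam i).
  by move=> Si; apply: GM; [apply: HG; have [] := hP _ Si|exact: gam_G].
have E1 : 1 <= expR l by rewrite -expR0 ler_expR ltW.
have [|||| M hM] := @orbit_count _ G sa _ S g (expR l) Gg Giso saS E1.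
- by move=> i Si; apply: mid_SL2; exact: hG.
- move=> i i' Si Si'; have := GM (GV (hG _ Si)) (hG _ Si').
  congr G; rewrite /g /mid; have gS := GS (hG _ Si).
  rewrite (invmxM2 (SL2M (SL2V seS) gS) saS) (invmxM2 (SL2V seS) gS) invmxK.
  by rewrite !mulmxA mulmxV// mul1mx !mulmxK.
- move=> i i' Si Si' /mid_inj e; have [Hh _] := hP _ Si; have [Hh' _] := hP _ Si'.
  apply: (@gam_inj _ _ (invmx (h i') *m h i)) => //; first by apply: HM => //; exact: HV.
  by rewrite -mulmxA e mulKmx// SL2_unit//; exact: HS.
- by move=> i Si; have [] := hP _ Si.
have T0 : 0 <= expR (`|tau| * pi) ^+ 2 by rewrite exprn_ge0// expR_ge0.
have := bounded_sumsZ T0 hM => bnd; eexists; apply: bounded_sumsW bnd => i.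
have i0 : 0 < complex.Im ('i : R[i]) by rewrite /= ltr01.
rewrite fE//; case: (boolP (i.1 \in dc)) => [/set_mem di|nd]; last first.
  by rewrite normc0 mulr_ge0//; case: ifP => // /set_mem; move/negP: nd => + /mem_set.
have Si : S i by [].
rewrite mem_set//; have [Hh _] := hP _ Si.
rewrite -(phi_H Hh (gam_G di) i0); have [a0 c0] := mid_neq0 (hG _ Si).
exact: (normc_phi_i l m k_even k_ge4 (mid_SL2 (hG _ Si)) a0 c0).
Qed.

Let P := poincare_hyp k G eta se l m.

Lemma f_ex z : 0 < complex.Im z -> exists s, sums (f^~ z) s.
Proof.
move=> z0; have [M hM] := f_bounded.
have [C C0 hC] := @family_bound R k./2 tau _ c al be _ (normc z) z0.
by apply: sums_exists (bounded_sumsW _ (bounded_sumsZ C0 hM)) => i; exact: hC.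
Qed.

Lemma slash_sums z : 0 < complex.Im z -> sums (f^~ z) (slash k P sa z).
Proof.
move=> z0; have [s hs] := f_ex z0; suff -> : slash k P sa z = s by [].
have js := jfac_neq0 saS z0; have w0 := Im_moebius_gt0 saS z0.
set w := moebius sa z in w0.
pose F A := powc (moebius (invmx se *m Defs.repr_of A) w) (- (k%:R / 2) + twist l m) *
   jfac (invmx se *m Defs.repr_of A) w ^- k.
(* [usum] has the intended value only once convergence is known, so the sum over left cosets is
   obtained by reindexing the convergent family [f]. *)
suff hF : sums (restr lc (fun A => jfac sa z ^- k * F A)) s.
  rewrite /slash -/w /P /poincare_hyp -/F.
  have hF' : has_sum lc F (jfac sa z ^+ k * s).
    apply/has_sumE; have := sumsZ (jfac sa z ^+ k) hF; congr sums; apply/funext => A.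
    by rewrite /restr; case: ifP => _; rewrite ?mulr0// mulVKf// expf_neq0.
  by rewrite (usumE hF') mulKf// expf_neq0.
apply: (@sums_reindex _ _ _ (fun i => [set h *m gam i | h in H])) hs => A.
have [lA|nA] := pselect (lc A); [left|right]; last first.
  split=> [|i iA]; first by rewrite /restr memNset.
  rewrite fE//; case: ifP => // /set_mem di; exfalso; apply: nA.
  by exists (gam i) => //; exact: gam_G.
have [g Gg' gA] := lA; have [i [h [di Hh gE]]] := gam_surj Gg'.
have Ai : [set x *m gam i | x in H] = A by rewrite -gA gE lcoset_eq.
exists i; split=> //.
  rewrite /restr mem_set// fE// mem_set//.
  have [h' Hh' rE] := lcoset_repr (gam i) H1; rewrite Ai in rE.
  have Gr : G (Defs.repr_of A) by rewrite rE; apply: GM; [exact: HG|exact: gam_G].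
  rewrite /F phi_slash//; last by apply: SL2M; [exact: SL2V|exact: GS].
  by rewrite -/(mid _) rE phi_H//; exact: gam_G.
move=> i' iA f0; have di' : dc i'.1.
  by move: f0; rewrite fE//; case: ifP => [/set_mem//|]; rewrite eqxx.
have : A (gam i') by rewrite -iA; exists 1%:M => //; rewrite mul1mx.
by rewrite -Ai => -[x Hx e]; apply/esym; apply: (gam_inj di di' Hx).
Qed.

(** Translation by 1 only shifts the integer index, under which an unordered sum is invariant. *)
Lemma slash_periodic z : 0 < complex.Im z -> slash k P sa (z + 1) = slash k P sa z.
Proof.
move=> z0; have z1 : 0 < complex.Im (z + 1) by rewrite Im_add /= addr0.
apply: sums_unique (slash_sums z0).
apply: (@sums_reindex _ _ _ (fun i => (i.1, i.2 + 1))) (slash_sums z1) => i; left.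
exists (i.1, i.2 - 1); split.
- by rewrite /= subrK; case: (i).
- by rewrite fD//= subrK; case: (i).
- by move=> [B j] e _; rewrite -e /= addrK.
Qed.

Lemma expansion_ex : exists b : int -> R[i], parabolic_expansion k sa P b /\
  forall n y, 0 < y ->
    sums (fun i => cell (fun x => f i (hline y x) * e_ (- (n%:~R * hline y x))) 0) (b n).
Proof.
have [M hM] := f_bounded.
have [b [b1 b2]] := family_fourier hM slash_sums slash_periodic.
exists b; split=> [z z0|n y y0]; last exact: b2.
by apply/has_sumT; exact: b1.
Qed.

(** Existence makes the selected [parabolic_coeff] a genuine expansion, and [fourier_unique]
    identifies it with the coefficients computed from cells. *)
Lemma expansion_coeff : parabolic_expansion k sa P (parabolic_coeff k sa P) /\
  forall n y, 0 < y ->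
    sums (fun i => cell (fun x => f i (hline y x) * e_ (- (n%:~R * hline y x))) 0)
      (parabolic_coeff k sa P n).
Proof.
have [b [b1 b2]] := expansion_ex.
have h : parabolic_expansion k sa P (parabolic_coeff k sa P).
  by apply: (@xgetPex _ (fun=> 0) [set c | parabolic_expansion k sa P c]); exists b.
split=> //; suff -> : parabolic_coeff k sa P = b by [].
by apply: (@fourier_unique _ (slash k P sa)) => z z0; apply/has_sumT; [exact: h|exact: b1].
Qed.

Let ent_C B : R := mid (Defs.repr_of B) 0 0 * mid (Defs.repr_of B) 1 0.
Let ent_x B : R := mid (Defs.repr_of B) 0 1 / (2 * mid (Defs.repr_of B) 0 0) +
  mid (Defs.repr_of B) 1 1 / (2 * mid (Defs.repr_of B) 1 0).
Let term (n : int) B : R[i] :=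
  e_ (m%:~R / l * ln `|mid (Defs.repr_of B) 0 0 / mid (Defs.repr_of B) 1 0| + n%:~R * ent_x B)%:C.
Local Notation kern := (par_kernel k l m).

(** [b/a] and [d/c] have midpoint [ent_x B] and, by [a d - b c = 1], half difference
    [r = 1 / (2 a c)]; translating by the midpoint leaves [psi (- r) r]. The integer [j] adds
    nothing to the exponential, and [a / c] has the sign of [r]. *)
Lemma f_kernel n B (j : int) y x : dc B -> 0 < y ->
  f (B, j) (hline y x) * e_ (- (n%:~R * hline y x)) =
  ((ent_C B) ^- k./2)%:C * term n B * kern y n (1 / (2 * ent_C B)) (x + (ent_x B + j%:~R)).
Proof.
move=> dB y0; have [Gr _] := repr_dc dB; have [a0 c0] := mid_neq0 Gr.
have dE := SL2E (mid_SL2 Gr).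
rewrite /f /c /al /be /= mem_set// /term /ent_C /ent_x /par_kernel /phi_cst.
move: (mid (Defs.repr_of B)) a0 c0 dE => g a0 c0 dE.
set r := 1 / (2 * (g 0 0 * g 1 0)).
set X := g 0 1 / (2 * g 0 0) + g 1 1 / (2 * g 1 0) + j%:~R.
have rE : r = (g 0 0 * g 1 1 - g 0 1 * g 1 0) / (2 * (g 0 0 * g 1 0)) by rewrite dE.
have -> : g 0 1 / g 0 0 + j%:~R = - r + X by rewrite rE /X; field; rewrite a0 c0.
have -> : g 1 1 / g 1 0 + j%:~R = r + X by rewrite rE /X; field; rewrite a0 c0.
rewrite -psi_shift -hlineD.
have -> : sgn_log (g 0 0 / g 1 0) = sgn_log r.
  rewrite /sgn_log; have -> : g 0 0 / g 1 0 = r * (2 * g 0 0 ^+ 2).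
    by rewrite /r; field; rewrite a0 c0.
  by rewrite pmulr_lgt0// mulr_gt0// exprn_even_gt0.
set Y := g 0 1 / (2 * g 0 0) + g 1 1 / (2 * g 1 0) in X *.
have -> : e_ (- (n%:~R * hline y x)) = e_ (n%:~R * Y)%:C * e_ (- (n%:~R * hline y (x + X))).
  rewrite hlineD (mulrDr _ (hline y x)) opprD e_D mulrCA -e_D.
  have -> : (n%:~R * Y)%:C - n%:~R * X%:C = (- (n * j))%:~R.
    rewrite -(rmorph_int (real_complex R) n) -(rmorph_int (real_complex R) (- (n * j))).
    by rewrite -rmorphM -rmorphB/=; congr _%:C; rewrite /X intrN intrM; ring.
  by rewrite e_int mulr1.
rewrite mulrDr expcD rmorphD e_D.
have -> : (0 +i* tau) * (ln `|g 0 0 / g 1 0|)%:C =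
    (0 +i* (2 * pi)) * (m%:~R / l * ln `|g 0 0 / g 1 0|)%:C.
  by apply: complexP => /=; rewrite /tau; ring.
by rewrite -/(e_ _); ring.
Qed.

Lemma kern_lip n y r : 0 < y -> loc_lip (kern y n r).
Proof.
move=> y0; have := loc_lipZ (expc ((0 +i* tau) * sgn_log r)) (loc_taylor_lip
  (loc_taylor_mul (@psi_loc_taylor R k./2 tau (- r) r) (loc_taylor_e n)) y0).
by congr loc_lip; apply/funext => x; rewrite /par_kernel mulrA.
Qed.

Lemma dcoset_sums n B y : dc B -> 0 < y ->
  sums (fun j : int => cell (fun x => f (B, j) (hline y x) * e_ (- (n%:~R * hline y x))) 0)
    (((ent_C B) ^- k./2)%:C * term n B * I_par k y l m n (1 / (2 * ent_C B))).
Proof.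
move=> dB y0; have [Gr _] := repr_dc dB; have [a0 c0] := mid_neq0 Gr.
have C0 : ent_C B != 0 by rewrite mulf_neq0.
have r0 : 1 / (2 * ent_C B) != 0 by rewrite mulf_neq0 ?oner_eq0// invr_eq0 mulf_neq0.
set r := 1 / (2 * ent_C B) in r0 *; set W := _ * term n B.
have W0 : W != 0.
  by rewrite mulf_neq0 ?e_neq0// (inj_eq (@complexI R)) invr_eq0 expf_neq0.
have kL := kern_lip n r y0.
rewrite I_parE//; have -> : (fun j : int => cell (fun x => f (B, j) (hline y x) *
    e_ (- (n%:~R * hline y x))) 0) = (fun j => W * cell (kern y n r) (ent_x B + j%:~R)).
  apply/funext => j; under [in LHS]eq_fun do rewrite f_kernel//.
  by rewrite (cellZ _ _ (loc_lip_shift _ kL)) cell_shift// add0r.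
apply: sumsZ; have [M hM] := f_bounded.
have [Q Q0 hQ] := @family_bound R k./2 tau _ c al be y (1 + `|y|) y0.
pose E := expR (2 * pi * (n%:~R * y)).
have D0 : 0 <= (normc W)^-1 * (Q * E) by rewrite mulr_ge0 ?invr_ge0 ?normc_ge0// mulr_ge0// expR_ge0.
(* The kernel on a cell is the term of [f] at [(B, j)], twisted by the exponential and divided by
   [W], so its bounds form a subfamily of those in [f_bounded]. *)
apply: (@sums_cells _ _ _ (fun j => (normc W)^-1 * (Q * E) * normc (f (B, j) 'i)) _ kL).
  move=> j t /andP[t0 t1]; have := f_kernel n j t dB y0; rewrite -/W -/r addrC => e.
  have -> : kern y n r (ent_x B + j%:~R + t) = W^-1 * (f (B, j) (hline y t) * e_ (- (n%:~R * hline y t))).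
    by rewrite e mulKf.
  rewrite normcM [normc (f _ _ * _)]normcM normcV -[leRHS]mulrA ler_wpM2l ?invr_ge0 ?normc_ge0//.
  have -> : normc (e_ (- (n%:~R * hline y t))) = E.
    by rewrite normc_e Im_opp Im_mul -(rmorph_int (real_complex R))/= mul0r addr0 mulrN opprK.
  rewrite [Q * E]mulrC -mulrA [leLHS]mulrC ler_wpM2l ?expR_ge0//.
  apply: hQ; first exact: lexx.
  by rewrite (le_trans (normc_le_ReIm _))//= lerD2r ger0_norm.
apply: bounded_sumsZ D0 _ => J; pose J' := [fset (B, j) | j in J]%fset.
apply: le_trans (hM J'); rewrite big_imfset//= => j j' _ _ [//].
Qed.

Lemma coeff_dcosets n y : 0 < y ->
  sums (fun B => if B \in dc then ((ent_C B) ^- k./2)%:C * term n B *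
    I_par k y l m n (1 / (2 * ent_C B)) else 0) (parabolic_coeff k sa P n).
Proof.
move=> y0; have [_ /(_ n y y0)] := expansion_coeff.
apply: (@sums_partition _ _ _ (fun i : f_type => i.1)) => B; case: ifPn => [/set_mem dB|nB].
  apply: (@sums_reindex _ _ _ (fun j : int => (B, j))) (dcoset_sums n dB y0) => i.
  have [iB|iB] := eqVneq i.1 B; [left|right].
    by exists i.2; split; rewrite -?iB; case: (i) => // B' j' j [].
  by split=> // j e; move: iB; rewrite -e eqxx.
have := @sums_cst0 R f_type; congr sums; apply/funext => i.
case: eqP => // iB; rewrite (_ : (fun x => _) = (fun=> 0 * 0)).
  have zL : loc_lip (fun _ : R => 0 : R[i]).
    by move=> b; exists 0 => *; rewrite subrr normc0 mul0r.
  by rewrite (cellZ _ _ zL) mul0r.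
by apply/funext => x; rewrite /f /c iB (negbTE nB) !mul0r.
Qed.

Lemma coeff_sum n y : 0 < y ->
  has_sum (C_set G se sa)
    (fun C : R => (C ^- k./2)%:C * I_par k y l m n (1 / (2 * C)) * S_sum G eta a se sa l m n C)
    (parabolic_coeff k sa P n).
Proof.
move=> y0; apply/has_sumE; have hc := coeff_dcosets n y0.
apply: (@sums_partition _ _ _ ent_C _ _ _ _ hc) => C; rewrite /restr.
have [CC|nC] := pselect (C_set G se sa C); last first.
  rewrite memNset//; have := @sums_cst0 R (set 'M[R]_2); congr sums; apply/funext => B.
  case: eqP => // BC; case: ifP => // /set_mem dB; exfalso; apply: nC.
  have [Gr _] := repr_dc dB; rewrite -BC /ent_C.
  by exists (mid (Defs.repr_of B)) => //; exists (Defs.repr_of B).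
rewrite mem_set//; set w := _ * I_par _ _ _ _ _ _.
pose A := [set B | dc B /\ ent_C B = C].
have -> : (fun B => if ent_C B == C then (if B \in dc then (ent_C B ^- k./2)%:C * term n B *
    I_par k y l m n (1 / (2 * ent_C B)) else 0) else 0) = (fun B => w * restr A (term n) B).
  apply/funext => B; rewrite /restr; case: eqP => BC; last first.
    by rewrite memNset ?mulr0// => -[].
  case: ifPn => dB; last first.
    by rewrite memNset ?mulr0// => -[/mem_set dB' _]; move: dB; rewrite dB'.
  by rewrite mem_set; [rewrite BC /w; ring|split=> //; exact: set_mem].
(* If [w = 0] the product is 0 whatever value [usum] gives to [S_sum]. Otherwise division by [w]
   transfers the absolute convergence of the sum over double cosets to the Kloosterman sum, so that
   its [usum] is a true sum. *)
have [w0|w0] := eqVneq w 0.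
  rewrite w0 mul0r; under eq_fun do rewrite mul0r; exact: sums_cst0.
apply: sumsZ.
have [M hM] := sums_bounded hc.
have [s hs] : exists s, sums (restr A (term n)) s.
  have n0 : 0 <= (normc w)^-1 by rewrite invr_ge0 normc_ge0.
  apply: sums_exists (bounded_sumsW _ (bounded_sumsZ n0 hM)) => B.
  rewrite /restr; case: ifPn => [/set_mem[dB BC]|_]; last by rewrite normc0 mulr_ge0 ?normc_ge0.
  rewrite mem_set// -normcV -normcM BC.
  by rewrite [X in w^-1 * X](_ : _ = w * term n B) ?mulKf// /w; ring.
suff -> : S_sum G eta a se sa l m n C = s by [].
by apply: usumE; apply/has_sumE.
Qed.

End Expansion.

Theorem theorem4p8 (R : realType) (k : nat) (k_even : ~~ odd k)
    (k_ge4 : (4 <= k)%N)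
    (G : set 'M[R]_2) (G_fuchsian : fuchsian_first_kind G)
    (a : option R) (a_cusp : is_cusp G a)
    (sa : 'M[R]_2) (sa_scaling : scaling_cusp G a sa)
    (eta : option R * option R) (eta_pair : hyperbolic_pair G eta)
    (se : 'M[R]_2) (l : R) (l_gt0 : 0 < l)
    (se_scaling : scaling_pair G eta se l)
    (m : int) :
  let P := poincare_hyp k G eta se l m in
  parabolic_expansion k sa P (parabolic_coeff k sa P) /\
  forall (n : int) (y : R), 0 < y ->
    has_sum (C_set G se sa)
      (fun C : R => (C ^- k./2)%:C * I_par k y l m n (1 / (2 * C))
                    * S_sum G eta a se sa l m n C)
      (parabolic_coeff k sa P n).
Proof.
case: G_fuchsian => Gg Giso _ P; split=> [|n y y0].
  by have [] := expansion_coeff m k_even k_ge4 l_gt0 Gg Giso sa_scaling se_scaling.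
exact: coeff_sum.
Qed.
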